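(* Let $h:\mathbb{R}\to\mathbb{R}$ be a twice continuously differentiable $2\pi$-periodic function. Suppose in addition that: (1) $h''$ has no zeros on $(0,\pi)$; (2) $h$ is odd; (3) there exist functions $m_0$ and $m_\pi$, positive and increasing on $(0,4c)$ for some $c>0$, and a constant $C>0$ such that $$\frac{m_0(2t)}{m_0(t)}\le C,\qquad \frac{m_\pi(2t)}{m_\pi(t)}\le C,\qquad 0<t<2c,$$ and $$m_0(t)\le h''(t)\le C\,m_0(t),\qquad m_\pi(t)\le h''(\pi-t)\le C\,m_\pi(t),\qquad 0<t<4c.$$ Then, as the real variable $x$ tends to $+\infty$, $$\frac{1}{\sqrt x}\left\lVert e^{ixh(t)}\right\rVert_A\longrightarrow\left(\frac{2}{\pi}\right)^{3/2}\int_0^\pi\sqrt{h''(t)}\,dt .$$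
   Context: For a $2\pi$-periodic function $f$ with an absolutely convergent Fourier series $f(t)=\sum_{\nu=-\infty}^{\infty}a_\nu e^{i\nu t}$, the norm is $\lVert f\rVert_A=\sum_{\nu=-\infty}^{\infty}|a_\nu|$. *)

(* Defs.v *)
From Stdlib Require Import Reals ZArith.
From Coquelicot Require Import Coquelicot.

Open Scope R_scope.

(* [Cis u] is e^{iu}; Coquelicot has no complex exponential. *)
Definition Cis (u : R) : C := (cos u, sin u).

Definition periodic_2pi {T : Type} (f : R -> T) : Prop :=
  forall t : R, f (t + 2 * PI) = f t.

(* Differentiability of [h] itself is listed separately because [Derive] is
   total: [ex_derive (Derive h) t] does not imply [ex_derive h t]. *)
Definition C2 (h : R -> R) : Prop :=
  (forall t : R, ex_derive h t) /\
  (forall t : R, ex_derive (Derive h) t) /\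
  (forall t : R, continuous (Derive_n h 2) t).

(* Families indexed by Z are summed as two one-sided series, over
   0, 1, 2, ... and over -1, -2, ... ; for absolutely convergent families this
   does not depend on the order of summation. *)
Definition nonneg_part {T : Type} (a : Z -> T) (n : nat) : T := a (Z.of_nat n).
Definition neg_part {T : Type} (a : Z -> T) (n : nat) : T :=
  a (- Z.of_nat (S n))%Z.

Definition ex_Zseries (a : Z -> R) : Prop :=
  ex_series (nonneg_part a) /\ ex_series (neg_part a).

Definition Zseries (a : Z -> R) : R :=
  Series (nonneg_part a) + Series (neg_part a).

Definition is_CZseries (a : Z -> C) (l : C) : Prop :=
  exists lp ln : C,
    is_series (K := R_AbsRing) (V := C_R_NormedModule) (nonneg_part a) lp /\
    is_series (K := R_AbsRing) (V := C_R_NormedModule) (neg_part a) ln /\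
    l = (lp + ln)%C.

Definition fourier_coeff (f : R -> C) (nu : Z) : C :=
  (RtoC (/ (2 * PI)) *
   RInt (V := C_R_CompleteNormedModule)
     (fun t : R => (f t * Cis (- (IZR nu * t)))%C) (- PI) PI)%C.

Definition abs_conv_fourier (f : R -> C) : Prop :=
  periodic_2pi f /\
  ex_RInt (V := C_R_NormedModule) f (- PI) PI /\
  ex_Zseries (fun nu : Z => Cmod (fourier_coeff f nu)) /\
  forall t : R,
    is_CZseries (fun nu : Z => (fourier_coeff f nu * Cis (IZR nu * t))%C) (f t).

(* Only meaningful when [abs_conv_fourier f] holds. *)
Definition A_norm (f : R -> C) : R :=
  Zseries (fun nu : Z => Cmod (fourier_coeff f nu)).

Definition nondecreasing_on (m : R -> R) (a b : R) : Prop :=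
  forall s t : R, a < s -> s <= t -> t < b -> m s <= m t.

(* Main.v *)
Require Import Defs.
From Stdlib Require Import Reals ZArith Lra Lia.
From Coquelicot Require Import Coquelicot.

Open Scope R_scope.

(** Write [h''] for the second derivative and [e(u)] for [exp (i u)]. As [h] is odd,
    the [n]-th Fourier coefficient of [e(x h)] is real and equals [1/pi] times the
    integral [coeff h x n] of [cos (x h - n t)] over [[0,pi]]. There [h] is convex,
    so each frequency [n] has at most one stationary point, the [t] with
    [x h'(t) = n]. The frequencies fall into three groups.

    Bulk: the stationary point stays in a fixed [[p,q]] inside [(0,pi)]. Stationary
    phase, with the Fresnel integrals ([coeff_stationary], [fresnel_limits]), gives
    [sqrt x |coeff| ~ sqrt (2 pi / h''(t_n)) |cos (theta_n + pi/4)|], where [theta_n]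
    is the stationary value of the phase. By convexity [theta] is a Legendre transform
    of [h], so its increment in [n] is nearly [- t_n], which varies slowly. A Weyl sum
    argument ([negligible_weyl]) then equidistributes [theta_n] modulo [pi], and
    [|cos|] may be replaced by its mean [2/pi] ([abs_cos_equidistributed]). Since unit
    steps in [n] are steps of [1/x] for [h''(t) dt] ([riemann_sum]), the sum over the
    bulk is asymptotic to [sqrt x] times [(2/pi) sqrt (2 pi)] times the integral of
    [sqrt h''] over [[p,q]] ([bulk_limit]).

    Edges: the stationary point is within [delta] of [0] or [pi]. Monotonicity and
    doubling of the comparison functions give [|coeff| = O(1 / sqrt (x h''(t_n)))] up
    to harmless terms ([coeff_edge]), and the sum over an edge is
    [O(sqrt x)] times the integral of [sqrt h''] over it, plus [O(1)]. The substitution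
    [t -> pi - t] exchanges the two edges up to a sign ([coeff_reflect]).

    Outside: there is no stationary point. One integration by parts, whose boundary
    terms vanish at integer frequencies, bounds the sum by a logarithm
    ([coefficient_sum_outer]).

    Letting [x] tend to infinity and then [delta] to [0] gives the limit, because
    [(2/pi) sqrt (2 pi) / pi = (2/pi)^(3/2)]. The same bounds make the coefficients
    summable for every [x]; that the Fourier series has sum [e(x h)] is the inversion
    theorem for twice differentiable functions ([fourier_inversion]). *)

(** * Continuity and elementary estimates *)

Lemma cR_plus (f g : R -> R) t : continuous f t -> continuous g t ->
  continuous (fun u => f u + g u) t.
Proof. intros Hf Hg. exact (continuous_plus f g t Hf Hg). Qed.

Lemma cR_opp (f : R -> R) t : continuous f t -> continuous (fun u => - f u) t.
Proof. intros Hf. exact (continuous_opp f t Hf). Qed.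

Lemma cR_minus (f g : R -> R) t : continuous f t -> continuous g t ->
  continuous (fun u => f u - g u) t.
Proof. intros Hf Hg. exact (continuous_minus f g t Hf Hg). Qed.

Lemma cR_mult (f g : R -> R) t : continuous f t -> continuous g t ->
  continuous (fun u => f u * g u) t.
Proof. intros Hf Hg. exact (continuous_mult f g t Hf Hg). Qed.

Lemma cR_comp (h g : R -> R) t : (forall s, continuous h s) -> continuous g t ->
  continuous (fun u => h (g u)) t.
Proof. intros Hh Hg. exact (continuous_comp g h t Hg (Hh (g t))). Qed.

Lemma cR_inv (f : R -> R) t : continuous f t -> f t <> 0 ->
  continuous (fun u => / f u) t.
Proof.
  intros Hf Hn. apply (continuous_comp f Rinv t Hf).
  apply (ex_derive_continuous (K := R_AbsRing) (V := R_NormedModule)).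
  auto_derive. exact Hn.
Qed.

Lemma cR_cos t : continuous cos t.
Proof. apply (ex_derive_continuous (K := R_AbsRing) (V := R_NormedModule)). auto_derive. exact I. Qed.

Lemma cR_sin t : continuous sin t.
Proof. apply (ex_derive_continuous (K := R_AbsRing) (V := R_NormedModule)). auto_derive. exact I. Qed.

Lemma cR_derive (f f1 : R -> R) t : is_derive f t (f1 t) -> continuous f t.
Proof. intros H. apply (ex_derive_continuous (K := R_AbsRing) (V := R_NormedModule)). exists (f1 t). exact H. Qed.

Ltac cont := intros; repeat match goal with
  | H : ?P |- ?P => exact H
  | H : forall t, continuous ?h t |- continuous ?h _ => apply H
  | |- continuous (fun _ => ?c) _ => apply continuous_const
  | |- continuous (fun x => x) _ => apply continuous_id
  | |- continuous (Rmult ?c) _ => apply (cR_mult (fun _ => c) (fun x => x))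
  | |- continuous (Rplus ?c) _ => apply (cR_plus (fun _ => c) (fun x => x))
  | |- continuous (Rminus ?c) _ => apply (cR_minus (fun _ => c) (fun x => x))
  | |- continuous cos _ => apply cR_cos
  | |- continuous sin _ => apply cR_sin
  | |- continuous sqrt _ => apply continuous_sqrt
  | |- continuous Rabs _ => apply continuous_Rabs
  | |- continuous (fun x => _ + _) _ => apply cR_plus
  | |- continuous (fun x => _ - _) _ => apply cR_minus
  | |- continuous (fun x => _ * _) _ => apply cR_mult
  | |- continuous (fun x => - _) _ => apply cR_opp
  | |- continuous (fun x => _ ^ 2) _ => simpl
  | |- continuous (fun x => cos _) _ => apply (cR_comp cos); [exact cR_cos|]
  | |- continuous (fun x => sin _) _ => apply (cR_comp sin); [exact cR_sin|]
  | |- continuous (fun x => sqrt _) _ => apply (cR_comp sqrt); [exact continuous_sqrt|]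
  | |- continuous (fun x => Rabs _) _ => apply (cR_comp Rabs); [exact continuous_Rabs|]
  | H : forall t, is_derive ?h t _ |- continuous ?h _ => eapply cR_derive; apply H
  | H : forall t, continuous ?h t |- continuous (fun x => ?h _) _ =>
      apply (cR_comp h); [exact H|]
  | H : forall t, is_derive ?h t _ |- continuous (fun x => ?h _) _ =>
      apply (cR_comp h); [intros; eapply cR_derive; apply H|]
  end.

(** Integral and derivative lemmas leave equations typed in a module structure,
    on which [ring] and [field] do not act. *)
Ltac eqR := match goal with |- ?a = ?b => change (@eq R a b) end.

Lemma ex_RInt_cont (f : R -> R) a b : (forall t, continuous f t) -> ex_RInt f a b.
Proof. intros H. apply (ex_RInt_continuous (V := R_CompleteNormedModule)); auto. Qed.

Lemma is_derive_value (f : R -> R) (t l l' : R) : is_derive f t l -> l = l' -> is_derive f t l'.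
Proof. now intros H <-. Qed.

Lemma is_derive_RInt_cont (f : R -> R) a t : (forall s, continuous f s) ->
  is_derive (fun b => RInt f a b) t (f t).
Proof.
  intros H. apply is_derive_RInt with (a := a); [|apply H].
  apply filter_forall. intros b. apply RInt_correct. now apply ex_RInt_cont.
Qed.

Lemma RInt_chasles (f : R -> R) a b c : (forall t, continuous f t) ->
  RInt f a c = RInt f a b + RInt f b c.
Proof.
  intros H. symmetry. apply (RInt_Chasles f a b c); now apply ex_RInt_cont.
Qed.

Lemma RInt_sub_cont (f g : R -> R) a b : (forall t, continuous f t) -> (forall t, continuous g t) ->
  RInt (fun t => f t - g t) a b = RInt f a b - RInt g a b.
Proof. intros Hf Hg. apply (RInt_minus f g a b); now apply ex_RInt_cont. Qed.

Lemma RInt_add_cont (f g : R -> R) a b : (forall t, continuous f t) -> (forall t, continuous g t) ->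
  RInt (fun t => f t + g t) a b = RInt f a b + RInt g a b.
Proof. intros Hf Hg. apply (RInt_plus f g a b); now apply ex_RInt_cont. Qed.

Lemma RInt_scal_cont (k : R) (f : R -> R) a b : (forall t, continuous f t) ->
  RInt (fun t => k * f t) a b = k * RInt f a b.
Proof. intros Hf. apply (RInt_scal f a b k); now apply ex_RInt_cont. Qed.

Lemma RInt_constant c a b : RInt (fun _ => c) a b = c * (b - a).
Proof. rewrite RInt_const. apply Rmult_comm. Qed.

Lemma RInt_abs_bound (f : R -> R) a b M : a <= b -> (forall t, continuous f t) ->
  (forall t, a <= t <= b -> Rabs (f t) <= M) -> Rabs (RInt f a b) <= M * (b - a).
Proof.
  intros Hab Hf HM. rewrite Rmult_comm. apply abs_RInt_le_const; auto. now apply ex_RInt_cont.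
Qed.

Lemma RInt_ftc (F f : R -> R) a b : (forall t, is_derive F t (f t)) ->
  (forall t, continuous f t) -> RInt f a b = F b - F a.
Proof.
  intros HF Hf. apply is_RInt_unique. apply (is_RInt_derive F f a b); intros; auto.
Qed.

Lemma nondecreasing_of_derive (f f1 : R -> R) a b : a <= b ->
  (forall t, a <= t <= b -> is_derive f t (f1 t)) ->
  (forall t, a <= t <= b -> 0 <= f1 t) -> f a <= f b.
Proof.
  intros Hab Hd Hp.
  destruct (MVT_gen f a b f1) as [c [Hc He]]; rewrite ?Rmin_left, ?Rmax_right in * by lra.
  - intros t Ht. apply Hd. lra.
  - intros t Ht. apply continuity_pt_filterlim. eapply cR_derive. now apply Hd.
  - specialize (Hp c Hc). nra.
Qed.

(** The mean value inequality with a variable majorant. It stands in for integration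
    by parts: a primitive minus its boundary term has a small derivative. *)
Lemma increment_bound (P Q P1 Q1 : R -> R) a b : a <= b ->
  (forall t, a <= t <= b -> is_derive P t (P1 t)) ->
  (forall t, a <= t <= b -> is_derive Q t (Q1 t)) ->
  (forall t, a <= t <= b -> Rabs (P1 t) <= Q1 t) ->
  Rabs (P b - P a) <= Q b - Q a.
Proof.
  intros Hab HP HQ H.
  assert (H1 : Q a - P a <= Q b - P b).
  { apply (nondecreasing_of_derive (fun t => Q t - P t) (fun t => Q1 t - P1 t)); auto.
    - intros t Ht. apply (is_derive_minus Q P); auto.
    - intros t Ht. specialize (H t Ht). apply Rabs_le_between in H. lra. }
  assert (H2 : Q a + P a <= Q b + P b).
  { apply (nondecreasing_of_derive (fun t => Q t + P t) (fun t => Q1 t + P1 t)); auto.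
    - intros t Ht. apply (is_derive_plus Q P); auto.
    - intros t Ht. specialize (H t Ht). apply Rabs_le_between in H. lra. }
  apply Rabs_le. lra.
Qed.

Lemma Rabs_cos_le u : Rabs (cos u) <= 1.
Proof. apply Rabs_le, COS_bound. Qed.

Lemma Rabs_sin_le u : Rabs (sin u) <= 1.
Proof. apply Rabs_le, SIN_bound. Qed.

(** * Oscillatory integrals *)

(** One integration by parts with [W = w / phi']: since [|sin| <= 1], the
    remaining integral is at most the total variation of [W]. *)
Lemma oscillation_by_parts (phi phi1 w W W1 : R -> R) a b : a <= b ->
  (forall t, a <= t <= b -> is_derive phi t (phi1 t)) ->
  (forall t, a <= t <= b -> is_derive W t (W1 t)) ->
  (forall t, a <= t <= b -> W1 t <= 0) ->
  (forall t, a <= t <= b -> W t * phi1 t = w t) ->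
  (forall t, continuous (fun s => w s * cos (phi s)) t) ->
  Rabs (RInt (fun s => w s * cos (phi s)) a b - (W b * sin (phi b) - W a * sin (phi a)))
  <= W a - W b.
Proof.
  intros Hab Hphi HW HW1 Hw Hc.
  set (g := fun s => w s * cos (phi s)).
  pose proof (increment_bound (fun t => RInt g a t - W t * sin (phi t)) (fun t => - W t)
    (fun t => - (W1 t * sin (phi t))) (fun t => - W1 t) a b Hab) as B.
  cbv beta in B.
  replace (RInt g a b - (W b * sin (phi b) - W a * sin (phi a)))
    with (RInt g a b - W b * sin (phi b) - (RInt g a a - W a * sin (phi a)))
    by (rewrite (RInt_point a g); unfold zero; simpl; ring).
  replace (W a - W b) with (- W b - - W a) by ring.
  apply B; clear B.
  - intros t Ht.
    replace (- (W1 t * sin (phi t)))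
      with (g t - (W1 t * sin (phi t) + W t * (phi1 t * cos (phi t)))).
    2: { unfold g. rewrite <- (Hw t Ht). ring. }
    apply (is_derive_minus (fun t => RInt g a t) (fun t => W t * sin (phi t))).
    + now apply is_derive_RInt_cont.
    + apply (is_derive_mult W (fun t => sin (phi t)));
        [now apply HW | | intros; apply Rmult_comm].
      apply (is_derive_comp sin phi); [apply is_derive_sin | now apply Hphi].
  - intros t Ht. apply (is_derive_opp W). now apply HW.
  - intros t Ht. rewrite Rabs_Ropp, Rabs_mult, (Rabs_left1 (W1 t)) by now apply HW1.
    assert (Rabs (sin (phi t)) <= 1) by apply Rabs_sin_le.
    specialize (HW1 t Ht). nra.
Qed.

Definition phase (phi phi1 phi2 : R -> R) : Prop :=
  (forall t, is_derive phi t (phi1 t)) /\ (forall t, is_derive phi1 t (phi2 t)).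

Lemma phase_cos_continuous phi phi1 phi2 : phase phi phi1 phi2 ->
  forall t, continuous (fun s => cos (phi s)) t.
Proof. intros [H _]. cont. Qed.

Lemma phase_slope_le phi phi1 phi2 a b : phase phi phi1 phi2 -> a <= b ->
  (forall t, a <= t <= b -> 0 <= phi2 t) -> phi1 a <= phi1 b.
Proof. intros [_ H] Hab Hp. apply (nondecreasing_of_derive phi1 phi2); auto. Qed.

Lemma phase_slope_growth phi phi1 phi2 l a b : phase phi phi1 phi2 -> a <= b ->
  (forall t, a <= t <= b -> l <= phi2 t) -> l * (b - a) <= phi1 b - phi1 a.
Proof.
  intros [_ H] Hab Hp.
  assert (phi1 a - l * a <= phi1 b - l * b); [|lra].
  apply (nondecreasing_of_derive (fun t => phi1 t - l * t) (fun t => phi2 t - l)); auto.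
  - intros t Ht. apply (is_derive_minus phi1 (fun t => l * t)); auto.
    auto_derive; auto. ring.
  - intros t Ht. specialize (Hp t Ht). lra.
Qed.

Lemma convex_phase_by_parts phi phi1 phi2 a b : phase phi phi1 phi2 -> a <= b ->
  (forall t, a <= t <= b -> phi1 t <> 0) -> (forall t, a <= t <= b -> 0 <= phi2 t) ->
  Rabs (RInt (fun s => cos (phi s)) a b - (sin (phi b) / phi1 b - sin (phi a) / phi1 a))
  <= / phi1 a - / phi1 b.
Proof.
  intros H Hab Hn Hp.
  pose proof (oscillation_by_parts phi phi1 (fun _ => 1) (fun t => / phi1 t)
    (fun t => - phi2 t / phi1 t ^ 2) a b Hab) as B.
  rewrite (RInt_ext (fun s => cos (phi s)) (fun s => 1 * cos (phi s)))
    by (intros; symmetry; apply Rmult_1_l).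
  replace (sin (phi b) / phi1 b) with (/ phi1 b * sin (phi b)) by (unfold Rdiv; ring).
  replace (sin (phi a) / phi1 a) with (/ phi1 a * sin (phi a)) by (unfold Rdiv; ring).
  apply B; clear B.
  - intros t _. apply H.
  - intros t Ht. apply (is_derive_inv phi1); [apply H | now apply Hn].
  - intros t Ht. specialize (Hn t Ht). specialize (Hp t Ht).
    assert (0 < / phi1 t ^ 2) by (apply Rinv_0_lt_compat, pow2_gt_0; auto).
    unfold Rdiv. nra.
  - intros t Ht. field. now apply Hn.
  - pose proof (phase_cos_continuous _ _ _ H). cont.
Qed.

Lemma inv_le_between l y : 0 < l -> l <= y \/ y <= - l -> - / l <= / y <= / l.
Proof.
  intros Hl [H|H].
  - assert (0 < / y) by (apply Rinv_0_lt_compat; lra).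
    assert (/ y <= / l) by (apply Rinv_le_contravar; lra).
    assert (0 < / l) by (apply Rinv_0_lt_compat; lra). lra.
  - assert (0 < / - y) by (apply Rinv_0_lt_compat; lra).
    assert (/ - y <= / l) by (apply Rinv_le_contravar; lra).
    rewrite Rinv_opp in *.
    assert (0 < / l) by (apply Rinv_0_lt_compat; lra). lra.
Qed.

(** Van der Corput's first derivative test: [1 / phi'] is monotone and at most [1 / l]
    in size, so the boundary terms and its variation add up to at most [2 / l]. *)
Lemma first_derivative_test phi phi1 phi2 l a b : phase phi phi1 phi2 -> a <= b -> 0 < l ->
  (forall t, a <= t <= b -> 0 <= phi2 t) -> l <= phi1 a \/ phi1 b <= - l ->
  Rabs (RInt (fun s => cos (phi s)) a b) <= 2 / l.
Proof.
  intros H Hab Hl Hp Hs.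
  assert (Hall : forall t, a <= t <= b -> l <= phi1 t \/ phi1 t <= - l).
  { intros t Ht. destruct Hs as [Hs|Hs].
    - left. apply Rle_trans with (1 := Hs). apply (phase_slope_le phi phi1 phi2); auto; [lra|].
      intros; apply Hp; lra.
    - right. apply Rle_trans with (2 := Hs). apply (phase_slope_le phi phi1 phi2); auto; [lra|].
      intros; apply Hp; lra. }
  assert (Hn : forall t, a <= t <= b -> phi1 t <> 0).
  { intros t Ht. specialize (Hall t Ht). lra. }
  pose proof (convex_phase_by_parts phi phi1 phi2 a b H Hab Hn Hp) as B.
  assert (Ha := Hall a ltac:(lra)). assert (Hb := Hall b ltac:(lra)).
  unfold Rdiv in *. apply Rabs_le_between in B.
  pose proof (SIN_bound (phi a)). pose proof (SIN_bound (phi b)).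
  apply Rabs_le.
  destruct Hs as [Hs|Hs].
  - assert (Hb' : l <= phi1 b).
    { apply Rle_trans with (1 := Hs). apply (phase_slope_le phi phi1 phi2); auto. }
    pose proof (inv_le_between l _ Hl (or_introl Hs)).
    pose proof (inv_le_between l _ Hl (or_introl Hb')).
    assert (0 < / phi1 a) by (apply Rinv_0_lt_compat; lra).
    assert (0 < / phi1 b) by (apply Rinv_0_lt_compat; lra). nra.
  - assert (Ha' : phi1 a <= - l).
    { apply Rle_trans with (2 := Hs). apply (phase_slope_le phi phi1 phi2); auto. }
    pose proof (inv_le_between l _ Hl (or_intror Hs)).
    pose proof (inv_le_between l _ Hl (or_intror Ha')).
    assert (/ phi1 a < 0) by (apply Rinv_lt_0_compat; lra).
    assert (/ phi1 b < 0) by (apply Rinv_lt_0_compat; lra). nra.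
Qed.

Lemma RInt_cos_trivial phi phi1 phi2 a b : phase phi phi1 phi2 -> a <= b ->
  Rabs (RInt (fun s => cos (phi s)) a b) <= b - a.
Proof.
  intros H Hab. replace (b - a) with (1 * (b - a)) by ring.
  apply RInt_abs_bound; auto.
  - now apply (phase_cos_continuous phi phi1 phi2).
  - intros t _. apply Rabs_cos_le.
Qed.

(** Van der Corput's second derivative test: the first derivative test outside
    the window of radius [1 / sqrt l] about the stationary point. *)
Lemma second_derivative_test phi phi1 phi2 l a tau b : phase phi phi1 phi2 ->
  a <= tau <= b -> 0 < l ->
  (forall t, a <= t <= b -> l <= phi2 t) -> phi1 tau = 0 ->
  Rabs (RInt (fun s => cos (phi s)) a b) <= 6 / sqrt l.
Proof.
  intros H Hab Hl Hp Hz.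
  set (r := / sqrt l).
  assert (Hsl : 0 < sqrt l) by now apply sqrt_lt_R0.
  assert (Hr : 0 < r) by now apply Rinv_0_lt_compat.
  assert (Hlr : l * r = sqrt l).
  { unfold r. rewrite <- (sqrt_sqrt l) at 1 by lra. field. lra. }
  set (u := Rmax a (tau - r)). set (v := Rmin b (tau + r)).
  assert (Hu : a <= u <= tau /\ tau - u <= r).
  { unfold u. destruct (Rle_dec a (tau - r)); [rewrite Rmax_right by lra | rewrite Rmax_left by lra]; lra. }
  assert (Hv : tau <= v <= b /\ v - tau <= r).
  { unfold v. destruct (Rle_dec b (tau + r)); [rewrite Rmin_left by lra | rewrite Rmin_right by lra]; lra. }
  pose proof (phase_cos_continuous _ _ _ H) as Hc.
  rewrite (RInt_chasles _ a u b) by auto. rewrite (RInt_chasles _ u v b) by auto.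
  assert (H1 : Rabs (RInt (fun s => cos (phi s)) a u) <= 2 / sqrt l).
  { destruct (Rle_lt_dec (tau - r) a) as [Hle|Hlt].
    - unfold u. rewrite Rmax_left by lra. rewrite RInt_point. unfold zero; simpl.
      rewrite Rabs_R0. unfold Rdiv. fold r. lra.
    - assert (Eu : u = tau - r) by (unfold u; apply Rmax_right; lra).
      apply (first_derivative_test phi phi1 phi2); auto; [lra| |].
      + intros t Ht. specialize (Hp t ltac:(lra)). lra.
      + right. pose proof (phase_slope_growth phi phi1 phi2 l u tau H ltac:(lra)
          ltac:(intros; apply Hp; lra)). rewrite Eu in *. nra. }
  assert (H2 : Rabs (RInt (fun s => cos (phi s)) v b) <= 2 / sqrt l).
  { destruct (Rle_lt_dec b (tau + r)) as [Hle|Hlt].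
    - unfold v. rewrite Rmin_left by lra. rewrite RInt_point. unfold zero; simpl.
      rewrite Rabs_R0. unfold Rdiv. fold r. lra.
    - assert (Ev : v = tau + r) by (unfold v; apply Rmin_right; lra).
      apply (first_derivative_test phi phi1 phi2); auto; [lra| |].
      + intros t Ht. specialize (Hp t ltac:(lra)). lra.
      + left. pose proof (phase_slope_growth phi phi1 phi2 l tau v H ltac:(lra)
          ltac:(intros; apply Hp; lra)). rewrite Ev in *. nra. }
  assert (H3 : Rabs (RInt (fun s => cos (phi s)) u v) <= 2 * r).
  { apply Rle_trans with (v - u); [|lra]. apply (RInt_cos_trivial phi phi1 phi2); auto; lra. }
  unfold Rdiv in *. fold r in H1, H2 |- *.
  apply Rabs_le_between in H1, H2, H3. apply Rabs_le. lra.
Qed.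

(** * The Fresnel integrals *)

Definition fresnel_cos (T : R) : R := RInt (fun s => cos (s * s)) 0 T.
Definition fresnel_sin (T : R) : R := RInt (fun s => sin (s * s)) 0 T.

Lemma cos_sub_half_pi y : cos (y - PI / 2) = sin y.
Proof. rewrite cos_minus, cos_PI2, sin_PI2. ring. Qed.

Lemma quadratic_phase c d e : phase (fun s => c * (s * s) + d * s + e)
  (fun s => 2 * c * s + d) (fun _ => 2 * c).
Proof. split; intros t; auto_derive; auto; ring. Qed.

Lemma fresnel_tail c a b : 0 < a <= b -> Rabs (RInt (fun s => cos (s * s + c)) a b) <= / a.
Proof.
  intros Hab.
  assert (B := first_derivative_test _ _ _ (2 * a) a b (quadratic_phase 1 0 c) ltac:(lra) ltac:(lra)
    ltac:(intros; lra) ltac:(left; lra)).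
  replace (/ a) with (2 / (2 * a)) by (field; lra).
  rewrite (RInt_ext _ (fun s => cos (1 * (s * s) + 0 * s + c))); [exact B|].
  intros s _. simpl. f_equal. ring.
Qed.

Lemma limit_with_rate (G : R -> R) : (forall a b, 0 < a <= b -> Rabs (G b - G a) <= / a) ->
  exists l, forall T, 0 < T -> Rabs (G T - l) <= / T.
Proof.
  intros HG.
  assert (Hc : ex_lim_seq_cauchy (fun n => G (INR n))).
  { intros eps. destruct (archimed_cor1 (eps / 2)) as [N [HN HN0]].
    { destruct eps; simpl; lra. }
    exists N. intros n m Hn Hm.
    assert (HNp : 0 < INR N) by (apply lt_0_INR; lia).
    apply le_INR in Hn, Hm.
    pose proof (HG (INR N) (INR n) ltac:(lra)) as B1.
    pose proof (HG (INR N) (INR m) ltac:(lra)) as B2.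
    apply Rabs_le_between in B1, B2. apply Rabs_def1; lra. }
  apply ex_lim_seq_cauchy_corr in Hc. destruct Hc as [l Hl].
  exists l. intros T HT.
  assert (L : is_lim_seq (fun n => Rabs (G T - G (INR n))) (Rabs (G T - l))).
  { apply (is_lim_seq_abs _ (Finite (G T - l))).
    apply (is_lim_seq_minus' _ _ (G T) l); [apply is_lim_seq_const | exact Hl]. }
  apply (is_lim_seq_le_loc (fun n => Rabs (G T - G (INR n))) (fun _ => / T) _ (/ T)) in L.
  - exact L.
  - destruct (nfloor_ex T ltac:(lra)) as [N HN].
    exists (S N). intros n Hn. apply le_INR in Hn. rewrite S_INR in Hn.
    rewrite <- Rabs_Ropp, Ropp_minus_distr. apply HG. lra.
  - apply is_lim_seq_const.
Qed.

(** [gauss_mix c t] is the real part of the integral over [0,1] of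
    [exp (i (t^2 (1+u^2) + c)) / (1+u^2)]: the oscillating analogue of the
    auxiliary function in the classical evaluation of the Gaussian integral
    by differentiation under the integral sign. *)
Definition gauss_mix (c t : R) : R :=
  RInt (fun u => cos (t * t * (1 + u * u) + c) / (1 + u * u)) 0 1.

Lemma one_plus_sqr_pos u : 0 < 1 + u * u.
Proof. nra. Qed.

Lemma gauss_mix_integrand_continuous c t u :
  continuous (fun u => cos (t * t * (1 + u * u) + c) / (1 + u * u)) u.
Proof.
  unfold Rdiv. apply cR_mult; [cont|]. apply cR_inv; [cont|].
  pose proof (one_plus_sqr_pos u). lra.
Qed.

Lemma fresnel_rescale (f : R -> R) t : (forall s, continuous f s) ->
  t * RInt (fun u => f (t * u)) 0 1 = RInt f 0 t.
Proof.
  intros Hf.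
  pose proof (RInt_comp_lin f t 0 0 1 (ex_RInt_cont f _ _ Hf)) as E.
  replace (t * 0 + 0) with 0 in E by ring. replace (t * 1 + 0) with t in E by ring.
  rewrite <- E, <- RInt_scal_cont.
  - apply RInt_ext. intros u _. unfold scal; simpl; unfold mult; simpl.
    replace (t * u + 0) with (t * u) by ring. reflexivity.
  - cont.
Qed.

Lemma is_derive_gauss_mix c t : is_derive (gauss_mix c) t
  (- 2 * (sin (t * t + c) * fresnel_cos t + cos (t * t + c) * fresnel_sin t)).
Proof.
  set (f := fun t u : R => cos (t * t * (1 + u * u) + c) / (1 + u * u)).
  assert (Hd : forall x u, is_derive (fun z => f z u) x (- (2 * x * sin (x * x * (1 + u * u) + c)))).
  { intros x u. unfold f. pose proof (one_plus_sqr_pos u). auto_derive; [lra|]. field. lra. }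
  assert (D := is_derive_RInt_param f 0 1 t).
  match type of D with _ -> _ -> _ -> is_derive _ _ ?v =>
    replace (- 2 * (sin (t * t + c) * fresnel_cos t + cos (t * t + c) * fresnel_sin t)) with v end.
  - apply D; clear D.
    + apply filter_forall. intros x u _. eexists. apply Hd.
    + intros u _.
      apply (continuity_2d_pt_ext (fun x u => - (2 * x * sin (x * x * (1 + u * u) + c)))).
      { intros x v. symmetry. apply is_derive_unique, Hd. }
      apply continuity_2d_pt_opp. apply continuity_2d_pt_mult.
      { apply continuity_2d_pt_mult; [apply continuity_2d_pt_const | apply continuity_2d_pt_id1]. }
      apply (continuity_1d_2d_pt_comp sin).
      { apply continuity_pt_filterlim, cR_sin. }
      repeat first [apply continuity_2d_pt_plus | apply continuity_2d_pt_mult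
        | apply continuity_2d_pt_const | apply continuity_2d_pt_id1 | apply continuity_2d_pt_id2].
    + apply filter_forall. intros x. apply ex_RInt_cont. apply gauss_mix_integrand_continuous.
  - rewrite (RInt_ext _ (fun u => (- 2 * t * sin (t * t + c)) * cos (t * u * (t * u))
      + (- 2 * t * cos (t * t + c)) * sin (t * u * (t * u)))).
    2: { intros u _. simpl. transitivity (- (2 * t * sin (t * t * (1 + u * u) + c))).
      - apply is_derive_unique, Hd.
      - replace (t * t * (1 + u * u) + c) with ((t * t + c) + t * u * (t * u)) by ring.
        rewrite sin_plus. ring. }
    rewrite RInt_add_cont, !RInt_scal_cont by cont.
    unfold fresnel_cos, fresnel_sin.
    rewrite <- (fresnel_rescale (fun s => cos (s * s))), <- (fresnel_rescale (fun s => sin (s * s))) by cont.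
    eqR. ring.
Qed.

Lemma is_derive_fresnel_cos t : is_derive fresnel_cos t (cos (t * t)).
Proof. apply (is_derive_RInt_cont (fun s => cos (s * s))). cont. Qed.

Lemma is_derive_fresnel_sin t : is_derive fresnel_sin t (sin (t * t)).
Proof. apply (is_derive_RInt_cont (fun s => sin (s * s))). cont. Qed.

Lemma fresnel_0 : fresnel_cos 0 = 0 /\ fresnel_sin 0 = 0.
Proof. split; [exact (RInt_point 0 (fun s => cos (s * s))) | exact (RInt_point 0 (fun s => sin (s * s)))]. Qed.

Lemma constant_of_derive_zero (G : R -> R) t : (forall s, is_derive G s 0) -> G t = G 0.
Proof.
  intros H.
  destruct (MVT_gen G 0 t (fun _ => 0)) as [c [_ E]]; [auto | | lra].
  intros s _. apply continuity_pt_filterlim. eapply (cR_derive G (fun _ => 0)). apply H.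
Qed.

Lemma gauss_mix_0_0 : gauss_mix 0 0 = PI / 4.
Proof.
  unfold gauss_mix. rewrite (RInt_ext _ (fun u => / (1 + u * u))).
  - rewrite (RInt_ftc atan).
    + rewrite atan_1, atan_0. lra.
    + intros u. pose proof (is_derive_atan u) as H.
      replace (/ (1 + u * u)) with (/ (1 + u²)) by reflexivity. exact H.
    + intros u. apply cR_inv; [cont|]. pose proof (one_plus_sqr_pos u). lra.
  - intros u _. simpl. replace (0 * 0 * (1 + u * u) + 0) with 0 by ring. rewrite cos_0.
    unfold Rdiv. ring.
Qed.

Lemma gauss_mix_quarter_0 : gauss_mix (- (PI / 2)) 0 = 0.
Proof.
  unfold gauss_mix. rewrite (RInt_ext _ (fun u => 0)).
  - rewrite RInt_constant. ring.
  - intros u _. replace (0 * 0 * (1 + u * u) + - (PI / 2)) with (- (PI / 2)) by ring.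
    rewrite cos_neg, cos_PI2. unfold Rdiv. apply Rmult_0_l.
Qed.

(** With [E = fresnel_cos + i fresnel_sin] and
    [G = gauss_mix 0 + i gauss_mix (- pi/2)], both sides of [E^2 = i (pi/4 - G)] have
    the same derivative and vanish at [0]; this is the imaginary part. *)
Lemma fresnel_product t :
  2 * (fresnel_cos t * fresnel_sin t) + gauss_mix 0 t = PI / 4.
Proof.
  rewrite (constant_of_derive_zero
    (fun t => 2 * (fresnel_cos t * fresnel_sin t) + gauss_mix 0 t) t).
  - destruct fresnel_0 as [-> ->]. rewrite gauss_mix_0_0. ring.
  - intros s.
    apply is_derive_value with (2 * (cos (s * s) * fresnel_sin s + fresnel_cos s * sin (s * s))
      + (- 2 * (sin (s * s + 0) * fresnel_cos s + cos (s * s + 0) * fresnel_sin s)));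
      [|rewrite Rplus_0_r; ring].
    apply (is_derive_plus (fun t => 2 * (fresnel_cos t * fresnel_sin t)) (gauss_mix 0)).
    + apply (is_derive_scal (fun t => fresnel_cos t * fresnel_sin t) s 2).
      apply (is_derive_mult fresnel_cos fresnel_sin);
        [apply is_derive_fresnel_cos | apply is_derive_fresnel_sin | intros; apply Rmult_comm].
    + apply is_derive_gauss_mix.
Qed.

(** The real part of the same identity. *)
Lemma fresnel_squares t :
  fresnel_cos t * fresnel_cos t - fresnel_sin t * fresnel_sin t - gauss_mix (- (PI / 2)) t = 0.
Proof.
  rewrite (constant_of_derive_zero (fun t => fresnel_cos t * fresnel_cos t
    - fresnel_sin t * fresnel_sin t - gauss_mix (- (PI / 2)) t) t).
  - destruct fresnel_0 as [-> ->]. rewrite gauss_mix_quarter_0. ring.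
  - intros s.
    apply is_derive_value with ((cos (s * s) * fresnel_cos s + fresnel_cos s * cos (s * s)
      - (sin (s * s) * fresnel_sin s + fresnel_sin s * sin (s * s)))
      - (- 2 * (sin (s * s + - (PI / 2)) * fresnel_cos s
        + cos (s * s + - (PI / 2)) * fresnel_sin s))).
    2: { eqR; fold (s * s - PI / 2). rewrite cos_sub_half_pi, sin_minus, cos_PI2, sin_PI2. ring. }
    apply (is_derive_minus (fun t => fresnel_cos t * fresnel_cos t - fresnel_sin t * fresnel_sin t)
      (gauss_mix (- (PI / 2)))); [|apply is_derive_gauss_mix].
    apply (is_derive_minus (fun t => fresnel_cos t * fresnel_cos t)
      (fun t => fresnel_sin t * fresnel_sin t)).
    + apply (is_derive_mult fresnel_cos fresnel_cos);
        [apply is_derive_fresnel_cos | apply is_derive_fresnel_cos | intros; apply Rmult_comm].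
    + apply (is_derive_mult fresnel_sin fresnel_sin);
        [apply is_derive_fresnel_sin | apply is_derive_fresnel_sin | intros; apply Rmult_comm].
Qed.

(** The phase is stationary at [u = 0]: bound [[0, 1/t]] trivially and integrate by
    parts on [[1/t, 1]]. *)
Lemma gauss_mix_decay c t : 1 <= t -> Rabs (gauss_mix c t) <= 2 / t.
Proof.
  intros Ht. unfold gauss_mix.
  set (eta := / t).
  assert (He : 0 < eta <= 1).
  { split; [apply Rinv_0_lt_compat; lra|]. rewrite <- Rinv_1. apply Rinv_le_contravar; lra. }
  rewrite (RInt_chasles _ 0 eta 1) by apply gauss_mix_integrand_continuous.
  assert (B1 : Rabs (RInt (fun u => cos (t * t * (1 + u * u) + c) / (1 + u * u)) 0 eta)
    <= 1 * (eta - 0)).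
  { apply RInt_abs_bound; [lra | apply gauss_mix_integrand_continuous |].
    intros u Hu. unfold Rdiv. rewrite Rabs_mult.
    assert (Rabs (cos (t * t * (1 + u * u) + c)) <= 1) by apply Rabs_cos_le.
    assert (0 < / (1 + u * u) <= 1).
    { split; [apply Rinv_0_lt_compat, one_plus_sqr_pos|].
      rewrite <- Rinv_1. apply Rinv_le_contravar; nra. }
    rewrite (Rabs_right (/ _)) by lra.
    pose proof (Rabs_pos (cos (t * t * (1 + u * u) + c))). nra. }
  pose proof (oscillation_by_parts (fun u => t * t * (1 + u * u) + c) (fun u => 2 * (t * t) * u)
    (fun u => / (1 + u * u)) (fun u => / (2 * (t * t) * (u * (1 + u * u))))
    (fun u => - (2 * (t * t) * (1 + 3 * (u * u))) / (2 * (t * t) * (u * (1 + u * u))) ^ 2)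
    eta 1) as B2.
  rewrite (RInt_ext _ (fun s => / (1 + s * s) * cos (t * t * (1 + s * s) + c)) eta 1)
    by (intros; apply Rmult_comm).
  assert (Htt : 0 < t * t) by nra.
  assert (Hpos : forall u, eta <= u <= 1 -> 0 < 2 * (t * t) * (u * (1 + u * u))).
  { intros u Hu. pose proof (one_plus_sqr_pos u).
    apply Rmult_lt_0_compat; [lra|]. apply Rmult_lt_0_compat; lra. }
  assert (H := Hpos eta ltac:(lra)). assert (H' := Hpos 1 ltac:(lra)).
  lapply B2; [clear B2; intros B2 | lra].
  lapply B2; [clear B2; intros B2 | intros; auto_derive; auto; ring].
  lapply B2; [clear B2; intros B2 |].
  2: { intros u Hu. specialize (Hpos u Hu). auto_derive; [lra|]. field.
       pose proof (one_plus_sqr_pos u). repeat split; lra. }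
  lapply B2; [clear B2; intros B2 |].
  2: { intros u Hu. specialize (Hpos u Hu).
       assert (0 < / (2 * (t * t) * (u * (1 + u * u))) ^ 2)
         by (apply Rinv_0_lt_compat, pow2_gt_0; lra).
       assert (0 <= t * t * (1 + 3 * (u * u))) by (apply Rmult_le_pos; nra).
       unfold Rdiv. nra. }
  lapply B2; [clear B2; intros B2 |].
  2: { intros u Hu. pose proof (one_plus_sqr_pos u). field. repeat split; lra. }
  lapply B2; [clear B2; intros B2 |].
  2: { intros u. apply cR_mult; [apply cR_inv; [cont|]; pose proof (one_plus_sqr_pos u); lra | cont]. }
  assert (H1 : / (2 * (t * t) * (eta * (1 + eta * eta))) <= / (2 * t)).
  { apply Rinv_le_contravar; [lra|].
    replace (2 * (t * t) * (eta * (1 + eta * eta))) with (2 * t * (1 + eta * eta))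
      by (unfold eta; field; lra). nra. }
  assert (H2 : 0 < / (2 * (t * t) * (eta * (1 + eta * eta)))) by now apply Rinv_0_lt_compat.
  assert (H3 : 0 < / (2 * (t * t) * (1 * (1 + 1 * 1)))) by now apply Rinv_0_lt_compat.
  pose proof (SIN_bound (t * t * (1 + eta * eta) + c)).
  pose proof (SIN_bound (t * t * (1 + 1 * 1) + c)).
  replace (2 / t) with (eta + 2 * / (2 * t)) by (unfold eta; field; lra).
  apply Rabs_le_between in B1, B2. apply Rabs_le. nra.
Qed.

(** As [gauss_mix] tends to [0], the two limits have equal squares and product
    [pi/8], hence coincide. Only the square of the common value [c0] is recorded:
    its sign disappears when absolute values are taken. *)
Lemma fresnel_limits : exists c0, c0 * c0 = PI / 8 /\
  forall T, 0 < T -> Rabs (fresnel_cos T - c0) <= / T /\ Rabs (fresnel_sin T - c0) <= / T.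
Proof.
  assert (HL : forall G c, (forall T, G T = RInt (fun s => cos (s * s + c)) 0 T) ->
    exists l, forall T, 0 < T -> Rabs (G T - l) <= / T).
  { intros G c HG. apply limit_with_rate. intros a b Hab.
    rewrite !HG, (RInt_chasles _ 0 a b) by cont. rewrite Rplus_comm, Rplus_minus_r.
    now apply fresnel_tail. }
  destruct (HL fresnel_cos 0) as [l Hl].
  { intros T. apply RInt_ext. intros s _. now rewrite Rplus_0_r. }
  destruct (HL fresnel_sin (- (PI / 2))) as [m Hm].
  { intros T. apply RInt_ext. intros s _. symmetry. apply cos_sub_half_pi. }
  assert (Hinv : is_lim_seq (fun n => / INR (S n)) 0).
  { apply (is_lim_seq_incr_1 (fun n => / INR n)).
    replace (Finite 0) with (Rbar_inv p_infty) by reflexivity.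
    apply is_lim_seq_inv; [apply is_lim_seq_INR | discriminate]. }
  assert (Lof : forall (G : R -> R) k v, (forall T, 1 <= T -> Rabs (G T - v) <= k * / T) ->
    is_lim_seq (fun n => G (INR (S n))) v).
  { intros G k v HG.
    assert (L : is_lim_seq (fun n => G (INR (S n)) - v) 0).
    { apply is_lim_seq_abs_0.
      apply (is_lim_seq_le_le (fun _ => 0) _ (fun n => k * / INR (S n))).
      - intros n. split; [apply Rabs_pos|]. apply HG. rewrite S_INR. pose proof (pos_INR n). lra.
      - apply is_lim_seq_const.
      - replace (Finite 0) with (Rbar_mult k 0) by (simpl; f_equal; ring).
        now apply is_lim_seq_scal_l. }
    apply (is_lim_seq_ext (fun n => (G (INR (S n)) - v) + v)); [intros; ring|].
    replace (Finite v) with (Finite (0 + v)) by (f_equal; ring).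
    apply is_lim_seq_plus'; [exact L | apply is_lim_seq_const]. }
  assert (Lc : is_lim_seq (fun n => fresnel_cos (INR (S n))) l).
  { apply (Lof _ 1). intros T HT. rewrite Rmult_1_l. apply Hl. lra. }
  assert (Ls : is_lim_seq (fun n => fresnel_sin (INR (S n))) m).
  { apply (Lof _ 1). intros T HT. rewrite Rmult_1_l. apply Hm. lra. }
  assert (Lg : forall c, is_lim_seq (fun n => gauss_mix c (INR (S n))) 0).
  { intros c. apply (Lof _ 2). intros T HT. rewrite Rminus_0_r. now apply gauss_mix_decay. }
  assert (E1 : 2 * (l * m) + 0 = PI / 4).
  { assert (L : is_lim_seq (fun n => 2 * (fresnel_cos (INR (S n)) * fresnel_sin (INR (S n)))
      + gauss_mix 0 (INR (S n))) (2 * (l * m) + 0)).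
    { apply is_lim_seq_plus'; [|apply Lg].
      apply is_lim_seq_mult'; [apply is_lim_seq_const|]. now apply is_lim_seq_mult'. }
    apply (is_lim_seq_ext _ (fun _ => PI / 4)) in L; [|intros; apply fresnel_product].
    apply is_lim_seq_unique in L. rewrite Lim_seq_const in L. now inversion L. }
  assert (E2 : l * l - m * m - 0 = 0).
  { assert (L : is_lim_seq (fun n => fresnel_cos (INR (S n)) * fresnel_cos (INR (S n))
      - fresnel_sin (INR (S n)) * fresnel_sin (INR (S n)) - gauss_mix (- (PI / 2)) (INR (S n)))
      (l * l - m * m - 0)).
    { apply is_lim_seq_minus'; [|apply Lg].
      apply is_lim_seq_minus'; now apply is_lim_seq_mult'. }
    apply (is_lim_seq_ext _ (fun _ => 0)) in L; [|intros; apply fresnel_squares].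
    apply is_lim_seq_unique in L. rewrite Lim_seq_const in L. now inversion L. }
  assert (E : l = m).
  { assert (Hf : (l - m) * (l + m) = 0) by lra.
    apply Rmult_integral in Hf. destruct Hf as [Hf|Hf]; [lra|].
    exfalso. assert (l = - m) by lra. subst l. pose proof PI_RGT_0. nra. }
  subst m. exists l. split; [lra|]. intros T HT. split; auto.
Qed.

(** * Sums over integer windows *)

Fixpoint window_sum (u : Z -> R) (a : Z) (n : nat) : R :=
  match n with
  | O => 0
  | S k => window_sum u a k + u (a + Z.of_nat k)%Z
  end.

Definition zsum (u : Z -> R) (a b : Z) : R := window_sum u a (Z.to_nat (b - a)).

Lemma zsum_same u a : zsum u a a = 0.
Proof. unfold zsum. now rewrite Z.sub_diag. Qed.

Lemma zsum_succ u a b : (a <= b)%Z -> zsum u a (b + 1) = zsum u a b + u b.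
Proof.
  intros H. unfold zsum. replace (Z.to_nat (b + 1 - a)) with (S (Z.to_nat (b - a))) by lia.
  simpl. f_equal. f_equal. lia.
Qed.

Lemma Z_interval_ind (P : Z -> Prop) a : P a ->
  (forall b, (a <= b)%Z -> P b -> P (b + 1)%Z) -> forall b, (a <= b)%Z -> P b.
Proof.
  intros H0 HS b Hb. replace b with (a + Z.of_nat (Z.to_nat (b - a)))%Z by lia.
  induction (Z.to_nat (b - a)) as [|n IH].
  - now rewrite Z.add_0_r.
  - rewrite Nat2Z.inj_succ, <- Z.add_1_r, Z.add_assoc. apply HS; [lia | exact IH].
Qed.

Lemma zsum_chasles u a b c : (a <= b <= c)%Z -> zsum u a c = zsum u a b + zsum u b c.
Proof.
  intros [Hab Hbc]. revert c Hbc. apply Z_interval_ind.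
  - rewrite zsum_same. ring.
  - intros c Hc IH. rewrite !zsum_succ by lia. rewrite IH. ring.
Qed.

Lemma zsum_le u v a b : (a <= b)%Z -> (forall n, (a <= n < b)%Z -> u n <= v n) ->
  zsum u a b <= zsum v a b.
Proof.
  intros Hab. revert b Hab. apply (Z_interval_ind (fun b => _ -> zsum u a b <= zsum v a b)).
  - intros _. rewrite !zsum_same. lra.
  - intros b Hb IH H. rewrite !zsum_succ by lia.
    apply Rplus_le_compat; [apply IH; intros; apply H; lia | apply H; lia].
Qed.

Lemma zsum_ext u v a b : (a <= b)%Z -> (forall n, (a <= n < b)%Z -> u n = v n) ->
  zsum u a b = zsum v a b.
Proof. intros Hab H. apply Rle_antisym; apply zsum_le; auto; intros n Hn; rewrite H; auto; lra. Qed.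

Lemma zsum_nonneg u a b : (a <= b)%Z -> (forall n, (a <= n < b)%Z -> 0 <= u n) -> 0 <= zsum u a b.
Proof.
  intros Hab H. replace 0 with (zsum (fun _ => 0) a b); [now apply zsum_le|].
  clear H. revert b Hab. apply Z_interval_ind; [apply zsum_same|].
  intros b Hb IH. rewrite zsum_succ, IH by lia. ring.
Qed.

Lemma zsum_plus u v a b : (a <= b)%Z -> zsum (fun n => u n + v n) a b = zsum u a b + zsum v a b.
Proof.
  revert b. apply Z_interval_ind.
  - rewrite !zsum_same. ring.
  - intros b Hb IH. rewrite !zsum_succ by lia. rewrite IH. ring.
Qed.

Lemma zsum_scal k u a b : (a <= b)%Z -> zsum (fun n => k * u n) a b = k * zsum u a b.
Proof.
  revert b. apply Z_interval_ind.
  - rewrite !zsum_same. ring.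
  - intros b Hb IH. rewrite !zsum_succ by lia. rewrite IH. ring.
Qed.

Lemma zsum_minus u v a b : (a <= b)%Z -> zsum (fun n => u n - v n) a b = zsum u a b - zsum v a b.
Proof.
  revert b. apply Z_interval_ind.
  - rewrite !zsum_same. ring.
  - intros b Hb IH. rewrite !zsum_succ by lia. rewrite IH. ring.
Qed.

Lemma zsum_const k a b : (a <= b)%Z -> zsum (fun _ => k) a b = k * (IZR b - IZR a).
Proof.
  revert b. apply Z_interval_ind.
  - rewrite !zsum_same. ring.
  - intros b Hb IH. rewrite !zsum_succ by lia. rewrite IH, plus_IZR. ring.
Qed.

Lemma zsum_opp u a b : (a <= b)%Z -> zsum u a b = zsum (fun n => u (- n)%Z) (1 - b) (1 - a).
Proof.
  revert b. apply Z_interval_ind.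
  - now rewrite !zsum_same.
  - intros b Hb IH.
    rewrite zsum_succ, IH, (zsum_chasles _ (1 - (b + 1)) (1 - b) (1 - a)) by lia.
    replace (zsum (fun n => u (- n)%Z) (1 - (b + 1)) (1 - b)) with (u b); [ring|].
    replace (1 - b)%Z with (1 - (b + 1) + 1)%Z by ring.
    rewrite zsum_succ, zsum_same by lia. rewrite Rplus_0_l. f_equal. lia.
Qed.

Lemma zsum_abs u a b : (a <= b)%Z -> Rabs (zsum u a b) <= zsum (fun n => Rabs (u n)) a b.
Proof.
  revert b. apply Z_interval_ind.
  - rewrite !zsum_same, Rabs_R0. lra.
  - intros b Hb IH. rewrite !zsum_succ by lia.
    eapply Rle_trans; [apply Rabs_triang|]. lra.
Qed.

Lemma zsum_abs_bound u k a b : (a <= b)%Z -> (forall n, (a <= n < b)%Z -> Rabs (u n) <= k) ->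
  Rabs (zsum u a b) <= k * (IZR b - IZR a).
Proof.
  intros Hab H. eapply Rle_trans; [now apply zsum_abs|].
  rewrite <- zsum_const by exact Hab. now apply zsum_le.
Qed.

Lemma zsum_telescope G a b : (a <= b)%Z -> zsum (fun n => G (n + 1)%Z - G n) a b = G b - G a.
Proof.
  revert b. apply Z_interval_ind.
  - rewrite zsum_same. ring.
  - intros b Hb IH. rewrite zsum_succ by lia. rewrite IH. ring.
Qed.

(** * Coefficient integrals of a convex profile *)

(** What remains of an odd periodic function after folding to [[0,pi]]. The conditions
    are invariant under [t -> pi - t], which exchanges the two endpoints. *)
Record profile (h h1 h2 : R -> R) : Prop := {
  profile_derive : forall t, is_derive h t (h1 t);
  profile_derive2 : forall t, is_derive h1 t (h2 t);
  profile_continuous : forall t, continuous h2 t;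
  profile_nonneg : forall t, 0 <= t <= PI -> 0 <= h2 t;
  profile_pos : forall t, 0 < t < PI -> 0 < h2 t;
  profile_0 : h 0 = 0;
  profile_PI : h PI = 0 }.

Ltac profile_cont := match goal with H : profile _ _ _ |- _ =>
  pose proof (profile_derive _ _ _ H); pose proof (profile_derive2 _ _ _ H);
  pose proof (profile_continuous _ _ _ H); cont end.

Definition coeff (h : R -> R) (x y : R) : R := RInt (fun t => cos (x * h t - y * t)) 0 PI.

Lemma profile_phase h h1 h2 x y : profile h h1 h2 ->
  phase (fun t => x * h t - y * t) (fun t => x * h1 t - y) (fun t => x * h2 t).
Proof.
  intros H. split; intros t.
  - apply (is_derive_minus (fun t => x * h t) (fun t => y * t)).
    + apply (is_derive_scal h). apply H.
    + auto_derive; auto. ring.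
  - apply is_derive_value with (x * h2 t - 0); [|ring].
    apply (is_derive_minus (fun t => x * h1 t) (fun t => y)).
    + apply (is_derive_scal h1). apply H.
    + auto_derive; auto.
Qed.

Lemma profile_slope_diff h h1 h2 a b : profile h h1 h2 -> h1 b - h1 a = RInt h2 a b.
Proof. intros H. symmetry. apply RInt_ftc; apply H. Qed.

Lemma profile_slope_le h h1 h2 a b : profile h h1 h2 -> 0 <= a <= b -> b <= PI -> h1 a <= h1 b.
Proof.
  intros H Hab Hb. apply (nondecreasing_of_derive h1 h2); [lra | |].
  - intros; apply H.
  - intros t Ht. apply (profile_nonneg _ _ _ H). lra.
Qed.

Lemma profile_slope_lt h h1 h2 a b : profile h h1 h2 -> 0 <= a < b -> b <= PI -> h1 a < h1 b.
Proof.
  intros H Hab Hb.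
  set (p := (3 * a + b) / 4). set (q := (a + 3 * b) / 4).
  assert (Hp : h1 a <= h1 p) by (apply (profile_slope_le h h1 h2); auto; unfold p; lra).
  assert (Hq : h1 q <= h1 b) by (apply (profile_slope_le h h1 h2); auto; unfold q; lra).
  destruct (MVT_gen h1 p q h2) as [c [Hc E]].
  - intros; apply H.
  - intros s _. apply continuity_pt_filterlim. eapply cR_derive. apply H.
  - unfold p, q in *. rewrite Rmin_left, Rmax_right in Hc by lra.
    pose proof (profile_pos _ _ _ H c ltac:(lra)). nra.
Qed.

Lemma profile_reflect h h1 h2 : profile h h1 h2 ->
  profile (fun t => h (PI - t)) (fun t => - h1 (PI - t)) (fun t => h2 (PI - t)).
Proof.
  intros H. destruct H as [Hd Hd2 Hc Hn Hp H0 HP].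
  assert (Hl : forall t, is_derive (fun s => PI - s) t (-1)).
  { intros t. auto_derive; auto; ring. }
  split.
  - intros t. apply is_derive_value with (-1 * h1 (PI - t)); [|ring].
    apply (is_derive_comp h (fun s => PI - s)); auto.
  - intros t. apply is_derive_value with (- (-1 * h2 (PI - t))); [|ring].
    apply (is_derive_opp (fun s => h1 (PI - s))).
    apply (is_derive_comp h1 (fun s => PI - s)); auto.
  - cont.
  - intros t Ht. apply Hn. lra.
  - intros t Ht. apply Hp. lra.
  - now rewrite Rminus_0_r.
  - now rewrite Rminus_diag.
Qed.

Lemma RInt_reflect (f : R -> R) c a b : (forall t, continuous f t) ->
  RInt (fun t => f (c - t)) a b = RInt f (c - b) (c - a).
Proof.
  intros Hf.
  pose proof (RInt_comp_lin f (-1) c a b (ex_RInt_cont f _ _ Hf)) as E.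
  replace (-1 * a + c) with (c - a) in E by ring. replace (-1 * b + c) with (c - b) in E by ring.
  rewrite (RInt_ext _ (fun t => -1 * f (c - t))) in E.
  2: { intros t _. replace (c - t) with (-1 * t + c) by ring. reflexivity. }
  rewrite RInt_scal_cont in E by cont.
  pose proof (RInt_chasles f (c - a) (c - b) (c - a) Hf) as C. rewrite (RInt_point (c - a) f) in C.
  unfold zero in C; simpl in C. lra.
Qed.

Lemma sin_IZR_PI n : sin (IZR n * PI) = 0.
Proof. apply sin_eq_0_1. now exists n. Qed.

(** The substitution adds [n pi] to the phase, which multiplies the cosine by
    [cos (n pi) = 1] or [-1]. *)
Lemma coeff_reflect h h1 h2 x n : profile h h1 h2 ->
  Rabs (coeff h x (IZR n)) = Rabs (coeff (fun t => h (PI - t)) x (IZR (- n))).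
Proof.
  intros H. unfold coeff.
  set (f := fun t => cos (x * h t - IZR n * t)).
  assert (Hf : forall t, continuous f t).
  { unfold f. profile_cont. }
  assert (Hk : Rabs (cos (IZR n * PI)) = 1).
  { pose proof (sin2_cos2 (IZR n * PI)) as E. rewrite sin_IZR_PI in E. unfold Rsqr in E.
    assert (E' : cos (IZR n * PI) * cos (IZR n * PI) = 1) by lra.
    rewrite <- sqrt_1, <- E'. symmetry. apply sqrt_Rsqr_abs. }
  assert (E : RInt (fun t => cos (x * h (PI - t) - IZR (- n) * t)) 0 PI
    = cos (IZR n * PI) * RInt f 0 PI).
  { replace (RInt f 0 PI) with (RInt f (PI - PI) (PI - 0)) by (f_equal; ring).
    rewrite <- (RInt_reflect f PI 0 PI Hf), <- RInt_scal_cont by cont.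
    apply RInt_ext. intros t _. unfold f.
    replace (x * h (PI - t) - IZR (- n) * t)
      with ((x * h (PI - t) - IZR n * (PI - t)) + IZR n * PI) by (rewrite opp_IZR; ring).
    rewrite cos_plus, sin_IZR_PI. eqR. ring. }
  rewrite E, Rabs_mult, Hk. ring.
Qed.

Lemma coeff_sum_reflect h h1 h2 x a b : profile h h1 h2 -> (a <= b)%Z ->
  zsum (fun n => Rabs (coeff h x (IZR n))) a b
  = zsum (fun n => Rabs (coeff (fun t => h (PI - t)) x (IZR n))) (1 - b) (1 - a).
Proof.
  intros H Hab. 
  rewrite (zsum_opp (fun n => Rabs (coeff (fun t => h (PI - t)) x (IZR n))) (1 - b) (1 - a)) by lia.
  replace (1 - (1 - a))%Z with a by ring. replace (1 - (1 - b))%Z with b by ring.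
  apply zsum_ext; auto. intros n _. now apply (coeff_reflect h h1 h2).
Qed.

Lemma coeff_trivial h h1 h2 x y : profile h h1 h2 -> Rabs (coeff h x y) <= PI.
Proof.
  intros H. pose proof PI_RGT_0.
  replace PI with (PI - 0) at 1 by ring.
  eapply (RInt_cos_trivial _ _ _ 0 PI (profile_phase h h1 h2 x y H)). lra.
Qed.

(** * Frequencies outside the range of the phase derivative *)

(** At integer frequencies both boundary terms of the integration by parts vanish,
    since [h] vanishes at [0] and [pi]. Only the variation of [1 / phi'] is left, and it
    is of order [mu^-2] for large [mu], hence summable. *)
Lemma coeff_outer h h1 h2 x n : profile h h1 h2 -> 0 <= x -> 0 < x * h1 0 - IZR n ->
  Rabs (coeff h x (IZR n))
  <= / (x * h1 0 - IZR n) - / (x * h1 0 - IZR n + x * (h1 PI - h1 0)).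
Proof.
  intros H Hx Hmu. pose proof PI_RGT_0.
  pose proof (convex_phase_by_parts _ _ _ 0 PI (profile_phase h h1 h2 x (IZR n) H) ltac:(lra)) as B.
  lapply B; [clear B; intros B|].
  2: { intros t Ht. pose proof (profile_slope_le h h1 h2 0 t H ltac:(lra) ltac:(lra)). nra. }
  lapply B; [clear B; intros B|].
  2: { intros t Ht. apply Rmult_le_pos; auto. now apply (profile_nonneg _ _ _ H). }
  cbv beta in B.
  rewrite (profile_0 _ _ _ H), (profile_PI _ _ _ H) in B.
  replace (x * 0 - IZR n * 0) with 0 in B by ring.
  replace (x * 0 - IZR n * PI) with (- (IZR n * PI)) in B by ring.
  rewrite sin_neg, sin_IZR_PI, sin_0 in B.
  unfold Rdiv in B. rewrite Ropp_0, !Rmult_0_l, !Rminus_0_r in B.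
  replace (x * h1 0 - IZR n + x * (h1 PI - h1 0)) with (x * h1 PI - IZR n) by ring.
  exact B.
Qed.

Definition log_ratio (Y mu : R) : R := ln mu - ln (mu + Y).

Lemma log_ratio_derive Y mu : 0 <= Y -> 0 < mu ->
  is_derive (log_ratio Y) mu (/ mu - / (mu + Y)).
Proof. intros HY Hmu. unfold log_ratio. auto_derive; [lra|]. field. lra. Qed.

Lemma inv_gap_decreasing Y s mu : 0 <= Y -> 0 < s <= mu ->
  / mu - / (mu + Y) <= / s - / (s + Y).
Proof.
  intros HY Hs.
  replace (/ mu - / (mu + Y)) with (Y * / (mu * (mu + Y))) by (field; lra).
  replace (/ s - / (s + Y)) with (Y * / (s * (s + Y))) by (field; lra).
  apply Rmult_le_compat_l; auto. apply Rinv_le_contravar; nra.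
Qed.

(** The left side is the derivative of [log_ratio] at [mu], and that derivative
    decreases. Summed over unit steps the right side telescopes to a logarithm. *)
Lemma log_ratio_step Y mu : 0 <= Y -> 1 < mu ->
  / mu - / (mu + Y) <= log_ratio Y mu - log_ratio Y (mu - 1).
Proof.
  intros HY Hmu. set (c := / mu - / (mu + Y)).
  enough (log_ratio Y (mu - 1) - c * (mu - 1) <= log_ratio Y mu - c * mu) by lra.
  apply (nondecreasing_of_derive (fun s => log_ratio Y s - c * s)
    (fun s => / s - / (s + Y) - c)); [lra | |].
  - intros s Hs. apply (is_derive_minus (log_ratio Y) (fun s => c * s)).
    + apply log_ratio_derive; lra.
    + auto_derive; auto. ring.
  - intros s Hs. pose proof (inv_gap_decreasing Y s mu HY ltac:(lra)). unfold c. lra.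
Qed.

Lemma log_ratio_bounds Y s : 0 <= Y -> 1 <= s -> - ln (1 + Y) <= log_ratio Y s <= 0.
Proof.
  intros HY Hs. split.
  - replace (- ln (1 + Y)) with (log_ratio Y 1) by (unfold log_ratio; rewrite ln_1; ring).
    apply (nondecreasing_of_derive (log_ratio Y) (fun s => / s - / (s + Y))); auto.
    + intros t Ht. apply log_ratio_derive; lra.
    + intros t Ht. assert (/ (t + Y) <= / t) by (apply Rinv_le_contravar; lra). lra.
  - unfold log_ratio. assert (ln s <= ln (s + Y)) by (apply ln_le; lra). lra.
Qed.

Lemma outer_sum_left h h1 h2 x a b : profile h h1 h2 -> 0 <= x -> (a <= b)%Z ->
  IZR b <= x * h1 0 - 1 ->
  zsum (fun n => Rabs (coeff h x (IZR n))) a b <= ln (1 + x * (h1 PI - h1 0)).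
Proof.
  intros H Hx Hab Hb. pose proof PI_RGT_0.
  set (Y := x * (h1 PI - h1 0)).
  assert (HY : 0 <= Y).
  { pose proof (profile_slope_le h h1 h2 0 PI H ltac:(lra) ltac:(lra)).
    apply Rmult_le_pos; lra. }
  set (G := fun m : Z => - log_ratio Y (x * h1 0 - IZR m)).
  apply Rle_trans with (zsum (fun n => G (n + 1)%Z - G n) a b).
  - unfold G. apply zsum_le; auto. intros n Hn.
    assert (Hn' : IZR n <= IZR b - 1) by (rewrite <- minus_IZR; apply IZR_le; lia).
    eapply Rle_trans; [apply (coeff_outer h h1 h2); auto; lra|]. fold Y.
    eapply Rle_trans; [apply log_ratio_step; auto; lra|].
    rewrite plus_IZR. replace (x * h1 0 - (IZR n + 1)) with (x * h1 0 - IZR n - 1) by ring. lra.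
  - rewrite zsum_telescope by auto. unfold G. apply IZR_le in Hab.
    pose proof (log_ratio_bounds Y (x * h1 0 - IZR a) HY ltac:(lra)).
    pose proof (log_ratio_bounds Y (x * h1 0 - IZR b) HY ltac:(lra)). lra.
Qed.

Lemma outer_sum_right h h1 h2 x a b : profile h h1 h2 -> 0 <= x -> (a <= b)%Z ->
  x * h1 PI + 2 <= IZR a ->
  zsum (fun n => Rabs (coeff h x (IZR n))) a b <= ln (1 + x * (h1 PI - h1 0)).
Proof.
  intros H Hx Hab Ha. rewrite (coeff_sum_reflect h h1 h2) by auto.
  replace (h1 PI - h1 0) with (- h1 (PI - PI) - - h1 (PI - 0))
    by (rewrite Rminus_diag, Rminus_0_r; ring).
  apply (outer_sum_left _ _ _ x _ _ (profile_reflect h h1 h2 H) Hx); [lia|].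
  rewrite minus_IZR, Rminus_0_r. lra.
Qed.

(** * Frequencies whose stationary point is near an endpoint *)

Definition doubling_edge (h2 : R -> R) : Prop := exists (m : R -> R) (c K : R),
  0 < c /\ 0 < K /\ (forall t, 0 < t < 4 * c -> 0 < m t) /\ nondecreasing_on m 0 (4 * c) /\
  (forall t, 0 < t < 2 * c -> m (2 * t) / m t <= K) /\
  (forall t, 0 < t < 4 * c -> m t <= h2 t <= K * m t).

(** With [tau] the stationary point, [[0, tau/2]] is handled by the first
    derivative test or trivially, [[tau/2, 2d]] by the second derivative test with
    [h'' >= m (tau/2)], and the rest by the first derivative test. Doubling
    makes [m (tau/2)] comparable to [h'' tau]. The bound is expressed through
    the previous frequency's stationary point [sigma] so that it telescopes. *)
Lemma coeff_edge h h1 h2 : profile h h1 h2 -> doubling_edge h2 ->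
  exists d A B, 0 < d < PI / 2 /\ 0 <= A /\ 0 <= B /\
  forall x sigma tau, 0 < x -> 0 <= sigma < tau -> tau <= d -> x * (h1 tau - h1 sigma) = 1 ->
  Rabs (coeff h x (x * h1 tau))
  <= A * sqrt x * RInt (fun t => sqrt (h2 t)) sigma tau + B * (h1 tau - h1 sigma).
Proof.
  intros H (m & c & K & Hc & HK & Hm & Hmono & Hdbl & Hcmp). pose proof PI_RGT_0.
  set (d := Rmin c (PI / 4)).
  assert (Hd : 0 < d /\ d <= c /\ d <= PI / 4).
  { unfold d. pose proof (Rmin_l c (PI / 4)). pose proof (Rmin_r c (PI / 4)).
    repeat split; auto. apply Rmin_glb_lt; lra. }
  set (kap := h1 (2 * d) - h1 d).
  assert (Hkap : 0 < kap).
  { pose proof (profile_slope_lt h h1 h2 d (2 * d) H ltac:(lra) ltac:(lra)). unfold kap. lra. }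
  exists d, (8 * K), (2 / kap).
  split; [lra|]. split; [lra|]. split; [apply Rlt_le, Rdiv_lt_0_compat; lra|].
  intros x sg ta Hx Hsg Hta E.
  pose proof (profile_phase h h1 h2 x (x * h1 ta) H) as Hph.
  set (mm := m (ta / 2)).
  assert (Hmm : 0 < mm) by (apply Hm; lra).
  set (l := x * mm).
  assert (Hl : 0 < l) by (apply Rmult_lt_0_compat; auto).
  assert (Hsl : 0 < sqrt l) by now apply sqrt_lt_R0.
  assert (Hll : sqrt l * sqrt l = l) by (apply sqrt_sqrt; lra).
  assert (Hlow : forall t, ta / 2 <= t <= 2 * d -> l <= x * h2 t).
  { intros t Ht. apply Rmult_le_compat_l; [lra|].
    apply Rle_trans with (m t); [apply Hmono; lra | apply Hcmp; lra]. }
  assert (Hnn : forall a b, 0 <= a -> b <= PI -> forall t, a <= t <= b -> 0 <= x * h2 t).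
  { intros a b Ha Hb t Ht. apply Rmult_le_pos; [lra|]. apply (profile_nonneg _ _ _ H). lra. }
  set (f := fun t => cos (x * h t - x * h1 ta * t)).
  assert (Hf : forall t, continuous f t) by apply (phase_cos_continuous _ _ _ Hph).
  assert (B1 : Rabs (RInt f 0 (ta / 2)) <= 2 / sqrt l).
  { destruct (Rle_lt_dec ta (2 / sqrt l)) as [Hle|Hlt].
    - eapply Rle_trans; [apply (RInt_cos_trivial _ _ _ 0 (ta / 2) Hph); lra|].
      lra.
    - assert (Hg : l * (ta - ta / 2) <= (x * h1 ta - x * h1 ta) - (x * h1 (ta / 2) - x * h1 ta)).
      { apply (phase_slope_growth _ _ _ l (ta / 2) ta Hph); [lra|].
        intros t Ht. apply Hlow. lra. }
      apply (Rmult_lt_compat_r (sqrt l)) in Hlt; auto.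
      replace (2 / sqrt l * sqrt l) with 2 in Hlt by (field; lra).
      apply (first_derivative_test _ _ _ (sqrt l) 0 (ta / 2) Hph); auto; [lra| |].
      + apply Hnn; lra.
      + right. cbv beta. nra. }
  assert (B2 : Rabs (RInt f (ta / 2) (2 * d)) <= 6 / sqrt l).
  { apply (second_derivative_test _ _ _ l (ta / 2) ta (2 * d) Hph); auto; [lra|].
    cbv beta. ring. }
  assert (B3 : Rabs (RInt f (2 * d) PI) <= 2 / (x * kap)).
  { apply (first_derivative_test _ _ _ (x * kap) (2 * d) PI Hph); [lra | nra | apply Hnn; lra |].
    left. cbv beta. unfold kap.
    pose proof (profile_slope_le h h1 h2 ta d H ltac:(lra) ltac:(lra)). nra. }
  (* [h2] has mass [1 / x] between [sigma] and [tau], and doubling bounds [h2] there by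
     [K^2 * mm], hence by [K * sqrt mm * sqrt h2] *)
  assert (B4 : / sqrt l <= K * sqrt x * RInt (fun t => sqrt (h2 t)) sg ta).
  { assert (I1 : RInt h2 sg ta <= RInt (fun t => (K * sqrt mm) * sqrt (h2 t)) sg ta).
    { apply RInt_le; [lra | | |].
      - apply ex_RInt_cont, H.
      - apply ex_RInt_cont. profile_cont.
      - intros t Ht. pose proof (profile_nonneg _ _ _ H t ltac:(lra)) as Hp.
        rewrite <- (sqrt_sqrt (h2 t)) at 1 by auto.
        apply Rmult_le_compat_r; [apply sqrt_pos|].
        rewrite <- (sqrt_square K), <- sqrt_mult by nra.
        apply sqrt_le_1_alt. apply Rle_trans with (K * m t); [apply Hcmp; lra|].
        rewrite Rmult_assoc. apply Rmult_le_compat_l; [lra|].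
        apply Rle_trans with (m ta); [apply Hmono; lra|].
        pose proof (Hdbl (ta / 2) ltac:(lra)) as D. replace (2 * (ta / 2)) with ta in D by field.
        fold mm in D. apply (Rmult_le_compat_r mm) in D; [|lra].
        replace (m ta / mm * mm) with (m ta) in D by (field; lra). exact D. }
    rewrite RInt_scal_cont in I1 by profile_cont.
    rewrite <- (profile_slope_diff h h1 h2) in I1 by auto.
    assert (Hslx : sqrt l = sqrt x * sqrt mm) by (apply sqrt_mult; lra).
    assert (Hxx : sqrt x * sqrt x = x) by (apply sqrt_sqrt; lra).
    apply (Rmult_le_reg_l (sqrt l)); auto. rewrite Rinv_r by lra.
    rewrite <- E, Hslx.
    replace (sqrt x * sqrt mm * (K * sqrt x * RInt (fun t => sqrt (h2 t)) sg ta))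
      with (x * (K * sqrt mm * RInt (fun t => sqrt (h2 t)) sg ta)) by (rewrite <- Hxx at 1; ring).
    apply Rmult_le_compat_l; lra. }
  unfold coeff. fold f.
  rewrite (RInt_chasles f 0 (ta / 2) PI), (RInt_chasles f (ta / 2) (2 * d) PI) by auto.
  replace (h1 ta - h1 sg) with (/ x) by (apply (Rmult_eq_reg_l x); [rewrite E; field|]; lra).
  replace (2 / (x * kap)) with (2 / kap * / x) in B3 by (field; lra).
  unfold Rdiv at 1 in B1. unfold Rdiv at 1 in B2.
  apply Rabs_le_between in B1, B2, B3. apply Rabs_le. lra.
Qed.

(** * Stationary phase in the bulk *)

Definition for_large (P : R -> Prop) : Prop := exists X, 0 < X /\ forall x, X <= x -> P x.

Lemma for_large_and P Q : for_large P -> for_large Q -> for_large (fun x => P x /\ Q x).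
Proof.
  intros [X [HX HP]] [Y [HY HQ]]. exists (X + Y). split; [lra|].
  intros x Hx. split; [apply HP | apply HQ]; lra.
Qed.

Lemma for_large_mono (P Q : R -> Prop) : for_large P -> (forall x, 0 < x -> P x -> Q x) -> for_large Q.
Proof. intros [X [HX HP]] H. exists X. split; auto. intros x Hx. apply H; [lra | auto]. Qed.

Lemma for_large_ge c : for_large (fun x => c <= x).
Proof. exists (Rabs c + 1). pose proof (Rabs_pos c). pose proof (Rle_abs c). split; [|intros]; lra. Qed.

Lemma for_large_mul_ge c k : 0 < k -> for_large (fun x => c <= k * x).
Proof.
  intros Hk. apply (for_large_mono _ _ (for_large_ge (c / k))). intros x _ Hx.
  replace c with (k * (c / k)) by (field; lra). apply Rmult_le_compat_l; lra.
Qed.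

Lemma lipschitz_bound (f f1 : R -> R) k a b :
  (forall t, is_derive f t (f1 t)) ->
  (forall t, Rmin a b <= t <= Rmax a b -> Rabs (f1 t) <= k) ->
  Rabs (f b - f a) <= k * Rabs (b - a).
Proof.
  intros Hd Hk. destruct (MVT_gen f a b f1) as [c [Hc ->]].
  - intros; apply Hd.
  - intros t _. apply continuity_pt_filterlim. eapply cR_derive. apply Hd.
  - rewrite Rabs_mult. apply Rmult_le_compat_r; [apply Rabs_pos|]. now apply Hk.
Qed.

Lemma cos_lipschitz u v : Rabs (cos v - cos u) <= Rabs (v - u).
Proof.
  rewrite <- (Rmult_1_l (Rabs (v - u))).
  apply (lipschitz_bound cos (fun t => - sin t)).
  - apply is_derive_cos.
  - intros t _. rewrite Rabs_Ropp. apply Rabs_sin_le.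
Qed.

Lemma RInt_even_primitive (f : R -> R) T : (forall t, continuous f t) ->
  (forall t, f (- t) = f t) -> RInt f 0 (- T) = - RInt f 0 T.
Proof.
  intros Hf He. pose proof (RInt_reflect f 0 0 T Hf) as E.
  rewrite (RInt_ext _ f) in E by (intros; rewrite Rminus_0_l; apply He).
  rewrite Rminus_0_l, Rminus_diag in E.
  pose proof (RInt_chasles f 0 (- T) 0 Hf) as C. rewrite (RInt_point 0 f) in C.
  unfold zero in C; simpl in C. lra.
Qed.

Lemma fresnel_odd T : fresnel_cos (- T) = - fresnel_cos T /\ fresnel_sin (- T) = - fresnel_sin T.
Proof.
  split.
  - apply (RInt_even_primitive (fun s => cos (s * s))); [cont | intros; f_equal; ring].
  - apply (RInt_even_primitive (fun s => sin (s * s))); [cont | intros; f_equal; ring].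
Qed.

Lemma quadratic_window theta a tau r : 0 < a ->
  RInt (fun t => cos (theta + a * ((t - tau) * (t - tau)))) (tau - r) (tau + r)
  = 2 / sqrt a * (cos theta * fresnel_cos (r * sqrt a) - sin theta * fresnel_sin (r * sqrt a)).
Proof.
  intros Ha. set (s := sqrt a).
  assert (Hs : 0 < s) by now apply sqrt_lt_R0.
  assert (Hss : s * s = a) by (apply sqrt_sqrt; lra).
  rewrite (RInt_ftc (fun t => / s * (cos theta * fresnel_cos ((t - tau) * s)
    - sin theta * fresnel_sin ((t - tau) * s)))).
  - replace ((tau + r - tau) * s) with (r * s) by ring.
    replace ((tau - r - tau) * s) with (- (r * s)) by ring.
    destruct (fresnel_odd (r * s)) as [-> ->]. eqR. field. lra.
  - intros t.
    assert (Hl : is_derive (fun t => (t - tau) * s) t s) by (auto_derive; [auto | eqR; ring]).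
    apply is_derive_value with (/ s * (cos theta * (s * cos ((t - tau) * s * ((t - tau) * s)))
      - sin theta * (s * sin ((t - tau) * s * ((t - tau) * s))))).
    + apply (is_derive_scal (fun t => cos theta * fresnel_cos ((t - tau) * s)
        - sin theta * fresnel_sin ((t - tau) * s))).
      apply (is_derive_minus (fun t => cos theta * fresnel_cos ((t - tau) * s))
        (fun t => sin theta * fresnel_sin ((t - tau) * s))).
      * apply (is_derive_scal (fun t => fresnel_cos ((t - tau) * s))).
        apply (is_derive_comp fresnel_cos (fun t => (t - tau) * s)); auto.
        apply is_derive_fresnel_cos.
      * apply (is_derive_scal (fun t => fresnel_sin ((t - tau) * s))).
        apply (is_derive_comp fresnel_sin (fun t => (t - tau) * s)); auto.
        apply is_derive_fresnel_sin.
    + rewrite cos_plus.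
      replace ((t - tau) * s * ((t - tau) * s)) with (a * ((t - tau) * (t - tau)))
        by (rewrite <- Hss; ring).
      field. lra.
  - cont.
Qed.

Lemma continuous_min (f : R -> R) a b : a <= b -> (forall t, continuous f t) ->
  exists s, a <= s <= b /\ forall t, a <= t <= b -> f s <= f t.
Proof.
  intros Hab Hf. destruct (continuity_ab_min f a b Hab) as [s [H1 H2]].
  - intros t _. apply continuity_pt_filterlim, Hf.
  - exists s. auto.
Qed.

Lemma continuous_bounded (f : R -> R) a b : (forall t, continuous f t) ->
  exists M, 0 < M /\ forall t, a <= t <= b -> Rabs (f t) <= M.
Proof.
  intros Hf. destruct (Rle_dec a b) as [Hab|Hab].
  - destruct (continuous_min (fun t => - Rabs (f t)) a b Hab) as [s [_ Hs]]; [cont|].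
    exists (Rabs (f s) + 1). split; [pose proof (Rabs_pos (f s)); lra|].
    intros t Ht. specialize (Hs t Ht). lra.
  - exists 1. split; [lra|]. intros t Ht. lra.
Qed.

Lemma uniformly_continuous (f : R -> R) a b eps : (forall t, continuous f t) -> 0 < eps ->
  exists delta, 0 < delta /\ forall s t, a <= s <= b -> a <= t <= b -> Rabs (s - t) < delta ->
    Rabs (f s - f t) <= eps.
Proof.
  intros Hf He. destruct (Heine_cor2 (f := f) (a := a) (b := b)) with (eps := mkposreal eps He) as [d Hd].
  - intros t _. apply continuity_pt_filterlim, Hf.
  - exists d. split; [apply cond_pos|]. intros s t Hs Ht Hst. apply Rlt_le. now apply Hd.
Qed.

Lemma profile_curvature_min h h1 h2 p q : profile h h1 h2 -> 0 < p <= q -> q < PI ->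
  exists m, 0 < m /\ forall t, p <= t <= q -> m <= h2 t.
Proof.
  intros H Hpq Hq. destruct (continuous_min h2 p q) as [s [Hs Hm]]; [lra | apply H |].
  exists (h2 s). split; [apply (profile_pos _ _ _ H); lra | exact Hm].
Qed.

(** Compare the phase with its quadratic Taylor polynomial on a window of radius
    [M / sqrt x]: [M] large makes the two tails small, and then [x] large makes
    the Taylor error small on the window. *)
Lemma coeff_stationary h h1 h2 c0 p q eps : profile h h1 h2 ->
  (forall T, 0 < T -> Rabs (fresnel_cos T - c0) <= / T /\ Rabs (fresnel_sin T - c0) <= / T) ->
  0 < p <= q -> q < PI -> 0 < eps ->
  for_large (fun x => forall tau, p <= tau <= q ->
  Rabs (sqrt x * coeff h x (x * h1 tau)
    - 2 * c0 * sqrt (2 / h2 tau)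
      * (cos (x * h tau - x * h1 tau * tau) - sin (x * h tau - x * h1 tau * tau))) <= eps).
Proof.
  intros H Hfr Hpq Hq Heps. pose proof PI_RGT_0.
  set (p' := p / 2). set (q' := (q + PI) / 2).
  destruct (profile_curvature_min h h1 h2 p' q' H) as [m [Hm Hmin]]; [unfold p', q'; lra..|].
  set (M := 24 / (m * eps)).
  assert (HM : 0 < M) by (apply Rdiv_lt_0_compat; nra).
  set (om := eps / (4 * M ^ 3)).
  assert (HM3 : 0 < M ^ 3) by now apply pow_lt.
  assert (Hom : 0 < om) by (apply Rdiv_lt_0_compat; lra).
  destruct (uniformly_continuous h2 p' q' om) as [del [Hdel Huc]]; [apply H | auto |].
  set (rho := Rmin (Rmin (p / 2) ((PI - q) / 2)) (del / 2)).
  assert (Hrho : 0 < rho /\ rho <= p / 2 /\ rho <= (PI - q) / 2 /\ rho < del).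
  { unfold rho. pose proof (Rmin_l (Rmin (p / 2) ((PI - q) / 2)) (del / 2)).
    pose proof (Rmin_r (Rmin (p / 2) ((PI - q) / 2)) (del / 2)).
    pose proof (Rmin_l (p / 2) ((PI - q) / 2)). pose proof (Rmin_r (p / 2) ((PI - q) / 2)).
    repeat split; try lra. repeat apply Rmin_glb_lt; lra. }
  exists ((M / rho) ^ 2). split; [apply pow_lt, Rdiv_lt_0_compat; lra|].
  intros x Hx ta Hta.
  assert (Hsx : M / rho <= sqrt x).
  { rewrite <- (sqrt_pow2 (M / rho)) by (apply Rlt_le, Rdiv_lt_0_compat; lra).
    now apply sqrt_le_1_alt. }
  assert (Hsx0 : 0 < sqrt x).
  { apply Rlt_le_trans with (M / rho); auto. apply Rdiv_lt_0_compat; lra. }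
  assert (Hx0 : 0 < x).
  { destruct (Rlt_le_dec 0 x) as [|Hn]; auto. rewrite sqrt_neg_0 in Hsx0; lra. }
  assert (Hxx : sqrt x * sqrt x = x) by (apply sqrt_sqrt; lra).
  set (r := M / sqrt x).
  assert (Hr : 0 < r) by now apply Rdiv_lt_0_compat.
  assert (Hrr : r <= rho).
  { unfold r. apply (Rmult_le_reg_r (sqrt x)); auto.
    replace (M / sqrt x * sqrt x) with (M / rho * rho) by (field; lra).
    rewrite (Rmult_comm rho). apply Rmult_le_compat_r; lra. }
  assert (Hrs : r * sqrt x = M) by (unfold r; field; lra).
  assert (Hxr : x * r = M * sqrt x) by (rewrite <- Hrs, <- Hxx at 1; ring).
  set (theta := x * h ta - x * h1 ta * ta).
  set (a := x * h2 ta / 2).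
  pose proof (Hmin ta ltac:(unfold p', q'; lra)) as Hmta.
  assert (Ha : 0 < a) by (unfold a; nra).
  pose proof (profile_phase h h1 h2 x (x * h1 ta) H) as Hph.
  set (phi := fun t => x * h t - x * h1 ta * t) in *.
  set (quad := fun t => theta + a * ((t - ta) * (t - ta))).
  assert (Hnn : forall a b, 0 <= a -> b <= PI -> forall t, a <= t <= b -> 0 <= x * h2 t).
  { intros u v Hu Hv t Ht. apply Rmult_le_pos; [lra|]. apply (profile_nonneg _ _ _ H). lra. }
  assert (Hlow : forall t, p' <= t <= q' -> x * m <= x * h2 t).
  { intros t Ht. apply Rmult_le_compat_l; [lra|]. now apply Hmin. }
  pose proof (phase_cos_continuous _ _ _ Hph) as Hc.
  assert (Hcq : forall t, continuous (fun s => cos (quad s)) t) by (unfold quad; cont).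
  assert (HL : 0 < x * m * r) by (apply Rmult_lt_0_compat; [apply Rmult_lt_0_compat|]; lra).
  assert (Hxor : 0 < x * (om * r)).
  { apply Rmult_lt_0_compat; [lra|]. apply Rmult_lt_0_compat; lra. }
  assert (B1 : Rabs (RInt (fun s => cos (phi s)) 0 (ta - r)) <= 2 / (x * m * r)).
  { apply (first_derivative_test _ _ _ (x * m * r) 0 (ta - r) Hph);
      [lra | lra | apply Hnn; lra |]. right. cbv beta.
    pose proof (phase_slope_growth _ _ _ (x * m) (ta - r) ta Hph ltac:(lra)
      ltac:(intros; apply Hlow; unfold p', q'; lra)) as G. cbv beta in G. lra. }
  assert (B3 : Rabs (RInt (fun s => cos (phi s)) (ta + r) PI) <= 2 / (x * m * r)).
  { apply (first_derivative_test _ _ _ (x * m * r) (ta + r) PI Hph);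
      [lra | lra | apply Hnn; lra |]. left. cbv beta.
    pose proof (phase_slope_growth _ _ _ (x * m) ta (ta + r) Hph ltac:(lra)
      ltac:(intros; apply Hlow; unfold p', q'; lra)) as G. cbv beta in G. lra. }
  assert (T1 : forall t, Rabs (t - ta) <= r -> Rabs (h1 t - h1 ta - h2 ta * (t - ta)) <= om * r).
  { intros t Ht.
    replace (h1 t - h1 ta - h2 ta * (t - ta)) with ((h1 t - h2 ta * t) - (h1 ta - h2 ta * ta)) by ring.
    apply Rle_trans with (om * Rabs (t - ta)); [|apply Rmult_le_compat_l; lra].
    apply (lipschitz_bound (fun s => h1 s - h2 ta * s) (fun s => h2 s - h2 ta)).
    - intros s. apply (is_derive_minus h1 (fun s => h2 ta * s)); [apply H|].
      auto_derive; [auto | eqR; ring].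
    - intros s Hs. apply Rabs_le_between in Ht.
      assert (Hs' : ta - r <= s <= ta + r).
      { revert Hs. unfold Rmin, Rmax. destruct (Rle_dec ta t); lra. }
      apply Huc; [unfold p', q'; lra | unfold p', q'; lra | apply Rabs_def1; lra]. }
  assert (T2 : forall t, Rabs (t - ta) <= r -> Rabs (phi t - quad t) <= x * (om * r) * r).
  { intros t Ht.
    replace (phi t - quad t) with ((phi t - quad t) - (phi ta - quad ta))
      by (unfold phi, quad, theta; ring).
    apply Rle_trans with (x * (om * r) * Rabs (t - ta)).
    2: { apply Rmult_le_compat_l; lra. }
    apply (lipschitz_bound (fun s => phi s - quad s)
      (fun s => x * (h1 s - h1 ta - h2 ta * (s - ta)))).
    - intros s.
      apply is_derive_value with ((x * h1 s - x * h1 ta) - a * (2 * (s - ta))).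
      + apply (is_derive_minus phi quad); [apply Hph|].
        unfold quad. auto_derive; [auto | eqR; ring].
      + unfold a. field.
    - intros s Hs. rewrite Rabs_mult, (Rabs_right x) by lra.
      apply Rmult_le_compat_l; [lra|]. apply T1.
      apply Rabs_le_between in Ht. apply Rabs_le.
      revert Hs. unfold Rmin, Rmax. destruct (Rle_dec ta t); lra. }
  assert (B2 : Rabs (RInt (fun s => cos (phi s)) (ta - r) (ta + r)
    - RInt (fun s => cos (quad s)) (ta - r) (ta + r)) <= x * (om * r) * r * (2 * r)).
  { rewrite <- RInt_sub_cont by auto.
    replace (2 * r) with (ta + r - (ta - r)) by ring.
    apply RInt_abs_bound; [lra | |].
    - intros t. apply cR_minus; auto.
    - intros t Ht. eapply Rle_trans; [apply cos_lipschitz|].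
      apply T2. apply Rabs_le. lra. }
  (* the Fresnel tails beyond the window have total size at most [4 / (r a)] *)
  assert (Hsa : 0 < sqrt a) by now apply sqrt_lt_R0.
  assert (Haa : sqrt a * sqrt a = a) by (apply sqrt_sqrt; lra).
  assert (B4 : Rabs (RInt (fun s => cos (quad s)) (ta - r) (ta + r)
    - 2 / sqrt a * (c0 * (cos theta - sin theta))) <= 8 / (x * m * r)).
  { unfold quad. rewrite quadratic_window by exact Ha.
    destruct (Hfr (r * sqrt a)) as [F1 F2]; [now apply Rmult_lt_0_compat|].
    replace (2 / sqrt a * (cos theta * fresnel_cos (r * sqrt a) - sin theta * fresnel_sin (r * sqrt a))
      - 2 / sqrt a * (c0 * (cos theta - sin theta)))
      with (2 / sqrt a * (cos theta * (fresnel_cos (r * sqrt a) - c0)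
        - sin theta * (fresnel_sin (r * sqrt a) - c0))) by ring.
    rewrite Rabs_mult, (Rabs_right (2 / sqrt a)) by (apply Rgt_ge, Rdiv_lt_0_compat; lra).
    apply Rle_trans with (2 / sqrt a * (2 * / (r * sqrt a))).
    - apply Rmult_le_compat_l; [apply Rlt_le, Rdiv_lt_0_compat; lra|].
      unfold Rminus at 1. eapply Rle_trans; [apply Rabs_triang|].
      rewrite Rabs_Ropp, !Rabs_mult.
      assert (Rabs (cos theta) <= 1) by apply Rabs_cos_le.
      assert (Rabs (sin theta) <= 1) by apply Rabs_sin_le.
      pose proof (Rabs_pos (cos theta)). pose proof (Rabs_pos (sin theta)).
      pose proof (Rabs_pos (fresnel_cos (r * sqrt a) - c0)).
      pose proof (Rabs_pos (fresnel_sin (r * sqrt a) - c0)). nra.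
    - replace (2 / sqrt a * (2 * / (r * sqrt a))) with (4 * / (r * (sqrt a * sqrt a)))
        by (field; lra).
      rewrite Haa.
      unfold a. replace (4 * / (r * (x * h2 ta / 2))) with (8 * / (x * h2 ta * r)) by (field; lra).
      unfold Rdiv. apply Rmult_le_compat_l; [lra|]. apply Rinv_le_contravar; [lra|].
      apply Rmult_le_compat_r; [lra|]. apply Rmult_le_compat_l; lra. }
  assert (Hamp : sqrt x * (2 / sqrt a) = 2 * sqrt (2 / h2 ta)).
  { replace (2 / h2 ta) with (x / a) by (unfold a; field; lra).
    rewrite sqrt_div by lra. unfold Rdiv. ring. }
  set (main := c0 * (cos theta - sin theta)) in *.
  replace (2 * c0 * sqrt (2 / h2 ta) * (cos theta - sin theta))
    with (sqrt x * (2 / sqrt a * main)).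
  2: { unfold main. rewrite <- Rmult_assoc, Hamp. ring. }
  rewrite <- Rmult_minus_distr_l, Rabs_mult, (Rabs_right (sqrt x)) by lra.
  apply Rle_trans with (sqrt x * (12 / (x * m * r) + x * (om * r) * r * (2 * r))).
  - apply Rmult_le_compat_l; [lra|].
    change (coeff h x (x * h1 ta)) with (RInt (fun s => cos (phi s)) 0 PI).
    rewrite (RInt_chasles _ 0 (ta - r) PI), (RInt_chasles _ (ta - r) (ta + r) PI) by auto.
    unfold Rdiv in B1, B3, B4 |- *.
    apply Rabs_le_between in B1, B2, B3, B4. apply Rabs_le. lra.
  - replace (x * m * r) with (m * M * sqrt x) 
      by (transitivity (m * (x * r)); [rewrite Hxr; ring | ring]).
    replace (x * (om * r) * r * (2 * r)) with (2 * om * M ^ 3 / sqrt x).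
    2: { transitivity (2 * om * (sqrt x * sqrt x) * r * r * r).
         - unfold r. field. lra.
         - rewrite Hxx. ring. }
    replace (sqrt x * (12 / (m * M * sqrt x) + 2 * om * M ^ 3 / sqrt x))
      with (12 / (m * M) + 2 * om * M ^ 3) by (field; lra).
    unfold om. replace (12 / (m * M)) with (eps / 2) by (unfold M; field; lra).
    replace (2 * (eps / (4 * M ^ 3)) * M ^ 3) with (eps / 2) by (field; lra). lra.
Qed.

(** * Stationary points as a function of the frequency *)

Definition clamp (a b y : R) : R := Rmax a (Rmin b y).

Lemma clamp_spec a b y : a <= b ->
  (y <= a /\ clamp a b y = a) \/ (a <= y <= b /\ clamp a b y = y) \/ (b <= y /\ clamp a b y = b).
Proof.
  intros H. unfold clamp, Rmax, Rmin. destruct (Rle_dec b y); destruct (Rle_dec a _); lra.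
Qed.

Definition slope_inverse (h1 : R -> R) (p q : R) (T : R -> R) : Prop :=
  forall y, p <= T y <= q /\ h1 (T y) = clamp (h1 p) (h1 q) y.

Lemma slope_inverse_exists h h1 h2 p q : profile h h1 h2 -> 0 <= p < q -> q <= PI ->
  exists T, slope_inverse h1 p q T.
Proof.
  intros H Hpq Hq.
  pose proof (profile_slope_le h h1 h2 p q H ltac:(lra) Hq) as Hle.
  assert (Hc : continuity h1).
  { intros t. apply continuity_pt_filterlim. eapply cR_derive. apply H. }
  assert (Hy : forall y, Rmin (h1 p) (h1 q) <= clamp (h1 p) (h1 q) y <= Rmax (h1 p) (h1 q)).
  { intros y. rewrite Rmin_left, Rmax_right by lra. pose proof (clamp_spec (h1 p) (h1 q) y Hle). lra. }
  exists (fun y => proj1_sig (IVT_gen h1 p q (clamp (h1 p) (h1 q) y) Hc (Hy y))).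
  intros y. destruct (IVT_gen h1 p q _ Hc (Hy y)) as [t [Ht E]]. simpl.
  rewrite Rmin_left, Rmax_right in Ht by lra. auto.
Qed.

Lemma slope_injective h h1 h2 s t : profile h h1 h2 -> 0 <= s <= PI -> 0 <= t <= PI ->
  h1 s = h1 t -> s = t.
Proof.
  intros H Hs Ht E. destruct (Rtotal_order s t) as [L|[L|L]]; auto.
  - pose proof (profile_slope_lt h h1 h2 s t H ltac:(lra) ltac:(lra)). lra.
  - pose proof (profile_slope_lt h h1 h2 t s H ltac:(lra) ltac:(lra)). lra.
Qed.

Lemma slope_le_reflect h h1 h2 s t : profile h h1 h2 -> 0 <= s <= PI -> 0 <= t <= PI ->
  h1 s <= h1 t -> s <= t.
Proof.
  intros H Hs Ht E. destruct (Rle_lt_dec s t) as [|L]; auto.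
  pose proof (profile_slope_lt h h1 h2 t s H ltac:(lra) ltac:(lra)). lra.
Qed.

Lemma slope_inverse_in h h1 h2 p q T y : profile h h1 h2 -> 0 <= p < q -> q <= PI ->
  slope_inverse h1 p q T -> h1 p <= y <= h1 q -> h1 (T y) = y.
Proof.
  intros H Hpq Hq HT Hy. destruct (HT y) as [_ ->].
  pose proof (clamp_spec (h1 p) (h1 q) y ltac:(lra)). lra.
Qed.

Lemma slope_inverse_below h h1 h2 p q T y : profile h h1 h2 -> 0 <= p < q -> q <= PI ->
  slope_inverse h1 p q T -> y <= h1 p -> T y = p.
Proof.
  intros H Hpq Hq HT Hy. destruct (HT y) as [Hr E].
  pose proof (profile_slope_le h h1 h2 p q H ltac:(lra) Hq) as Hle.
  apply (slope_injective h h1 h2); auto; try lra.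
  rewrite E. pose proof (clamp_spec (h1 p) (h1 q) y ltac:(lra)). lra.
Qed.

Lemma slope_inverse_above h h1 h2 p q T y : profile h h1 h2 -> 0 <= p < q -> q <= PI ->
  slope_inverse h1 p q T -> h1 q <= y -> T y = q.
Proof.
  intros H Hpq Hq HT Hy. destruct (HT y) as [Hr E].
  pose proof (profile_slope_le h h1 h2 p q H ltac:(lra) Hq) as Hle.
  apply (slope_injective h h1 h2); auto; try lra.
  rewrite E. pose proof (clamp_spec (h1 p) (h1 q) y ltac:(lra)). lra.
Qed.

Lemma slope_inverse_le h h1 h2 p q T y z : profile h h1 h2 -> 0 <= p < q -> q <= PI ->
  slope_inverse h1 p q T -> y <= z -> T y <= T z.
Proof.
  intros H Hpq Hq HT Hyz. destruct (HT y) as [Hr E]. destruct (HT z) as [Hr' E'].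
  pose proof (profile_slope_le h h1 h2 p q H ltac:(lra) Hq) as Hle.
  apply (slope_le_reflect h h1 h2); auto; try lra.
  pose proof (clamp_spec (h1 p) (h1 q) y ltac:(lra)).
  pose proof (clamp_spec (h1 p) (h1 q) z ltac:(lra)). lra.
Qed.

Lemma slope_inverse_lipschitz h h1 h2 p q T m y z : profile h h1 h2 -> 0 <= p < q -> q <= PI ->
  slope_inverse h1 p q T -> 0 < m -> (forall t, p <= t <= q -> m <= h2 t) -> y <= z ->
  m * (T z - T y) <= z - y.
Proof.
  intros H Hpq Hq HT Hm Hmin Hyz.
  pose proof (slope_inverse_le h h1 h2 p q T y z H Hpq Hq HT Hyz) as Hle.
  destruct (HT y) as [Hr E]. destruct (HT z) as [Hr' E'].
  assert (Hph : phase h h1 h2) by (split; apply H).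
  pose proof (phase_slope_growth h h1 h2 m (T y) (T z) Hph Hle ltac:(intros; apply Hmin; lra)).
  pose proof (profile_slope_le h h1 h2 p q H ltac:(lra) Hq).
  pose proof (clamp_spec (h1 p) (h1 q) y ltac:(lra)).
  pose proof (clamp_spec (h1 p) (h1 q) z ltac:(lra)). lra.
Qed.

(** Convexity makes the stationary value a Legendre transform: it is the
    minimum over [[p,q]], including at frequencies where [T] is clamped. *)
Lemma stationary_value_min h h1 h2 p q T x y t : profile h h1 h2 -> 0 <= p < q -> q <= PI ->
  slope_inverse h1 p q T -> 0 < x -> p <= t <= q ->
  x * h (T (y / x)) - y * T (y / x) <= x * h t - y * t.
Proof.
  intros H Hpq Hq HT Hx Ht. destruct (HT (y / x)) as [Hr E].
  set (s := T (y / x)) in *.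
  pose proof (profile_slope_le h h1 h2 p q H ltac:(lra) Hq) as Hle.
  pose proof (clamp_spec (h1 p) (h1 q) (y / x) Hle) as Hcl. rewrite <- E in Hcl.
  assert (Hyx : x * (y / x) = y) by (field; lra).
  assert (Hup : y <= x * h1 s \/ s = q).
  { destruct Hcl as [[? ?]|[[? ?]|[? ?]]].
    - left. nra.
    - left. nra.
    - right. apply (slope_injective h h1 h2); auto; lra. }
  assert (Hdn : x * h1 s <= y \/ s = p).
  { destruct Hcl as [[? ?]|[[? ?]|[? ?]]].
    - right. apply (slope_injective h h1 h2); auto; lra.
    - left. nra.
    - left. nra. }
  pose proof (profile_phase h h1 h2 x y H) as [Hd _].
  destruct (Rle_lt_dec s t) as [Hst|Hts].
  - destruct Hup as [Hup|Hup]; [|replace t with s by lra; lra].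
    apply (nondecreasing_of_derive (fun t => x * h t - y * t) (fun t => x * h1 t - y)); auto.
    intros u Hu. pose proof (profile_slope_le h h1 h2 s u H ltac:(lra) ltac:(lra)). nra.
  - destruct Hdn as [Hdn|Hdn]; [|lra].
    apply Ropp_le_cancel.
    apply (nondecreasing_of_derive (fun t => - (x * h t - y * t)) (fun t => - (x * h1 t - y))); [lra | |].
    + intros u Hu. apply (is_derive_opp (fun t => x * h t - y * t)). apply Hd.
    + intros u Hu. pose proof (profile_slope_le h h1 h2 u s H ltac:(lra) ltac:(lra)). nra.
Qed.

Definition stat_point (T : R -> R) (x : R) (n : Z) : R := T (IZR n / x).
Definition stat_value (h T : R -> R) (x : R) (n : Z) : R :=
  x * h (stat_point T x n) - IZR n * stat_point T x n.

Lemma stat_point_step h h1 h2 p q T m x n : profile h h1 h2 -> 0 <= p < q -> q <= PI ->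
  slope_inverse h1 p q T -> 0 < m -> (forall t, p <= t <= q -> m <= h2 t) -> 0 < x ->
  0 <= stat_point T x (n + 1) - stat_point T x n <= / (m * x).
Proof.
  intros H Hpq Hq HT Hm Hmin Hx. unfold stat_point.
  assert (Hx' : 0 < / x) by now apply Rinv_0_lt_compat.
  assert (Hle : IZR n / x <= IZR (n + 1) / x) by (unfold Rdiv; rewrite plus_IZR; nra).
  pose proof (slope_inverse_le h h1 h2 p q T _ _ H Hpq Hq HT Hle).
  pose proof (slope_inverse_lipschitz h h1 h2 p q T m _ _ H Hpq Hq HT Hm Hmin Hle) as B.
  split; [lra|].
  replace (IZR (n + 1) / x - IZR n / x) with (/ x) in B by (rewrite plus_IZR; field; lra).
  apply (Rmult_le_reg_l m); auto. replace (m * / (m * x)) with (/ x) by (field; lra). exact B.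
Qed.

(** Test the minimum at frequency [n'] with the stationary point of [n]. Exchanging
    [n] and [n'] gives the opposite bound, so the increment is [- t_n] up to the
    motion of the stationary point. *)
Lemma stat_value_step h h1 h2 p q T x n n' : profile h h1 h2 -> 0 <= p < q -> q <= PI ->
  slope_inverse h1 p q T -> 0 < x ->
  stat_value h T x n' - stat_value h T x n <= - (IZR n' - IZR n) * stat_point T x n.
Proof.
  intros H Hpq Hq HT Hx.
  pose proof (stationary_value_min h h1 h2 p q T x (IZR n') (stat_point T x n) H Hpq Hq HT Hx) as B.
  lapply B; [|apply HT]. unfold stat_value, stat_point. lra.
Qed.

(** * Sums over stationary points as Riemann sums *)

(** Windows are half-open, so [bulk_lo h1 p x] and [bulk_lo h1 q x] delimit the integers
    [n] with [x h1(p) < n <= x h1(q)]. *)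
Definition bulk_lo (h1 : R -> R) (p x : R) : Z := up (x * h1 p).

Lemma bulk_window h h1 h2 p q x : profile h h1 h2 -> 0 <= p < q -> q <= PI -> 0 < x ->
  (bulk_lo h1 p x <= bulk_lo h1 q x)%Z /\
  IZR (bulk_lo h1 q x) - IZR (bulk_lo h1 p x) <= x * (h1 q - h1 p) + 1.
Proof.
  intros H Hpq Hq Hx. unfold bulk_lo.
  pose proof (profile_slope_le h h1 h2 p q H ltac:(lra) Hq).
  destruct (archimed (x * h1 p)) as [A1 A2]. destruct (archimed (x * h1 q)) as [A3 A4].
  assert (x * h1 p <= x * h1 q) by (apply Rmult_le_compat_l; lra).
  split; [|lra].
  apply Z.lt_succ_r, lt_IZR. rewrite <- Z.add_1_r, plus_IZR. lra.
Qed.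

(** Consecutive stationary points enclose mass exactly [1 / x] for [h''(t) dt]. *)
Lemma riemann_step h h1 h2 T (F : R -> R) om x p q n : profile h h1 h2 -> 0 <= p < q -> q <= PI ->
  slope_inverse h1 p q T -> (forall t, continuous F t) -> 0 < x ->
  x * h1 p <= IZR n -> IZR (n + 1) <= x * h1 q ->
  (forall t, stat_point T x n <= t <= stat_point T x (n + 1) ->
    Rabs (F t - F (stat_point T x n)) <= om) ->
  Rabs (F (stat_point T x n)
    - x * RInt (fun t => F t * h2 t) (stat_point T x n) (stat_point T x (n + 1))) <= om.
Proof.
  intros H Hpq Hq HT HF Hx Hn Hn1 Hom.
  assert (Hx' : 0 < / x) by now apply Rinv_0_lt_compat.
  assert (Hle : IZR n / x <= IZR (n + 1) / x) by (unfold Rdiv; rewrite plus_IZR; nra).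
  pose proof (slope_inverse_le h h1 h2 p q T _ _ H Hpq Hq HT Hle) as Hmono.
  rewrite plus_IZR in Hn1.
  assert (E0 : h1 (stat_point T x n) = IZR n / x).
  { apply (slope_inverse_in h h1 h2 p q); auto. split; apply (Rmult_le_reg_l x); auto;
    replace (x * (IZR n / x)) with (IZR n) by (field; lra); lra. }
  assert (E1 : h1 (stat_point T x (n + 1)) = IZR (n + 1) / x).
  { apply (slope_inverse_in h h1 h2 p q); auto. rewrite plus_IZR. split; apply (Rmult_le_reg_l x); auto;
    replace (x * ((IZR n + 1) / x)) with (IZR n + 1) by (field; lra); lra. }
  fold (stat_point T x n) (stat_point T x (n + 1)) in Hmono.
  assert (Hr : p <= stat_point T x n <= q) by apply HT.
  assert (Hr' : p <= stat_point T x (n + 1) <= q) by apply HT.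
  set (s := stat_point T x n) in *. set (s' := stat_point T x (n + 1)) in *.
  assert (Hmass : x * RInt h2 s s' = 1).
  { rewrite <- (profile_slope_diff h h1 h2) by auto. rewrite E0, E1, plus_IZR. field. lra. }
  assert (Hh2 := profile_continuous _ _ _ H).
  assert (Hpos : forall t, s <= t <= s' -> 0 <= h2 t).
  { intros t Ht. apply (profile_nonneg _ _ _ H). lra. }
  assert (U : RInt (fun t => F t * h2 t) s s' <= (F s + om) * RInt h2 s s').
  { rewrite <- RInt_scal_cont by auto. apply RInt_le; [lra | apply ex_RInt_cont; cont | apply ex_RInt_cont; cont |].
    intros t Ht. apply Rmult_le_compat_r; [apply Hpos; lra|].
    specialize (Hom t ltac:(lra)). apply Rabs_le_between in Hom. lra. }
  assert (L : (F s - om) * RInt h2 s s' <= RInt (fun t => F t * h2 t) s s').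
  { rewrite <- RInt_scal_cont by auto. apply RInt_le; [lra | apply ex_RInt_cont; cont | apply ex_RInt_cont; cont |].
    intros t Ht. apply Rmult_le_compat_r; [apply Hpos; lra|].
    specialize (Hom t ltac:(lra)). apply Rabs_le_between in Hom. lra. }
  apply (Rmult_le_compat_l x) in U, L; try lra.
  replace (x * ((F s + om) * RInt h2 s s')) with (F s + om) in U
    by (transitivity ((F s + om) * (x * RInt h2 s s')); [rewrite Hmass; ring | ring]).
  replace (x * ((F s - om) * RInt h2 s s')) with (F s - om) in L
    by (transitivity ((F s - om) * (x * RInt h2 s s')); [rewrite Hmass; ring | ring]).
  apply Rabs_le. lra.
Qed.

Lemma riemann_sum h h1 h2 p q T (F : R -> R) eps : profile h h1 h2 -> 0 < p < q -> q < PI ->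
  slope_inverse h1 p q T -> (forall t, continuous F t) -> 0 < eps ->
  for_large (fun x => Rabs (zsum (fun n => F (stat_point T x n)) (bulk_lo h1 p x) (bulk_lo h1 q x)
    - x * RInt (fun t => F t * h2 t) p q) <= eps * x).
Proof.
  intros H Hpq Hq HT HF Heps. pose proof PI_RGT_0.
  destruct (profile_curvature_min h h1 h2 p q H) as [m [Hm Hmin]]; [lra..|].
  destruct (continuous_bounded F p q HF) as [B [HB HFB]].
  destruct (continuous_bounded (fun t => F t * h2 t) p q) as [D [HD HFD]].
  { profile_cont. }
  set (V := h1 q - h1 p).
  assert (HV : 0 < V).
  { pose proof (profile_slope_lt h h1 h2 p q H ltac:(lra) ltac:(lra)). unfold V. lra. }
  set (om := eps / (4 * V)).
  assert (Hom : 0 < om) by (apply Rdiv_lt_0_compat; lra).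
  destruct (uniformly_continuous F p q om HF Hom) as [del [Hdel Huc]].
  apply (for_large_mono _ _ (for_large_and _ _
    (for_large_and _ _ (for_large_mul_ge 3 V HV) (for_large_mul_ge (2 / del) m Hm))
    (for_large_and _ _ (for_large_mul_ge (8 * B) eps Heps) (for_large_mul_ge (8 * D / m) eps Heps)))).
  intros x Hx0 [[HxV Hmd] [HeB HeD]].
  set (a := bulk_lo h1 p x). set (b := bulk_lo h1 q x).
  destruct (bulk_window h h1 h2 p q x H ltac:(lra) ltac:(lra) Hx0) as [Hab Hlen]. fold a b V in Hab, Hlen.
  destruct (archimed (x * h1 p)) as [A1 A2]. destruct (archimed (x * h1 q)) as [A3 A4].
  fold (bulk_lo h1 p x) in A1, A2. fold (bulk_lo h1 q x) in A3, A4. fold a in A1, A2. fold b in A3, A4.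
  assert (Hab1 : (a <= b - 1)%Z).
  { apply Z.lt_succ_r, lt_IZR. rewrite <- Z.add_1_r, plus_IZR, minus_IZR. unfold V in HxV. lra. }
  set (L := / (m * x)).
  assert (Hmx : 0 < m * x) by (apply Rmult_lt_0_compat; lra).
  assert (HL : 0 < L) by now apply Rinv_0_lt_compat.
  assert (HLx : x * L = / m) by (unfold L; field; lra).
  assert (Hstep : forall n, 0 <= stat_point T x (n + 1) - stat_point T x n <= L).
  { intros n. apply (stat_point_step h h1 h2 p q); auto; lra. }
  assert (HLdel : L < del).
  { apply (Rmult_lt_reg_l (m * x)); auto. unfold L. rewrite Rinv_r by lra.
    apply (Rmult_le_compat_r del) in Hmd; [|lra].
    replace (2 / del * del) with 2 in Hmd by (field; lra). lra. }
  assert (Hrange : forall n, p <= stat_point T x n <= q) by (intros; apply HT).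
  assert (S1 : Rabs (zsum (fun n => F (stat_point T x n)) a (b - 1)
    - x * RInt (fun t => F t * h2 t) (stat_point T x a) (stat_point T x (b - 1)))
    <= om * (x * V + 1)).
  { set (P := fun n => RInt (fun t => F t * h2 t) p (stat_point T x n)).
    assert (Hc : forall t, continuous (fun t => F t * h2 t) t).
    { profile_cont. }
    assert (HP : forall u v, RInt (fun t => F t * h2 t) (stat_point T x u) (stat_point T x v) = P v - P u).
    { intros u v. unfold P. rewrite (RInt_chasles _ p (stat_point T x u) (stat_point T x v)) by auto. lra. }
    rewrite HP, <- (zsum_telescope P) by auto. rewrite <- zsum_scal by auto.
    rewrite <- zsum_minus by auto.
    eapply Rle_trans.
    - apply (zsum_abs_bound _ om); auto. intros n Hn. rewrite <- HP.
      apply (riemann_step h h1 h2 T F om x p q); auto; try lra.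
      + assert (IZR a <= IZR n) by (apply IZR_le; lia). lra.
      + assert (IZR (n + 1) <= IZR (b - 1)) by (apply IZR_le; lia).
        rewrite (minus_IZR b) in *. lra.
      + intros t Ht. pose proof (Hstep n). pose proof (Hrange n). pose proof (Hrange (n + 1)%Z).
        apply Huc; try lra. apply Rabs_def1; lra.
    - rewrite minus_IZR. apply Rmult_le_compat_l; lra. }
  assert (S2 : Rabs (F (stat_point T x (b - 1))) <= B) by (apply HFB, Hrange).
  assert (Ea : stat_point T x a - p <= L).
  { pose proof (Hstep (a - 1)%Z) as B1. rewrite Z.sub_add in B1.
    assert (E : stat_point T x (a - 1) = p).
    { apply (slope_inverse_below h h1 h2 p q); auto; try lra.
      apply (Rmult_le_reg_l x); auto. rewrite minus_IZR.
      replace (x * ((IZR a - 1) / x)) with (IZR a - 1) by (field; lra). lra. }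
    lra. }
  assert (Eb : q - stat_point T x (b - 1) <= L).
  { pose proof (Hstep (b - 1)%Z) as B1. rewrite Z.sub_add in B1.
    assert (E : stat_point T x b = q).
    { apply (slope_inverse_above h h1 h2 p q); auto; try lra.
      apply (Rmult_le_reg_l x); auto.
      replace (x * (IZR b / x)) with (IZR b) by (field; lra). lra. }
    lra. }
  assert (S3 : Rabs (RInt (fun t => F t * h2 t) p q
    - RInt (fun t => F t * h2 t) (stat_point T x a) (stat_point T x (b - 1))) <= 2 * D * L).
  { assert (Hc : forall t, continuous (fun t => F t * h2 t) t).
    { profile_cont. }
    rewrite (RInt_chasles _ p (stat_point T x a) q), (RInt_chasles _ (stat_point T x a) (stat_point T x (b - 1)) q) by auto.
    pose proof (Hrange a). pose proof (Hrange (b - 1)%Z).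
    pose proof (RInt_abs_bound (fun t => F t * h2 t) p (stat_point T x a) D ltac:(lra) Hc
      ltac:(intros; apply HFD; lra)) as I1.
    pose proof (RInt_abs_bound (fun t => F t * h2 t) (stat_point T x (b - 1)) q D ltac:(lra) Hc
      ltac:(intros; apply HFD; lra)) as I2.
    assert (D * (stat_point T x a - p) <= D * L) by (apply Rmult_le_compat_l; lra).
    assert (D * (q - stat_point T x (b - 1)) <= D * L) by (apply Rmult_le_compat_l; lra).
    apply Rabs_le_between in I1, I2. apply Rabs_le. lra. }
  replace (zsum (fun n => F (stat_point T x n)) a b)
    with (zsum (fun n => F (stat_point T x n)) a (b - 1) + F (stat_point T x (b - 1))).
  2: { rewrite <- zsum_succ by auto. now rewrite Z.sub_add. }
  set (I := RInt (fun t => F t * h2 t) p q) in *.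
  set (I' := RInt (fun t => F t * h2 t) (stat_point T x a) (stat_point T x (b - 1))) in *.
  assert (S4 : Rabs (x * (I - I')) <= 2 * D / m).
  { rewrite Rabs_mult, (Rabs_right x) by lra.
    replace (2 * D / m) with (x * (2 * D * L)).
    2: { transitivity (2 * D * (x * L)); [ring | rewrite HLx; unfold Rdiv; ring]. }
    apply Rmult_le_compat_l; lra. }
  assert (Q1 : om * (x * V + 1) <= eps / 2 * x).
  { unfold om. replace (eps / 2 * x) with (eps / (4 * V) * (2 * (x * V))) by (field; lra).
    apply Rmult_le_compat_l; [apply Rlt_le; auto | lra]. }
  assert (Q2 : B <= eps / 8 * x) by lra.
  assert (Q3 : 2 * D / m <= eps / 4 * x) by lra.
  assert (HBx : 0 < eps * x) by (apply Rmult_lt_0_compat; lra).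
  apply Rabs_le_between in S1, S2, S4. apply Rabs_le. lra.
Qed.

(** * Equidistribution of the stationary values *)

Record bulk_setting (h h1 h2 : R -> R) (p q : R) (T : R -> R) : Prop := {
  bulk_profile : profile h h1 h2;
  bulk_left : 0 < p < q;
  bulk_right : q < PI;
  bulk_inverse : slope_inverse h1 p q T }.

Definition bulk_sum (h1 : R -> R) (p q x : R) (u : Z -> R) : R :=
  zsum u (bulk_lo h1 p x) (bulk_lo h1 q x).

Definition negligible (h1 : R -> R) (p q : R) (u : R -> Z -> R) : Prop :=
  forall eps, 0 < eps -> for_large (fun x => Rabs (bulk_sum h1 p q x (u x)) <= eps * x).

Lemma bulk_window_le h h1 h2 p q T x : bulk_setting h h1 h2 p q T -> 0 < x ->
  (bulk_lo h1 p x <= bulk_lo h1 q x)%Z.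
Proof.
  intros [H H1 H2 HT] Hx. apply (bulk_window h h1 h2 p q x); auto; lra.
Qed.

Lemma negligible_ext h1 p q u v : negligible h1 p q u -> (forall x n, u x n = v x n) ->
  negligible h1 p q v.
Proof.
  intros H E eps He. apply (for_large_mono _ _ (H eps He)). intros x _ B.
  assert (Ew : forall a k, window_sum (u x) a k = window_sum (v x) a k).
  { intros a k. induction k as [|k IH]; simpl; [reflexivity | now rewrite IH, E]. }
  unfold bulk_sum, zsum in *. now rewrite <- Ew.
Qed.

Lemma negligible_plus h h1 h2 p q T u v : bulk_setting h h1 h2 p q T ->
  negligible h1 p q u -> negligible h1 p q v -> negligible h1 p q (fun x n => u x n + v x n).
Proof.
  intros HS Hu Hv eps He.
  apply (for_large_mono _ _ (for_large_and _ _ (Hu (eps / 2) ltac:(lra)) (Hv (eps / 2) ltac:(lra)))).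
  intros x Hx [Bu Bv]. unfold bulk_sum in *.
  rewrite zsum_plus by (eapply bulk_window_le; eauto).
  eapply Rle_trans; [apply Rabs_triang | lra].
Qed.

Lemma negligible_scal h h1 h2 p q T k u : bulk_setting h h1 h2 p q T ->
  negligible h1 p q u -> negligible h1 p q (fun x n => k * u x n).
Proof.
  intros HS Hu eps He.
  assert (Hk : 0 < Rabs k + 1) by (pose proof (Rabs_pos k); lra).
  apply (for_large_mono _ _ (Hu (eps / (Rabs k + 1)) ltac:(apply Rdiv_lt_0_compat; lra))).
  intros x Hx B. unfold bulk_sum in *.
  rewrite zsum_scal by (eapply bulk_window_le; eauto). rewrite Rabs_mult.
  apply Rle_trans with ((Rabs k + 1) * (eps / (Rabs k + 1) * x)).
  - pose proof (Rabs_pos k).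
    pose proof (Rabs_pos (zsum (u x) (bulk_lo h1 p x) (bulk_lo h1 q x))). nra.
  - right. field. lra.
Qed.

(** Errors need only be small in the mean for [h''(t) dt], since their sums are Riemann
    sums. This absorbs the resonant stationary points, where no uniform bound holds. *)
Lemma negligible_approx h h1 h2 p q T u : bulk_setting h h1 h2 p q T ->
  (forall eps, 0 < eps -> exists v G, negligible h1 p q v /\ (forall t, continuous G t) /\
    RInt (fun t => G t * h2 t) p q <= eps /\
    for_large (fun x => forall n, Rabs (u x n - v x n) <= G (stat_point T x n))) ->
  negligible h1 p q u.
Proof.
  intros HS H eps He. destruct HS as [Hpr H1 H2 HT].
  destruct (H (eps / 3) ltac:(lra)) as (v & G & Hv & HG & HI & Hd).
  pose proof (riemann_sum h h1 h2 p q T G (eps / 3) Hpr H1 H2 HT HG ltac:(lra)) as HR.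
  apply (for_large_mono _ _ (for_large_and _ _ (for_large_and _ _ (Hv (eps / 3) ltac:(lra)) HR) Hd)).
  intros x Hx [[Bv BR] Bd].
  assert (Hw : (bulk_lo h1 p x <= bulk_lo h1 q x)%Z) by (apply (bulk_window h h1 h2 p q x); auto; lra).
  unfold bulk_sum in *. set (a := bulk_lo h1 p x) in *. set (b := bulk_lo h1 q x) in *.
  assert (E : zsum (u x) a b
    = zsum (v x) a b
      + zsum (fun n => u x n - v x n) a b)
    by (rewrite zsum_minus by auto; ring).
  rewrite E.
  assert (B2 : Rabs (zsum (fun n => u x n - v x n) a b)
    <= zsum (fun n => G (stat_point T x n)) a b).
  { eapply Rle_trans; [now apply zsum_abs|]. apply zsum_le; auto. }
  assert (x * RInt (fun t => G t * h2 t) p q <= x * (eps / 3)) by (apply Rmult_le_compat_l; lra).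
  apply Rabs_le_between in BR.
  eapply Rle_trans; [apply Rabs_triang|]. lra.
Qed.

Lemma negligible_close h h1 h2 p q T u : bulk_setting h h1 h2 p q T ->
  (forall eps, 0 < eps -> exists v, negligible h1 p q v /\
    for_large (fun x => forall n, Rabs (u x n - v x n) <= eps)) ->
  negligible h1 p q u.
Proof.
  intros HS H. apply (negligible_approx h h1 h2 p q T); auto. intros eps He.
  destruct HS as [Hpr H1 H2 HT].
  assert (HV : 0 < h1 q - h1 p).
  { pose proof (profile_slope_lt h h1 h2 p q Hpr ltac:(lra) ltac:(lra)). lra. }
  destruct (H (eps / (h1 q - h1 p))) as (v & Hv & Hd); [now apply Rdiv_lt_0_compat|].
  exists v, (fun _ => eps / (h1 q - h1 p)). repeat split; auto; [cont|].
  rewrite RInt_scal_cont by apply Hpr.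
  rewrite <- (profile_slope_diff h h1 h2) by auto. right. field. lra.
Qed.

Lemma negligible_telescope h h1 h2 p q T e B : bulk_setting h h1 h2 p q T ->
  (forall x n, Rabs (e x n) <= B) -> negligible h1 p q (fun x n => e x (n + 1)%Z - e x n).
Proof.
  intros HS HB eps He.
  apply (for_large_mono _ _ (for_large_mul_ge (2 * B) eps He)). intros x Hx Hle.
  unfold bulk_sum. rewrite zsum_telescope by (eapply bulk_window_le; eauto).
  pose proof (HB x (bulk_lo h1 p x)) as B1. pose proof (HB x (bulk_lo h1 q x)) as B2.
  apply Rabs_le_between in B1, B2. apply Rabs_le. lra.
Qed.

(** The sequence [c_n = cos (2k (theta_n + psi))] nearly satisfies
    [c_(n+1) + c_(n-1) = 2 cos (2 k t_n) c_n], so [4 sin^2 (k t_n) c_n] is nearly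
    a second difference; against a slowly varying weight it sums to [o(x)]. *)
Lemma negligible_resonance_free h h1 h2 p q T (G : R -> R) k psi : bulk_setting h h1 h2 p q T ->
  (forall t, continuous G t) -> 0 <= k ->
  negligible h1 p q (fun x n => G (stat_point T x n)
    * (sin (k * stat_point T x n) * sin (k * stat_point T x n))
    * cos (2 * k * (stat_value h T x n + psi))).
Proof.
  intros HS HG Hk. pose proof HS as [H H1 H2 HT].
  destruct (continuous_bounded G p q HG) as [B [HB HGB]].
  destruct (profile_curvature_min h h1 h2 p q H) as [m [Hm Hmin]]; [lra..|].
  assert (Hrange : forall x n, p <= stat_point T x n <= q) by (intros; apply HT).
  set (c := fun x n => cos (2 * k * (stat_value h T x n + psi))).
  set (d := fun x n => G (stat_point T x n) * c x n).
  assert (Hc1 : forall x n, Rabs (c x n) <= 1) by (intros; apply Rabs_cos_le).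
  assert (Hd : forall x n, Rabs (d x n) <= B).
  { intros x n. unfold d. rewrite Rabs_mult. pose proof (HGB _ (Hrange x n)).
    pose proof (Hc1 x n). pose proof (Rabs_pos (c x n)).
    pose proof (Rabs_pos (G (stat_point T x n))). nra. }
  apply (negligible_close h h1 h2 p q T); auto. intros eps He.
  exists (fun x n => - / 4 * ((d x (n + 1)%Z - d x (n + 1 - 1)%Z) - (d x n - d x (n - 1)%Z))).
  split.
  { apply (negligible_scal h h1 h2 p q T (- / 4)
      (fun x n => (d x (n + 1)%Z - d x (n + 1 - 1)%Z) - (d x n - d x (n - 1)%Z))); auto.
    apply (negligible_telescope h h1 h2 p q T (fun x n => d x n - d x (n - 1)%Z) (2 * B)); auto.
    intros x n. pose proof (Hd x n) as D1. pose proof (Hd x (n - 1)%Z) as D2.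
    apply Rabs_le_between in D1, D2. apply Rabs_le. lra. }
  destruct (uniformly_continuous G p q eps HG He) as [del [Hdel Huc]].
  apply (for_large_mono _ _ (for_large_and _ _
    (for_large_mul_ge (2 / del) m Hm) (for_large_mul_ge (2 * B * k / eps) m Hm))).
  intros x Hx [L1 L2] n.
  assert (Hmx : 0 < m * x) by (apply Rmult_lt_0_compat; lra).
  set (L := / (m * x)). assert (HL : 0 < L) by now apply Rinv_0_lt_compat.
  assert (HLm : L * (m * x) = 1) by (unfold L; field; lra).
  assert (Hstep : forall n, 0 <= stat_point T x (n + 1) - stat_point T x n <= L).
  { intros j. apply (stat_point_step h h1 h2 p q); auto; lra. }
  assert (HLdel : L < del).
  { apply (Rmult_lt_reg_r (m * x)); auto. rewrite HLm.
    apply (Rmult_le_compat_l del) in L1; [|lra].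
    replace (del * (2 / del)) with 2 in L1 by (field; lra). lra. }
  assert (HLB : 2 * B * k * L <= eps).
  { apply (Rmult_le_reg_r (m * x)); auto. rewrite Rmult_assoc, HLm.
    apply (Rmult_le_compat_l eps) in L2; [|lra].
    replace (eps * (2 * B * k / eps)) with (2 * B * k) in L2 by (field; lra). lra. }
  rewrite Z.add_simpl_r.
  pose proof (Hstep n) as S1. pose proof (Hstep (n - 1)%Z) as S2. rewrite Z.sub_add in S2.
  pose proof (stat_value_step h h1 h2 p q T x n (n + 1) H ltac:(lra) ltac:(lra) HT Hx) as V1.
  pose proof (stat_value_step h h1 h2 p q T x (n + 1) n H ltac:(lra) ltac:(lra) HT Hx) as V2.
  pose proof (stat_value_step h h1 h2 p q T x n (n - 1) H ltac:(lra) ltac:(lra) HT Hx) as V3.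
  pose proof (stat_value_step h h1 h2 p q T x (n - 1) n H ltac:(lra) ltac:(lra) HT Hx) as V4.
  rewrite plus_IZR in V1, V2. rewrite minus_IZR in V3, V4.
  assert (C0 : forall j y, Rabs (stat_value h T x j - stat_value h T x n + y) <= L ->
    Rabs (c x j - cos (2 * k * (stat_value h T x n + psi) - 2 * k * y)) <= 2 * k * L).
  { intros j y Hy. unfold c. eapply Rle_trans; [apply cos_lipschitz|].
    replace (2 * k * (stat_value h T x j + psi) - (2 * k * (stat_value h T x n + psi) - 2 * k * y))
      with (2 * k * (stat_value h T x j - stat_value h T x n + y)) by ring.
    rewrite Rabs_mult, (Rabs_right (2 * k)) by lra. apply Rmult_le_compat_l; lra. }
  pose proof (C0 (n + 1)%Z (stat_point T x n) ltac:(apply Rabs_le; lra)) as C1.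
  pose proof (C0 (n - 1)%Z (- stat_point T x n) ltac:(apply Rabs_le; lra)) as C2.
  rewrite <- Ropp_mult_distr_r in C2. unfold Rminus in C2 at 2. rewrite Ropp_involutive in C2.
  assert (G1 : Rabs (G (stat_point T x (n + 1)) - G (stat_point T x n)) <= eps).
  { apply Huc; auto. apply Rabs_def1; lra. }
  assert (G2 : Rabs (G (stat_point T x (n - 1)) - G (stat_point T x n)) <= eps).
  { apply Huc; auto. apply Rabs_def1; lra. }
  rewrite cos_minus in C1. rewrite cos_plus in C2.
  fold (c x n) in C1, C2 |- *.
  set (cp := c x (n + 1)%Z) in *. set (cm := c x (n - 1)%Z) in *.
  set (t := stat_point T x n) in *.
  assert (E2 : cos (2 * k * t) = 1 - 2 * (sin (k * t) * sin (k * t))).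
  { replace (2 * k * t) with (2 * (k * t)) by ring. rewrite cos_2a_sin. ring. }
  set (s := sin (k * t) * sin (k * t)) in *.
  assert (Hrec : Rabs (cp + cm - 2 * c x n + 4 * (s * c x n)) <= 4 * k * L).
  { rewrite E2 in C1, C2. fold (c x n) in C1, C2.
    apply Rabs_le_between in C1, C2. apply Rabs_le.
    replace (cos (2 * k * (stat_value h T x n + psi))) with (c x n) in C1, C2 by reflexivity.
    lra. }
  unfold d. fold cp cm t.
  replace (G t * s * c x n - - / 4 * (G (stat_point T x (n + 1)) * cp - G t * c x n
      - (G t * c x n - G (stat_point T x (n - 1)) * cm)))
    with (/ 4 * (G t * (cp + cm - 2 * c x n + 4 * (s * c x n))
      + ((G (stat_point T x (n + 1)) - G t) * cp + (G (stat_point T x (n - 1)) - G t) * cm))) by field.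
  assert (P1 : Rabs (G t * (cp + cm - 2 * c x n + 4 * (s * c x n))) <= B * (4 * k * L)).
  { rewrite Rabs_mult. apply Rmult_le_compat; auto using Rabs_pos. apply HGB, Hrange. }
  assert (P2 : Rabs ((G (stat_point T x (n + 1)) - G t) * cp) <= eps * 1).
  { rewrite Rabs_mult. apply Rmult_le_compat; auto using Rabs_pos. apply Hc1. }
  assert (P3 : Rabs ((G (stat_point T x (n - 1)) - G t) * cm) <= eps * 1).
  { rewrite Rabs_mult. apply Rmult_le_compat; auto using Rabs_pos. apply Hc1. }
  apply Rabs_le_between in P1, P2, P3. apply Rabs_le. lra.
Qed.

(** * Removing the resonances *)

Fixpoint geometric_sum (y : R) (N : nat) : R :=
  match N with O => 0 | S k => geometric_sum y k + y ^ k end.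

Lemma geometric_sum_spec y N : geometric_sum y N * (1 - y) = 1 - y ^ N.
Proof. induction N as [|N IH]; simpl; [ring|]. rewrite Rmult_plus_distr_r, IH. ring. Qed.

Lemma cR_pow (f : R -> R) N t : continuous f t -> continuous (fun s => f s ^ N) t.
Proof. intros Hf. induction N as [|N IH]; simpl; cont. Qed.

Lemma cR_geometric_sum (f : R -> R) N t : continuous f t ->
  continuous (fun s => geometric_sum (f s) N) t.
Proof.
  intros Hf. induction N as [|N IH]; simpl; [cont|]. apply cR_plus; auto. now apply cR_pow.
Qed.

Definition wallis (k : R) (N : nat) : R := RInt (fun t => (cos (k * t) * cos (k * t)) ^ N) 0 PI.

Lemma cR_cos_pow k N t : continuous (fun t => (cos (k * t) * cos (k * t)) ^ N) t.
Proof. apply (cR_pow (fun t => cos (k * t) * cos (k * t))). cont. Qed.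

(** With [y = k t], the function [sin y cos^(2N+1) y] vanishes at [t = 0] and [t = pi],
    and its derivative is [k ((2N+2) cos^(2N+2) y - (2N+1) cos^(2N) y)]. *)
Lemma wallis_step k N : (1 <= k)%nat ->
  wallis (INR k) (S N) = (2 * INR N + 1) / (2 * INR N + 2) * wallis (INR k) N.
Proof.
  intros Hk. set (K := INR k). assert (HK : 0 < K) by (apply lt_0_INR; lia).
  pose proof (pos_INR N) as HN.
  set (y := fun t => cos (K * t) * cos (K * t)).
  assert (E : RInt (fun t => K * (2 * INR N + 2) * y t ^ S N - K * (2 * INR N + 1) * y t ^ N) 0 PI
    = sin (K * PI) * cos (K * PI) * y PI ^ N - sin (K * 0) * cos (K * 0) * y 0 ^ N).
  { apply (RInt_ftc (fun t => sin (K * t) * cos (K * t) * y t ^ N)).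
    - intros t. unfold y.
      apply is_derive_value with (K * (cos (K * t) * cos (K * t) - sin (K * t) * sin (K * t))
        * (cos (K * t) * cos (K * t)) ^ N
        + sin (K * t) * cos (K * t) * (INR N * (- (2 * K * (sin (K * t) * cos (K * t))))
          * (cos (K * t) * cos (K * t)) ^ pred N)).
      + apply (is_derive_mult (fun t => sin (K * t) * cos (K * t))
          (fun t => (cos (K * t) * cos (K * t)) ^ N)); [ | | intros; apply Rmult_comm].
        * auto_derive; [auto | eqR; ring].
        * apply (is_derive_pow (fun t => cos (K * t) * cos (K * t)) N t
            (- (2 * K * (sin (K * t) * cos (K * t))))).
          auto_derive; [auto | eqR; ring].
      + eqR. destruct N as [|N].
        * simpl. pose proof (sin2_cos2 (K * t)) as SC. unfold Rsqr in SC.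
          replace (sin (K * t) * sin (K * t)) with (1 - cos (K * t) * cos (K * t)) by lra. ring.
        * replace (pred (S N)) with N by reflexivity.
          pose proof (sin2_cos2 (K * t)) as SC. unfold Rsqr in SC.
          replace (sin (K * t) * cos (K * t) * (INR (S N) * - (2 * K * (sin (K * t) * cos (K * t)))
            * (cos (K * t) * cos (K * t)) ^ N))
            with (- (2 * K * INR (S N)) * (sin (K * t) * sin (K * t)) *
              ((cos (K * t) * cos (K * t)) ^ S N)) by (simpl pow; ring).
          replace (sin (K * t) * sin (K * t)) with (1 - cos (K * t) * cos (K * t)) by lra.
          simpl pow. ring.
    - intros t. apply cR_minus; apply cR_mult; try (apply cR_cos_pow); cont. }
  rewrite RInt_sub_cont, !RInt_scal_cont in E.
  2, 3: apply cR_cos_pow.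
  2, 3: intros t; apply cR_mult; [cont | apply cR_cos_pow].
  replace (sin (K * PI)) with 0 in E.
  2: { symmetry. unfold K. rewrite INR_IZR_INZ. apply sin_IZR_PI. }
  rewrite Rmult_0_r, sin_0, !Rmult_0_l in E.
  change (RInt (fun t => y t ^ S N) 0 PI) with (wallis K (S N)) in E.
  change (RInt (fun t => y t ^ N) 0 PI) with (wallis K N) in E.
  apply (Rmult_eq_reg_l (K * (2 * INR N + 2))); [|nra].
  replace (K * (2 * INR N + 2) * ((2 * INR N + 1) / (2 * INR N + 2) * wallis K N))
    with (K * (2 * INR N + 1) * wallis K N) by (field; lra). lra.
Qed.

Lemma wallis_decay k N : (1 <= k)%nat ->
  0 <= wallis (INR k) N /\ wallis (INR k) N * wallis (INR k) N * (INR N + 1) <= PI * PI.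
Proof.
  intros Hk. pose proof PI_RGT_0. induction N as [|N [IH0 IH]].
  - unfold wallis. simpl. rewrite RInt_constant.
    split; nra.
  - rewrite wallis_step by auto. rewrite S_INR. pose proof (pos_INR N) as HN.
    set (n := INR N) in *. set (w := wallis (INR k) N) in *.
    assert (Hr : 0 <= (2 * n + 1) / (2 * n + 2)) by (apply Rlt_le, Rdiv_lt_0_compat; lra).
    split; [now apply Rmult_le_pos|].
    apply Rle_trans with (w * w * (n + 1)); [|exact IH].
    replace ((2 * n + 1) / (2 * n + 2) * w * ((2 * n + 1) / (2 * n + 2) * w) * (n + 1 + 1))
      with (w * w * ((2 * n + 1) * (2 * n + 1) * (n + 2) / ((2 * n + 2) * (2 * n + 2))))
      by (field; lra).
    apply Rmult_le_compat_l; [nra|].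
    apply (Rmult_le_reg_r ((2 * n + 2) * (2 * n + 2))); [nra|].
    replace ((2 * n + 1) * (2 * n + 1) * (n + 2) / ((2 * n + 2) * (2 * n + 2))
      * ((2 * n + 2) * (2 * n + 2))) with ((2 * n + 1) * (2 * n + 1) * (n + 2)) by (field; lra).
    nra.
Qed.

Lemma wallis_small k eps : (1 <= k)%nat -> 0 < eps -> exists N, wallis (INR k) N <= eps.
Proof.
  intros Hk He. pose proof PI_RGT_0.
  destruct (nfloor_ex (PI * PI / (eps * eps))) as [N [_ HN]].
  { apply Rlt_le, Rdiv_lt_0_compat; nra. }
  exists N. destruct (wallis_decay k N Hk) as [H0 HW].
  apply Rnot_lt_le. intros Hlt.
  assert (PI * PI < eps * eps * (INR N + 1)).
  { replace (PI * PI) with (eps * eps * (PI * PI / (eps * eps))) by (field; lra).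
    apply Rmult_lt_compat_l; nra. }
  assert (eps * eps <= wallis (INR k) N * wallis (INR k) N) by (apply Rmult_le_compat; lra).
  assert (eps * eps * (INR N + 1) <= wallis (INR k) N * wallis (INR k) N * (INR N + 1)).
  { apply Rmult_le_compat_r; auto. pose proof (pos_INR N). lra. }
  lra.
Qed.

(** Weyl sums: with [y = cos^2 (k t)], the factor [sin^2 (k t)] is removed by writing
    [1 = (1 - y) (1 + y + ... + y^(N-1)) + y^N], the mean of [y^N] being small. *)
Lemma negligible_weyl h h1 h2 p q T (F : R -> R) k psi : bulk_setting h h1 h2 p q T ->
  (forall t, continuous F t) -> (1 <= k)%nat ->
  negligible h1 p q (fun x n => F (stat_point T x n)
    * cos (2 * INR k * (stat_value h T x n + psi))).
Proof.
  intros HS HF Hk. pose proof HS as [H H1 H2 HT]. pose proof PI_RGT_0.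
  apply (negligible_approx h h1 h2 p q T); auto. intros eps He.
  destruct (continuous_bounded (fun t => F t * h2 t) p q) as [B [HB HFB]].
  { profile_cont. }
  destruct (wallis_small k (eps / B) Hk) as [N HN]; [now apply Rdiv_lt_0_compat|].
  set (y := fun t => cos (INR k * t) * cos (INR k * t)).
  assert (Hy : forall t, continuous y t) by (unfold y; cont).
  assert (HyN : forall t, 0 <= y t ^ N) by (intros t; apply pow_le; unfold y; nra).
  exists (fun x n => (fun t => F t * geometric_sum (y t) N) (stat_point T x n)
    * (sin (INR k * stat_point T x n) * sin (INR k * stat_point T x n))
    * cos (2 * INR k * (stat_value h T x n + psi))).
  exists (fun t => Rabs (F t) * y t ^ N).
  assert (HGc : forall t, continuous (fun t => Rabs (F t) * y t ^ N) t).
  { intros t. apply cR_mult; [cont | now apply cR_pow]. }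
  split; [|split; [|split]].
  - apply (negligible_resonance_free h h1 h2 p q T (fun t => F t * geometric_sum (y t) N));
      auto; [|apply pos_INR].
    intros t. apply cR_mult; [cont | now apply cR_geometric_sum].
  - exact HGc.
  - apply Rle_trans with (RInt (fun t => B * y t ^ N) p q).
    + apply RInt_le; [lra | | |].
      * apply ex_RInt_cont. intros t. apply cR_mult; [apply HGc | apply H].
      * apply ex_RInt_cont. intros t. apply cR_mult; [cont | now apply cR_pow].
      * intros t Ht. rewrite Rmult_assoc, (Rmult_comm (y t ^ N)), <- Rmult_assoc.
        apply Rmult_le_compat_r; auto.
        rewrite <- (Rabs_right (h2 t)).
        2: { apply Rle_ge, (profile_nonneg _ _ _ H). lra. }
        rewrite <- Rabs_mult. apply HFB. lra.
    + rewrite RInt_scal_cont by (intros t; now apply cR_pow).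
      assert (I0 : RInt (fun t => y t ^ N) p q <= wallis (INR k) N).
      { unfold wallis. change (fun t => (cos (INR k * t) * cos (INR k * t)) ^ N) with (fun t => y t ^ N).
        rewrite (RInt_chasles _ 0 p PI), (RInt_chasles _ p q PI) by (intros t; now apply cR_pow).
        assert (0 <= RInt (fun t => y t ^ N) 0 p).
        { apply RInt_ge_0; [lra | apply ex_RInt_cont; intros t; now apply cR_pow | auto]. }
        assert (0 <= RInt (fun t => y t ^ N) q PI).
        { apply RInt_ge_0; [lra | apply ex_RInt_cont; intros t; now apply cR_pow | auto]. }
        lra. }
      replace eps with (B * (eps / B)) by (field; lra).
      apply Rmult_le_compat_l; lra.
  - exists 1. split; [lra|]. intros x _ n. set (t := stat_point T x n).
    set (c := cos (2 * INR k * (stat_value h T x n + psi))).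
    pose proof (geometric_sum_spec (y t) N) as Hgeo.
    assert (Hs : sin (INR k * t) * sin (INR k * t) = 1 - y t).
    { pose proof (sin2_cos2 (INR k * t)) as SC. unfold Rsqr in SC. unfold y. lra. }
    rewrite Hs.
    replace (F t * c - F t * geometric_sum (y t) N * (1 - y t) * c)
      with (F t * c - F t * c * (geometric_sum (y t) N * (1 - y t))) by ring.
    rewrite Hgeo. replace (F t * c - F t * c * (1 - y t ^ N)) with (F t * (y t ^ N) * c) by ring.
    rewrite !Rabs_mult, (Rabs_right (y t ^ N)) by (apply Rle_ge; auto).
    assert (Rabs c <= 1) by apply Rabs_cos_le.
    assert (0 <= Rabs (F t) * y t ^ N) by (apply Rmult_le_pos; auto using Rabs_pos).
    rewrite <- (Rmult_1_r (Rabs (F t) * y t ^ N)) at 2. apply Rmult_le_compat_l; auto.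
Qed.

(** * The mean of [|cos|] along the stationary values *)

(** The even trigonometric polynomials of period [pi], given by generators so that
    equidistribution and closure under products follow by induction. *)
Inductive even_trig : (R -> R) -> Prop :=
  | even_trig_cos k : even_trig (fun u => cos (2 * INR k * u))
  | even_trig_plus f g : even_trig f -> even_trig g -> even_trig (fun u => f u + g u)
  | even_trig_scal c f : even_trig f -> even_trig (fun u => c * f u)
  | even_trig_ext f g : even_trig f -> (forall u, f u = g u) -> even_trig g.

Lemma even_trig_continuous f : even_trig f -> forall t, continuous f t.
Proof.
  induction 1 as [k|f g Hf IHf Hg IHg|c f Hf IHf|f g Hf IHf E]; intros t.
  - cont.
  - apply cR_plus; auto.
  - apply cR_mult; [cont | auto].
  - apply (continuous_ext f); auto.
Qed.

Lemma even_trig_const c : even_trig (fun _ => c).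
Proof.
  apply (even_trig_ext (fun u => c * cos (2 * INR 0 * u))).
  - apply even_trig_scal, even_trig_cos.
  - intros u. simpl. rewrite Rmult_0_r, Rmult_0_l, cos_0. ring.
Qed.

Lemma even_trig_cos_product k l :
  even_trig (fun u => cos (2 * INR k * u) * cos (2 * INR l * u)).
Proof.
  assert (Hle : forall i j, (i <= j)%nat ->
    even_trig (fun u => cos (2 * INR j * u) * cos (2 * INR i * u))).
  { intros i j Hij.
    apply (even_trig_ext (fun u => / 2 * (cos (2 * INR (j + i) * u) + cos (2 * INR (j - i) * u)))).
    - apply even_trig_scal, even_trig_plus; apply even_trig_cos.
    - intros u. rewrite plus_INR, minus_INR by auto.
      replace (2 * (INR j + INR i) * u) with (2 * INR j * u + 2 * INR i * u) by ring.
      replace (2 * (INR j - INR i) * u) with (2 * INR j * u - 2 * INR i * u) by ring.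
      rewrite cos_plus, cos_minus. field. }
  destruct (Nat.le_ge_cases l k) as [L|L]; auto.
  apply (even_trig_ext _ _ (Hle k l L)). intros u. ring.
Qed.

Lemma even_trig_mult f g : even_trig f -> even_trig g -> even_trig (fun u => f u * g u).
Proof.
  intros Hf. revert g. induction Hf as [k|f1 f2 H1 IH1 H2 IH2|c f Hf IHf|f f' Hf IHf E]; intros g Hg.
  - induction Hg as [l|g1 g2 H1 IH1 H2 IH2|c g Hg IHg|g g' Hg IHg E].
    + apply even_trig_cos_product.
    + apply (even_trig_ext _ _ (even_trig_plus _ _ IH1 IH2)). intros u. ring.
    + apply (even_trig_ext _ _ (even_trig_scal c _ IHg)). intros u. ring.
    + apply (even_trig_ext _ _ IHg). intros u. now rewrite E.
  - apply (even_trig_ext _ _ (even_trig_plus _ _ (IH1 g Hg) (IH2 g Hg))). intros u. ring.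
  - apply (even_trig_ext _ _ (even_trig_scal c _ (IHf g Hg))). intros u. ring.
  - apply (even_trig_ext _ _ (IHf g Hg)). intros u. now rewrite E.
Qed.

(** Newton-type iteration for the square root of [cos^2]; it stays a polynomial
    in [cos^2] and converges uniformly from below. *)
Fixpoint abs_cos_iter (n : nat) (u : R) : R :=
  match n with
  | O => 0
  | S k => abs_cos_iter k u + / 2 * (cos u * cos u - abs_cos_iter k u * abs_cos_iter k u)
  end.

Lemma abs_cos_iter_trig n : even_trig (abs_cos_iter n).
Proof.
  induction n as [|n IH].
  - apply (even_trig_ext (fun _ => 0)); [apply even_trig_const | reflexivity].
  - apply (even_trig_ext (fun u => abs_cos_iter n u + / 2 * ((/ 2 * (cos (2 * INR 1 * u) + 1))
      + -1 * (abs_cos_iter n u * abs_cos_iter n u)))).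
    + apply even_trig_plus; auto. apply even_trig_scal, even_trig_plus.
      * apply even_trig_scal, even_trig_plus; [apply even_trig_cos | apply even_trig_const].
      * apply even_trig_scal. now apply even_trig_mult.
    + intros u. simpl. rewrite Rmult_1_r, cos_2a_cos. field.
Qed.

Lemma abs_cos_iter_error n u :
  0 <= abs_cos_iter n u <= Rabs (cos u) /\ Rabs (cos u) - abs_cos_iter n u <= 2 / (INR n + 2).
Proof.
  set (s := Rabs (cos u)).
  assert (Hs : 0 <= s <= 1).
  { split; [apply Rabs_pos | apply Rabs_cos_le]. }
  assert (Ess : cos u * cos u = s * s).
  { unfold s. rewrite <- Rabs_mult. symmetry. apply Rabs_right. nra. }
  induction n as [|n [IH1 IH2]].
  - simpl. lra.
  - simpl abs_cos_iter. rewrite Ess, S_INR. pose proof (pos_INR n) as Hn.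
    set (v := abs_cos_iter n u) in *. set (e := s - v) in *.
    split; [unfold e in *; nra|].
    replace (s - (v + / 2 * (s * s - v * v))) with (e * (1 - / 2 * (s + v))) by (unfold e; ring).
    set (w := 2 / (INR n + 2)) in *.
    assert (Hw : w <= 1).
    { unfold w. apply (Rmult_le_reg_r (INR n + 2)); [lra|].
      replace (2 / (INR n + 2) * (INR n + 2)) with 2 by (field; lra). lra. }
    assert (He : 0 <= e) by (unfold e; lra).
    apply Rle_trans with (e * (1 - / 2 * e)); [unfold e in *; nra|].
    apply Rle_trans with (w * (1 - / 2 * w)); [nra|].
    unfold w. apply (Rmult_le_reg_r ((INR n + 2) * (INR n + 2) * (INR n + 1 + 2))).
    { apply Rmult_lt_0_compat; [apply Rmult_lt_0_compat|]; lra. }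
    replace (2 / (INR n + 2) * (1 - / 2 * (2 / (INR n + 2)))
      * ((INR n + 2) * (INR n + 2) * (INR n + 1 + 2)))
      with (2 * (INR n + 1) * (INR n + 3)) by (field; lra).
    replace (2 / (INR n + 1 + 2) * ((INR n + 2) * (INR n + 2) * (INR n + 1 + 2)))
      with (2 * (INR n + 2) * (INR n + 2)) by (field; lra).
    nra.
Qed.

Lemma RInt_abs_cos : RInt (fun u => Rabs (cos u)) 0 PI = 2.
Proof.
  pose proof PI_RGT_0. rewrite (RInt_chasles _ 0 (PI / 2) PI) by cont.
  rewrite (RInt_ext (fun u => Rabs (cos u)) cos 0 (PI / 2)).
  2: { intros u Hu. rewrite Rmin_left, Rmax_right in Hu by lra.
       apply Rabs_right, Rle_ge, cos_ge_0; lra. }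
  rewrite (RInt_ext (fun u => Rabs (cos u)) (fun u => - cos u) (PI / 2) PI).
  2: { intros u Hu. rewrite Rmin_left, Rmax_right in Hu by lra.
       apply Rabs_left1, cos_le_0; lra. }
  rewrite (RInt_ftc sin cos), (RInt_ftc (fun u => - sin u) (fun u => - cos u)).
  - rewrite sin_PI2, sin_0, sin_PI. lra.
  - intros u. apply (is_derive_opp sin), is_derive_sin.
  - cont.
  - intros u. apply is_derive_sin.
  - cont.
Qed.

Definition mean (G : R -> R) : R := RInt G 0 PI / PI.

Lemma mean_cos k : (1 <= k)%nat -> mean (fun u => cos (2 * INR k * u)) = 0.
Proof.
  intros Hk. assert (HK : 0 < INR k) by (apply lt_0_INR; lia). pose proof PI_RGT_0.
  unfold mean. rewrite (RInt_ftc (fun u => / (2 * INR k) * sin (2 * INR k * u))).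
  - replace (2 * INR k * PI) with (IZR (2 * Z.of_nat k) * PI)
      by (rewrite mult_IZR, <- INR_IZR_INZ; ring).
    replace (2 * INR k * 0) with 0 by ring. rewrite sin_IZR_PI, sin_0. eqR. field. lra.
  - intros u. auto_derive; [auto | eqR; field; lra].
  - cont.
Qed.

(** The constant term is the mean; all other harmonics are Weyl sums. *)
Lemma even_trig_equidistributed h h1 h2 p q T psi (F G : R -> R) : bulk_setting h h1 h2 p q T ->
  (forall t, continuous F t) -> even_trig G ->
  negligible h1 p q (fun x n => F (stat_point T x n) * (G (stat_value h T x n + psi) - mean G)).
Proof.
  intros HS HF HG. pose proof PI_RGT_0.
  induction HG as [k|f g Hf IHf Hg IHg|c f Hf IHf|f g Hf IHf E].
  - destruct k as [|k].
    + intros eps He. exists 1. split; [lra|]. intros x Hx.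
      assert (Z : forall n, F (stat_point T x n)
        * (cos (2 * INR 0 * (stat_value h T x n + psi)) - mean (fun u => cos (2 * INR 0 * u))) = 0).
      { intros n. unfold mean. rewrite (RInt_ext _ (fun _ => 1)).
        - rewrite RInt_constant.
          rewrite Rmult_0_r, Rmult_0_l, cos_0. field. lra.
        - intros u _. simpl. now rewrite Rmult_0_r, Rmult_0_l, cos_0. }
      unfold bulk_sum.
      rewrite (zsum_ext _ (fun _ => 0)) by (auto; eapply bulk_window_le; eauto; lra).
      rewrite zsum_const by (eapply bulk_window_le; eauto; lra).
      rewrite Rmult_0_l, Rabs_R0. apply Rmult_le_pos; lra.
    + rewrite mean_cos by lia.
      apply (negligible_ext _ _ _ _ _ (negligible_weyl h h1 h2 p q T F (S k) psi HS HF ltac:(lia))).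
      intros x n. ring.
  - apply (negligible_ext _ _ _ _ _ (negligible_plus _ _ _ _ _ _ _ _ HS IHf IHg)).
    intros x n. unfold mean. rewrite RInt_add_cont by now apply even_trig_continuous. field. lra.
  - apply (negligible_ext _ _ _ _ _ (negligible_scal _ _ _ _ _ _ c _ HS IHf)).
    intros x n. unfold mean. rewrite RInt_scal_cont by now apply even_trig_continuous. field. lra.
  - apply (negligible_ext _ _ _ _ _ IHf). intros x n. rewrite E.
    unfold mean. now rewrite (RInt_ext f g) by auto.
Qed.

Lemma abs_cos_equidistributed h h1 h2 p q T psi (F : R -> R) : bulk_setting h h1 h2 p q T ->
  (forall t, continuous F t) ->
  negligible h1 p q (fun x n => F (stat_point T x n)
    * (Rabs (cos (stat_value h T x n + psi)) - 2 / PI)).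
Proof.
  intros HS HF. pose proof PI_RGT_0.
  apply (negligible_close h h1 h2 p q T); auto. intros eps He.
  destruct (continuous_bounded F p q HF) as [B [HB HFB]].
  destruct (nfloor_ex (4 * B / eps)) as [N [_ HN]].
  { apply Rlt_le, Rdiv_lt_0_compat; lra. }
  set (d := 2 / (INR N + 2)). pose proof (pos_INR N).
  assert (Hd : 0 < d) by (apply Rdiv_lt_0_compat; lra).
  assert (HBd : B * (2 * d) <= eps).
  { unfold d. apply (Rmult_le_reg_r (INR N + 2)); [lra|].
    replace (B * (2 * (2 / (INR N + 2))) * (INR N + 2)) with (4 * B) by (field; lra).
    apply Rle_trans with (eps * (4 * B / eps)); [right; field; lra|].
    apply Rmult_le_compat_l; lra. }
  pose proof (even_trig_continuous _ (abs_cos_iter_trig N)) as Hc.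
  assert (Hm : 0 <= 2 / PI - mean (abs_cos_iter N) <= d).
  { unfold mean. rewrite <- RInt_abs_cos.
    assert (I1 : RInt (abs_cos_iter N) 0 PI <= RInt (fun u => Rabs (cos u)) 0 PI).
    { apply RInt_le; [lra | now apply ex_RInt_cont | apply ex_RInt_cont; cont |].
      intros u _. apply abs_cos_iter_error. }
    assert (I2 : RInt (fun u => Rabs (cos u) - abs_cos_iter N u) 0 PI <= d * PI).
    { replace (d * PI) with (RInt (fun _ => d) 0 PI)
        by (rewrite RInt_constant; eqR; ring).
      apply RInt_le; [lra | apply ex_RInt_cont; cont | apply ex_RInt_cont; cont |].
      intros u _. apply abs_cos_iter_error. }
    rewrite RInt_sub_cont in I2 by cont.
    replace (RInt (fun u => Rabs (cos u)) 0 PI / PI - RInt (abs_cos_iter N) 0 PI / PI)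
      with ((RInt (fun u => Rabs (cos u)) 0 PI - RInt (abs_cos_iter N) 0 PI) / PI) by (field; lra).
    split.
    - apply Rmult_le_pos; [lra | apply Rlt_le, Rinv_0_lt_compat; lra].
    - apply (Rmult_le_reg_r PI); [lra|]. unfold Rdiv. rewrite Rmult_assoc, Rinv_l by lra. lra. }
  exists (fun x n => F (stat_point T x n)
    * (abs_cos_iter N (stat_value h T x n + psi) - mean (abs_cos_iter N))).
  split; [apply (even_trig_equidistributed h h1 h2); auto; apply abs_cos_iter_trig|].
  exists 1. split; [lra|]. intros x _ n.
  pose proof (abs_cos_iter_error N (stat_value h T x n + psi)) as [E1 E2]. fold d in E2.
  rewrite <- Rmult_minus_distr_l, Rabs_mult.
  apply Rle_trans with (B * (2 * d)); [|exact HBd].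
  apply Rmult_le_compat; auto using Rabs_pos.
  - apply HFB. destruct HS as [_ _ _ HT]. apply HT.
  - apply Rabs_le. lra.
Qed.

(** * The bulk contribution *)

Lemma cos_minus_sin u : cos u - sin u = sqrt 2 * cos (u + PI / 4).
Proof.
  rewrite cos_plus, cos_PI4, sin_PI4.
  assert (0 < sqrt 2) by (apply sqrt_lt_R0; lra). field. lra.
Qed.

(** The three approximations combine: stationary phase for each coefficient, the mean
    of [|cos|], and the Riemann sum of the amplitude, where
    [sqrt (2 pi / h'') h'' = sqrt (2 pi) sqrt h'']. *)
Lemma bulk_limit h h1 h2 p q eps : profile h h1 h2 -> 0 < p < q -> q < PI -> 0 < eps ->
  for_large (fun x => Rabs (bulk_sum h1 p q x (fun n => Rabs (coeff h x (IZR n)))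
    - 2 / PI * sqrt (2 * PI) * sqrt x * RInt (fun t => sqrt (h2 t)) p q) <= eps * sqrt x).
Proof.
  intros H Hpq Hq He. pose proof PI_RGT_0.
  destruct (slope_inverse_exists h h1 h2 p q H ltac:(lra) ltac:(lra)) as [T HT].
  assert (HS : bulk_setting h h1 h2 p q T) by now split.
  destruct (profile_curvature_min h h1 h2 p q H ltac:(lra) Hq) as [m [Hm Hmin]].
  destruct fresnel_limits as [c0 [Hc0 Hfr]].
  (* on [[p,q]], where [h2 >= m], this is the amplitude [sqrt (2 pi / h2)]; the absolute
     value keeps it continuous everywhere *)
  set (F := fun t => sqrt (2 * PI) * / sqrt (m + Rabs (h2 t - m))).
  assert (HmF : forall t, 0 < sqrt (m + Rabs (h2 t - m))).
  { intros t. apply sqrt_lt_R0. pose proof (Rabs_pos (h2 t - m)). lra. }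
  assert (HF : forall t, continuous F t).
  { intros t. pose proof (profile_continuous _ _ _ H). apply cR_mult; [cont|].
    apply cR_inv; [cont|]. pose proof (HmF t). lra. }
  assert (HFin : forall t, p <= t <= q -> F t = sqrt (2 * PI) / sqrt (h2 t)).
  { intros t Ht. unfold F. rewrite Rabs_right by (specialize (Hmin t Ht); lra).
    replace (m + (h2 t - m)) with (h2 t) by ring. reflexivity. }
  assert (HFh : RInt (fun t => F t * h2 t) p q = sqrt (2 * PI) * RInt (fun t => sqrt (h2 t)) p q).
  { pose proof (profile_continuous _ _ _ H). rewrite <- RInt_scal_cont by cont.
    apply RInt_ext. intros t Ht. rewrite Rmin_left, Rmax_right in Ht by lra.
    rewrite HFin by lra. specialize (Hmin t ltac:(lra)).
    assert (0 < sqrt (h2 t)) by (apply sqrt_lt_R0; lra).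
    assert (Eh : sqrt (h2 t) * sqrt (h2 t) = h2 t) by (apply sqrt_sqrt; lra).
    transitivity (sqrt (2 * PI) / sqrt (h2 t) * (sqrt (h2 t) * sqrt (h2 t))).
    - now rewrite Eh.
    - eqR. field. lra. }
  assert (Hamp : forall t u, p <= t <= q ->
    Rabs (2 * c0 * sqrt (2 / h2 t) * (cos u - sin u)) = F t * Rabs (cos (u + PI / 4))).
  { intros t u Ht. rewrite HFin by auto. specialize (Hmin t Ht).
    rewrite cos_minus_sin, !Rabs_mult.
    rewrite (Rabs_right 2), (Rabs_right (sqrt (2 / h2 t))), (Rabs_right (sqrt 2))
      by (try apply Rle_ge; try apply sqrt_pos; lra).
    rewrite <- Rmult_assoc. f_equal.
    rewrite <- (sqrt_Rsqr_abs c0). unfold Rsqr. rewrite Hc0.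
    assert (E : sqrt (2 * PI) = 4 * sqrt (PI / 8)).
    { replace (2 * PI) with (4 * 4 * (PI / 8)) by field. rewrite sqrt_mult by lra.
      rewrite sqrt_square by lra. reflexivity. }
    rewrite E, (sqrt_div 2 (h2 t)) by lra.
    assert (0 < sqrt (h2 t)) by (apply sqrt_lt_R0; lra).
    assert (E2 : sqrt 2 * sqrt 2 = 2) by (apply sqrt_sqrt; lra).
    transitivity (2 * sqrt (PI / 8) * (sqrt 2 * sqrt 2) / sqrt (h2 t)); [field; lra|].
    rewrite E2. field. lra. }
  set (V := h1 q - h1 p).
  assert (HV : 0 < V).
  { pose proof (profile_slope_lt h h1 h2 p q H ltac:(lra) ltac:(lra)). unfold V. lra. }
  set (e1 := eps / (8 * V)).
  assert (He1 : 0 < e1) by (apply Rdiv_lt_0_compat; lra).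
  pose proof (coeff_stationary h h1 h2 c0 p q e1 H Hfr ltac:(lra) Hq He1) as A1.
  pose proof (abs_cos_equidistributed h h1 h2 p q T (PI / 4) F HS HF (eps / 4) ltac:(lra)) as A2.
  pose proof (riemann_sum h h1 h2 p q T F (eps / 4) H Hpq Hq HT HF ltac:(lra)) as A3.
  apply (for_large_mono _ _ (for_large_and _ _ (for_large_and _ _ A1 A2)
    (for_large_and _ _ A3 (for_large_mul_ge 2 V HV)))).
  intros x Hx [[B1 B2] [B3 B4]].
  destruct (bulk_window h h1 h2 p q x H ltac:(lra) ltac:(lra) Hx) as [Hw Hlen]. fold V in Hlen.
  unfold bulk_sum in *.
  set (a := bulk_lo h1 p x) in *. set (b := bulk_lo h1 q x) in *.
  assert (Hsx : 0 < sqrt x) by now apply sqrt_lt_R0.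
  assert (Hxx : sqrt x * sqrt x = x) by (apply sqrt_sqrt; lra).
  set (S0 := zsum (fun n => Rabs (coeff h x (IZR n))) a b) in *.
  set (S1 := zsum (fun n => F (stat_point T x n)) a b) in *.
  set (S2 := zsum (fun n => F (stat_point T x n)
    * (Rabs (cos (stat_value h T x n + PI / 4)) - 2 / PI)) a b) in *.
  assert (C1 : Rabs (sqrt x * S0 - (S2 + 2 / PI * S1)) <= e1 * (IZR b - IZR a)).
  { unfold S0, S1, S2. rewrite <- !zsum_scal, <- zsum_plus, <- zsum_minus by exact Hw.
    apply zsum_abs_bound; auto. intros n Hn.
    assert (Hran : p <= stat_point T x n <= q) by apply HT.
    assert (Hxn : x * h1 (stat_point T x n) = IZR n).
    { unfold stat_point. rewrite (slope_inverse_in h h1 h2 p q); auto; try lra; [field; lra|].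
      destruct (archimed (x * h1 p)) as [A4 _]. destruct (archimed (x * h1 q)) as [_ A5].
      fold (bulk_lo h1 p x) in A4. fold (bulk_lo h1 q x) in A5. fold a in A4. fold b in A5.
      assert (IZR a <= IZR n) by (apply IZR_le; lia).
      assert (IZR n <= IZR b - 1) by (rewrite <- minus_IZR; apply IZR_le; lia).
      split; apply (Rmult_le_reg_l x); auto;
        replace (x * (IZR n / x)) with (IZR n) by (field; lra); lra. }
    specialize (B1 _ Hran). rewrite Hxn in B1. fold (stat_value h T x n) in B1.
    replace (F (stat_point T x n) * (Rabs (cos (stat_value h T x n + PI / 4)) - 2 / PI)
      + 2 / PI * F (stat_point T x n))
      with (F (stat_point T x n) * Rabs (cos (stat_value h T x n + PI / 4))) by ring.
    rewrite <- Hamp by auto.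
    rewrite <- (Rabs_right (sqrt x)) at 1 by lra. rewrite <- Rabs_mult.
    eapply Rle_trans; [apply Rabs_triang_inv2 | exact B1]. }
  assert (C2 : e1 * (IZR b - IZR a) <= eps / 4 * x).
  { apply Rle_trans with (e1 * (2 * (V * x))); [apply Rmult_le_compat_l; lra|].
    right. unfold e1. field. lra. }
  rewrite HFh in B3. set (I := RInt (fun t => sqrt (h2 t)) p q) in *.
  assert (C3 : Rabs (2 / PI * (S1 - x * (sqrt (2 * PI) * I))) <= eps / 4 * x).
  { rewrite Rabs_mult, (Rabs_right (2 / PI)) by (apply Rgt_ge, Rdiv_lt_0_compat; lra).
    apply Rle_trans with (1 * (eps / 4 * x)); [|lra].
    apply Rmult_le_compat; auto using Rabs_pos.
    - apply Rlt_le, Rdiv_lt_0_compat; lra.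
    - apply (Rmult_le_reg_r PI); [lra|]. unfold Rdiv. rewrite Rmult_assoc, Rinv_l by lra.
      pose proof PI2_1. lra. }
  apply (Rmult_le_reg_l (sqrt x)); auto.
  rewrite <- (Rabs_right (sqrt x)) at 1 by lra. rewrite <- Rabs_mult.
  replace (sqrt x * (eps * sqrt x)) with (eps * (sqrt x * sqrt x)) by ring.
  replace (sqrt x * (S0 - 2 / PI * sqrt (2 * PI) * sqrt x * I))
    with (sqrt x * S0 - 2 / PI * (sqrt x * sqrt x * (sqrt (2 * PI) * I))) by ring.
  rewrite Hxx.
  assert (0 < eps * x) by (apply Rmult_lt_0_compat; lra).
  apply Rabs_le_between in C1, C3, B2. apply Rabs_le. lra.
Qed.

(** * The edge contributions *)

(** The bounds of [coeff_edge] telescope over consecutive stationary points. The first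
    frequency of the window is a unit inside, so that its predecessor has one too. *)
Lemma edge_sum_left h h1 h2 : profile h h1 h2 -> doubling_edge h2 ->
  exists d A B, 0 < d < PI / 2 /\ 0 <= A /\ 0 <= B /\
  forall x delta a b, 0 < x -> 0 < delta <= d -> (a <= b)%Z ->
  x * h1 0 + 1 <= IZR a -> IZR b - 1 <= x * h1 delta ->
  zsum (fun n => Rabs (coeff h x (IZR n))) a b
  <= A * sqrt x * RInt (fun t => sqrt (h2 t)) 0 delta + B * (h1 delta - h1 0).
Proof.
  intros H Hdb. pose proof PI_RGT_0.
  destruct (coeff_edge h h1 h2 H Hdb) as (d & A & B & Hd & HA & HB & Hbound).
  exists d, A, B. repeat split; auto; try lra.
  intros x delta a b Hx Hdel Hab Ha Hb.
  destruct (slope_inverse_exists h h1 h2 0 PI H ltac:(lra) ltac:(lra)) as [T HT].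
  assert (Hc : forall t, continuous (fun t => sqrt (h2 t)) t).
  { profile_cont. }
  pose proof (profile_slope_le h h1 h2 delta PI H ltac:(lra) ltac:(lra)) as Hdp.
  pose proof (profile_slope_lt h h1 h2 0 delta H ltac:(lra) ltac:(lra)) as H0d.
  (* [t n] belongs to frequency [n - 1], so that the bound for the coefficient at [n] is
     the increment [G (n + 1) - G n] *)
  set (t := fun n => T ((IZR n - 1) / x)).
  set (G := fun n => A * sqrt x * RInt (fun t => sqrt (h2 t)) 0 (t n) + B * h1 (t n)).
  assert (Ht : forall n, 0 <= t n <= PI) by (intros; apply HT).
  assert (Hval : forall n, x * h1 0 + 1 <= IZR n -> IZR n - 1 <= x * h1 delta ->
    x * h1 (t n) = IZR n - 1 /\ t n <= delta).
  { intros n Hn1 Hn2.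
    assert (E : h1 (t n) = (IZR n - 1) / x).
    { unfold t. apply (slope_inverse_in h h1 h2 0 PI); auto; try lra.
      split; apply (Rmult_le_reg_l x); auto;
        replace (x * ((IZR n - 1) / x)) with (IZR n - 1) by (field; lra); [lra|].
      apply Rle_trans with (x * h1 delta); [lra | apply Rmult_le_compat_l; lra]. }
    split; [rewrite E; field; lra|].
    apply (slope_le_reflect h h1 h2); auto; [lra|]. rewrite E.
    apply (Rmult_le_reg_l x); auto. replace (x * ((IZR n - 1) / x)) with (IZR n - 1) by (field; lra).
    lra. }
  assert (Hmono : forall s u, 0 <= s <= u -> u <= PI ->
    RInt (fun t => sqrt (h2 t)) 0 s <= RInt (fun t => sqrt (h2 t)) 0 u).
  { intros s u Hs Hu. rewrite (RInt_chasles _ 0 s u) by auto.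
    assert (0 <= RInt (fun t => sqrt (h2 t)) s u); [|lra].
    apply RInt_ge_0; [lra | now apply ex_RInt_cont | intros; apply sqrt_pos]. }
  apply Rle_trans with (zsum (fun n => G (n + 1)%Z - G n) a b).
  - apply zsum_le; auto. intros n Hn.
    assert (Han : IZR a <= IZR n) by (apply IZR_le; lia).
    assert (Hnb : IZR n <= IZR b - 1) by (rewrite <- minus_IZR; apply IZR_le; lia).
    destruct (Hval n ltac:(lra) ltac:(lra)) as [V1 V2].
    destruct (Hval (n + 1)%Z ltac:(rewrite plus_IZR; lra) ltac:(rewrite plus_IZR; lra)) as [V3 V4].
    rewrite plus_IZR in V3.
    assert (Hlt : t n < t (n + 1)%Z).
    { apply Rnot_le_lt. intros Hle.
      pose proof (profile_slope_le h h1 h2 (t (n + 1)%Z) (t n) H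
        ltac:(pose proof (Ht (n + 1)%Z); lra) ltac:(apply Ht)). nra. }
    pose proof (Hbound x (t n) (t (n + 1)%Z) Hx ltac:(pose proof (Ht n); lra) ltac:(lra)
      ltac:(rewrite Rmult_minus_distr_l; lra)) as Bn.
    replace (x * h1 (t (n + 1)%Z)) with (IZR n) in Bn by lra.
    eapply Rle_trans; [exact Bn|]. unfold G.
    rewrite (RInt_chasles _ 0 (t n) (t (n + 1)%Z)) by auto. right. ring.
  - rewrite zsum_telescope by auto. unfold G.
    assert (Hab' := IZR_le _ _ Hab).
    assert (Tb : t b <= delta).
    { apply (Hval b); lra. }
    assert (I1 : RInt (fun t => sqrt (h2 t)) 0 (t b) <= RInt (fun t => sqrt (h2 t)) 0 delta).
    { apply Hmono; [pose proof (Ht b); lra | lra]. }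
    assert (I2 : 0 <= RInt (fun t => sqrt (h2 t)) 0 (t a)).
    { apply RInt_ge_0; [apply Ht | now apply ex_RInt_cont | intros; apply sqrt_pos]. }
    pose proof (profile_slope_le h h1 h2 (t b) delta H ltac:(pose proof (Ht b); lra) ltac:(lra)).
    pose proof (profile_slope_le h h1 h2 0 (t a) H ltac:(pose proof (Ht a); lra) ltac:(apply Ht)).
    assert (HAx : 0 <= A * sqrt x) by (apply Rmult_le_pos; [lra | apply sqrt_pos]).
    apply (Rmult_le_compat_l (A * sqrt x)) in I1; auto.
    assert (0 <= A * sqrt x * RInt (fun t => sqrt (h2 t)) 0 (t a)) by now apply Rmult_le_pos.
    assert (B * (h1 (t b) - h1 (t a)) <= B * (h1 delta - h1 0)) by (apply Rmult_le_compat_l; lra).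
    lra.
Qed.

Lemma edge_sum_right h h1 h2 : profile h h1 h2 -> doubling_edge (fun t => h2 (PI - t)) ->
  exists d A B, 0 < d < PI / 2 /\ 0 <= A /\ 0 <= B /\
  forall x delta a b, 0 < x -> 0 < delta <= d -> (a <= b)%Z ->
  x * h1 (PI - delta) <= IZR a -> IZR b <= x * h1 PI ->
  zsum (fun n => Rabs (coeff h x (IZR n))) a b
  <= A * sqrt x * RInt (fun t => sqrt (h2 t)) (PI - delta) PI + B * (h1 PI - h1 (PI - delta)).
Proof.
  intros H Hdb.
  destruct (edge_sum_left _ _ _ (profile_reflect h h1 h2 H) Hdb) as (d & A & B & Hd & HA & HB & Hbound).
  exists d, A, B. repeat split; auto; try lra.
  intros x delta a b Hx Hdel Hab Ha Hb.
  rewrite (coeff_sum_reflect h h1 h2) by auto.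
  eapply Rle_trans.
  - apply (Hbound x delta (1 - b)%Z (1 - a)%Z); auto; [lia | |]; rewrite minus_IZR.
    + rewrite Rminus_0_r. lra.
    + lra.
  - right. rewrite Rminus_0_r.
    rewrite (RInt_reflect (fun t => sqrt (h2 t)) PI 0 delta), Rminus_0_r; [ring|].
    profile_cont.
Qed.

(** * The sum of all coefficient integrals *)

Lemma for_large_sqrt_ge c : for_large (fun x => c <= sqrt x).
Proof.
  apply (for_large_mono _ _ (for_large_ge (c * c))). intros x Hx Hc.
  destruct (Rle_lt_dec c 0); [pose proof (sqrt_pos x); lra|].
  rewrite <- (sqrt_square c) by lra. now apply sqrt_le_1_alt.
Qed.

Lemma ln_le_pred w : 0 < w -> ln w <= w - 1.
Proof.
  intros Hw. pose proof (exp_ineq1_le (ln w)) as E. rewrite exp_ln in E by auto. lra.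
Qed.

(** Through [ln y <= 4 y^(1/4)], where [y] grows linearly in [x]. *)
Lemma ln_small_sqrt V eps : 0 <= V -> 0 < eps ->
  for_large (fun x => ln (1 + x * V) <= eps * sqrt x).
Proof.
  intros HV He. set (k := sqrt (1 + V)).
  assert (Hk : 0 < k) by (apply sqrt_lt_R0; lra).
  apply (for_large_mono _ _ (for_large_and _ _ (for_large_ge 1)
    (for_large_sqrt_ge (16 * k / (eps * eps))))).
  intros x Hx [H1 H2].
  assert (Hee : 0 < eps * eps) by nra.
  assert (H3 : 16 * k <= eps * eps * sqrt x).
  { replace (16 * k) with (eps * eps * (16 * k / (eps * eps))) by (field; lra).
    apply Rmult_le_compat_l; lra. }
  set (y := 1 + x * V). assert (Hy : 1 <= y) by (unfold y; nra).
  set (s := sqrt y). assert (Hs : 0 < s) by (apply sqrt_lt_R0; lra).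
  set (w := sqrt s). assert (Hw : 0 < w) by (apply sqrt_lt_R0; lra).
  assert (Ess : s * s = y) by (apply sqrt_sqrt; lra).
  assert (Eww : w * w = s) by (apply sqrt_sqrt; lra).
  assert (Hln : ln y = 4 * ln w).
  { rewrite <- Ess, <- Eww. rewrite !ln_mult by nra. ring. }
  assert (Hsk : s <= k * sqrt x).
  { unfold s, k. rewrite <- sqrt_mult by lra. apply sqrt_le_1_alt. unfold y. nra. }
  assert (Hsx : 0 < sqrt x) by (apply sqrt_lt_R0; lra).
  assert (4 * w <= eps * sqrt x).
  { apply Rnot_lt_le. intros Hlt.
    assert (eps * sqrt x * (eps * sqrt x) < 4 * w * (4 * w)).
    { apply Rmult_le_0_lt_compat; auto; apply Rmult_le_pos; lra. }
    assert (16 * k * sqrt x <= eps * eps * sqrt x * sqrt x) by (apply Rmult_le_compat_r; lra).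
    nra. }
  pose proof (ln_le_pred w Hw). lra.
Qed.

(** The margin of two keeps the distance [mu] to the range of the slope at least [2], as
    the telescoping of [log_ratio] evaluates it at [mu - 1]. *)
Definition outer_lo (h1 : R -> R) (x : R) : Z := (up (x * h1 0)%R - 2)%Z.
Definition outer_hi (h1 : R -> R) (x : R) : Z := (up (x * h1 PI) + 2)%Z.

Lemma outer_order h h1 h2 x : profile h h1 h2 -> 0 <= x -> (outer_lo h1 x <= outer_hi h1 x)%Z.
Proof.
  intros H Hx. pose proof PI_RGT_0. unfold outer_lo, outer_hi.
  pose proof (profile_slope_le h h1 h2 0 PI H ltac:(lra) ltac:(lra)) as Hle.
  apply (Rmult_le_compat_l x) in Hle; auto.
  destruct (archimed (x * h1 0)). destruct (archimed (x * h1 PI)).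
  apply Z.lt_le_incl, lt_IZR. rewrite plus_IZR, minus_IZR. lra.
Qed.

Lemma coefficient_sum_outer h h1 h2 x a b : profile h h1 h2 -> 0 <= x ->
  (a <= outer_lo h1 x)%Z -> (outer_hi h1 x <= b)%Z ->
  0 <= zsum (fun n => Rabs (coeff h x (IZR n))) a b
    - zsum (fun n => Rabs (coeff h x (IZR n))) (outer_lo h1 x) (outer_hi h1 x)
  <= 2 * ln (1 + x * (h1 PI - h1 0)).
Proof.
  intros H Hx Ha Hb. pose proof (outer_order h h1 h2 x H Hx) as Ho.
  rewrite (zsum_chasles _ a (outer_lo h1 x) b), (zsum_chasles _ (outer_lo h1 x) (outer_hi h1 x) b) by lia.
  pose proof (zsum_nonneg (fun n => Rabs (coeff h x (IZR n))) a (outer_lo h1 x) Ha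
    ltac:(intros; apply Rabs_pos)).
  pose proof (zsum_nonneg (fun n => Rabs (coeff h x (IZR n))) (outer_hi h1 x) b Hb
    ltac:(intros; apply Rabs_pos)).
  destruct (archimed (x * h1 0)). destruct (archimed (x * h1 PI)).
  pose proof (outer_sum_left h h1 h2 x a (outer_lo h1 x) H Hx Ha
    ltac:(unfold outer_lo; rewrite minus_IZR; lra)).
  pose proof (outer_sum_right h h1 h2 x (outer_hi h1 x) b H Hx Hb
    ltac:(unfold outer_hi; rewrite plus_IZR; lra)).
  lra.
Qed.

(** Split the frequencies into outside, edges and bulk, with the few near each end of
    the range bounded trivially; fix [delta] first and then let [x] grow. *)
Lemma coefficient_sum_limit h h1 h2 eps : profile h h1 h2 ->
  doubling_edge h2 -> doubling_edge (fun t => h2 (PI - t)) -> 0 < eps ->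
  for_large (fun x => forall a b, (a <= outer_lo h1 x)%Z -> (outer_hi h1 x <= b)%Z ->
    Rabs (zsum (fun n => Rabs (coeff h x (IZR n))) a b
      - 2 / PI * sqrt (2 * PI) * sqrt x * RInt (fun t => sqrt (h2 t)) 0 PI) <= eps * sqrt x).
Proof.
  intros H Hl Hr He. pose proof PI_RGT_0.
  destruct (edge_sum_left h h1 h2 H Hl) as (d1 & A1 & B1 & Hd1 & HA1 & HB1 & E1).
  destruct (edge_sum_right h h1 h2 H Hr) as (d2 & A2 & B2 & Hd2 & HA2 & HB2 & E2).
  assert (Hc : forall t, continuous (fun t => sqrt (h2 t)) t).
  { profile_cont. }
  destruct (continuous_bounded (fun t => sqrt (h2 t)) 0 PI Hc) as [M [HM HMb]].
  set (C := 2 / PI * sqrt (2 * PI)).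
  assert (HC : 0 <= C).
  { apply Rmult_le_pos; [apply Rlt_le, Rdiv_lt_0_compat; lra | apply sqrt_pos]. }
  (* [W * delta] bounds the edges of the sum, divided by [sqrt x] and up to [O(1)] terms,
     together with the edges of the limit integral *)
  set (W := (A1 + A2 + 2 * C) * M + 1).
  assert (HW : 0 < W).
  { assert (0 <= (A1 + A2 + 2 * C) * M) by (apply Rmult_le_pos; lra). unfold W. lra. }
  set (delta := Rmin (Rmin d1 d2) (eps / (4 * W))).
  assert (Hdel : 0 < delta /\ delta <= d1 /\ delta <= d2 /\ delta <= eps / (4 * W)).
  { unfold delta. pose proof (Rmin_l (Rmin d1 d2) (eps / (4 * W))).
    pose proof (Rmin_r (Rmin d1 d2) (eps / (4 * W))).
    pose proof (Rmin_l d1 d2). pose proof (Rmin_r d1 d2).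
    repeat split; try lra. repeat apply Rmin_glb_lt; try lra.
    apply Rdiv_lt_0_compat; lra. }
  assert (HWd : W * delta <= eps / 4).
  { replace (eps / 4) with (W * (eps / (4 * W))) by (field; lra). apply Rmult_le_compat_l; lra. }
  set (V := h1 PI - h1 0).
  pose proof (profile_slope_lt h h1 h2 0 delta H ltac:(lra) ltac:(lra)) as S1.
  pose proof (profile_slope_lt h h1 h2 delta (PI - delta) H ltac:(lra) ltac:(lra)) as S2.
  pose proof (profile_slope_lt h h1 h2 (PI - delta) PI H ltac:(lra) ltac:(lra)) as S3.
  pose proof (bulk_limit h h1 h2 delta (PI - delta) (eps / 8) H ltac:(lra) ltac:(lra) ltac:(lra)) as L1.
  pose proof (ln_small_sqrt V (eps / 8) ltac:(unfold V; lra) ltac:(lra)) as L2.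
  pose proof (for_large_sqrt_ge ((6 * PI + B1 * V + B2 * V) / (eps / 4))) as L3.
  pose proof (for_large_mul_ge 2 (h1 delta - h1 0) ltac:(lra)) as L4.
  pose proof (for_large_mul_ge 2 (h1 PI - h1 (PI - delta)) ltac:(lra)) as L5.
  apply (for_large_mono _ _ (for_large_and _ _ L1 (for_large_and _ _ L2
    (for_large_and _ _ L3 (for_large_and _ _ L4 L5))))).
  intros x Hx (K1 & K2 & K3 & K4 & K5) a b Ha Hb.
  set (u := fun n => Rabs (coeff h x (IZR n))) in *.
  assert (Hu : forall n, 0 <= u n <= PI).
  { intros n. split; [apply Rabs_pos | now apply (coeff_trivial h h1 h2)]. }
  pose proof (coefficient_sum_outer h h1 h2 x a b H ltac:(lra) Ha Hb) as Ko.
  fold u V in Ko.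
  assert (HBx : (6 * PI + B1 * V + B2 * V) <= eps / 4 * sqrt x).
  { apply (Rmult_le_compat_l (eps / 4)) in K3; [|lra].
    replace (eps / 4 * ((6 * PI + B1 * V + B2 * V) / (eps / 4))) with (6 * PI + B1 * V + B2 * V) in K3
      by (field; lra). exact K3. }
  unfold bulk_sum, bulk_lo in K1.
  set (b1 := up (x * h1 delta)) in *. set (b2 := up (x * h1 (PI - delta))) in *.
  set (a1 := (up (x * h1 0)%R + 1)%Z). set (a2 := (up (x * h1 PI) - 1)%Z).
  destruct (archimed (x * h1 0)) as [P1 P2]. destruct (archimed (x * h1 PI)) as [P3 P4].
  destruct (archimed (x * h1 delta)) as [P5 P6]. destruct (archimed (x * h1 (PI - delta))) as [P7 P8].
  fold b1 in P5, P6. fold b2 in P7, P8.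
  assert (Hxs : x * h1 delta < x * h1 (PI - delta)) by (apply Rmult_lt_compat_l; lra).
  assert (O1 : (a1 <= b1)%Z).
  { apply Z.lt_le_incl, lt_IZR. unfold a1. rewrite plus_IZR. lra. }
  assert (O2 : (b1 <= b2)%Z).
  { apply Z.lt_succ_r, lt_IZR. rewrite <- Z.add_1_r, plus_IZR. lra. }
  assert (O3 : (b2 <= a2)%Z).
  { apply Z.lt_succ_r, lt_IZR. rewrite <- Z.add_1_r, plus_IZR. unfold a2. rewrite minus_IZR. lra. }
  assert (O4 : (outer_lo h1 x <= a1)%Z) by (unfold outer_lo, a1; lia).
  assert (O5 : (a2 <= outer_hi h1 x)%Z) by (unfold outer_hi, a2; lia).
  rewrite (zsum_chasles u (outer_lo h1 x) a1 (outer_hi h1 x)), (zsum_chasles u a1 b1 (outer_hi h1 x)),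
    (zsum_chasles u b1 b2 (outer_hi h1 x)), (zsum_chasles u b2 a2 (outer_hi h1 x)) in Ko by lia.
  assert (N1 : 0 <= zsum u (outer_lo h1 x) a1 <= 3 * PI).
  { split; [apply zsum_nonneg; auto; intros; apply Hu|].
    eapply Rle_trans; [apply (zsum_le _ (fun _ => PI)); auto; intros; apply Hu|].
    rewrite zsum_const by auto. unfold outer_lo, a1. rewrite plus_IZR, minus_IZR. lra. }
  assert (N2 : 0 <= zsum u a2 (outer_hi h1 x) <= 3 * PI).
  { split; [apply zsum_nonneg; auto; intros; apply Hu|].
    eapply Rle_trans; [apply (zsum_le _ (fun _ => PI)); auto; intros; apply Hu|].
    rewrite zsum_const by auto. unfold outer_hi, a2. rewrite plus_IZR, minus_IZR. lra. }
  assert (N3 : 0 <= zsum u a1 b1) by (apply zsum_nonneg; auto; intros; apply Hu).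
  assert (N4 : 0 <= zsum u b2 a2) by (apply zsum_nonneg; auto; intros; apply Hu).
  pose proof (E1 x delta a1 b1 Hx ltac:(lra) O1 ltac:(unfold a1; rewrite plus_IZR; lra) ltac:(lra)) as Q1.
  pose proof (E2 x delta b2 a2 Hx ltac:(lra) O3 ltac:(lra) ltac:(unfold a2; rewrite minus_IZR; lra)) as Q2.
  fold u in Q1, Q2.
  assert (Hsx : 0 < sqrt x) by now apply sqrt_lt_R0.
  set (I1 := RInt (fun t => sqrt (h2 t)) 0 delta) in *.
  set (I2 := RInt (fun t => sqrt (h2 t)) (PI - delta) PI) in *.
  set (I0 := RInt (fun t => sqrt (h2 t)) delta (PI - delta)) in *.
  assert (EI : RInt (fun t => sqrt (h2 t)) 0 PI = I1 + (I0 + I2)).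
  { unfold I1, I0, I2. rewrite <- !RInt_chasles by auto. reflexivity. }
  assert (HI : forall v w, 0 <= v <= w -> w <= PI ->
    0 <= RInt (fun t => sqrt (h2 t)) v w <= M * (w - v)).
  { intros v w Hv Hw. split.
    - apply RInt_ge_0; [lra | now apply ex_RInt_cont | intros; apply sqrt_pos].
    - eapply Rle_trans; [apply Rle_abs|]. apply RInt_abs_bound; auto; [lra|].
      intros; apply HMb; lra. }
  pose proof (HI 0 delta ltac:(lra) ltac:(lra)) as HI1.
  pose proof (HI (PI - delta) PI ltac:(lra) ltac:(lra)) as HI2. fold I1 in HI1. fold I2 in HI2.
  rewrite EI. fold C in K1 |- *.
  assert (Hedge : A1 * I1 + A2 * I2 + C * I1 + C * I2 <= eps / 4).
  { apply Rle_trans with (W * delta); auto. unfold W.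
    assert (A1 * I1 <= A1 * (M * delta)) by (apply Rmult_le_compat_l; lra).
    assert (A2 * I2 <= A2 * (M * delta)) by (apply Rmult_le_compat_l; lra).
    assert (C * I1 <= C * (M * delta)) by (apply Rmult_le_compat_l; lra).
    assert (C * I2 <= C * (M * delta)) by (apply Rmult_le_compat_l; lra). lra. }
  apply (Rmult_le_compat_r (sqrt x)) in Hedge; [|lra].
  assert (R1 : B1 * (h1 delta - h1 0) <= B1 * V) by (apply Rmult_le_compat_l; unfold V; lra).
  assert (R2 : B2 * (h1 PI - h1 (PI - delta)) <= B2 * V) by (apply Rmult_le_compat_l; unfold V; lra).
  assert (Z1 : 0 <= C * sqrt x * I1) by (apply Rmult_le_pos; [apply Rmult_le_pos|]; lra).
  assert (Z2 : 0 <= C * sqrt x * I2) by (apply Rmult_le_pos; [apply Rmult_le_pos|]; lra).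
  assert (Z3 : 0 <= A1 * I1 * sqrt x) by (apply Rmult_le_pos; [apply Rmult_le_pos|]; lra).
  assert (Z4 : 0 <= A2 * I2 * sqrt x) by (apply Rmult_le_pos; [apply Rmult_le_pos|]; lra).
  assert (Z5 : 0 < eps * sqrt x) by (apply Rmult_lt_0_compat; lra).
  apply Rabs_le_between in K1. apply Rabs_le. lra.
Qed.

(** * Fourier inversion for twice differentiable functions *)

Lemma RInt_periodic (F : R -> R) c : (forall t, continuous F t) -> periodic_2pi F ->
  RInt F (c - PI) (c + PI) = RInt F (- PI) PI.
Proof.
  intros HF Hp.
  assert (Hd : forall s, is_derive (fun c => RInt F 0 (c + PI) - RInt F 0 (c - PI)) s 0).
  { intros s. apply is_derive_value with (1 * F (s + PI) - 1 * F (s - PI)).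
    - apply (is_derive_minus (fun c => RInt F 0 (c + PI)) (fun c => RInt F 0 (c - PI))).
      + apply (is_derive_comp (fun b => RInt F 0 b) (fun c => c + PI)).
        * now apply is_derive_RInt_cont.
        * auto_derive; [auto | eqR; ring].
      + apply (is_derive_comp (fun b => RInt F 0 b) (fun c => c - PI)).
        * now apply is_derive_RInt_cont.
        * auto_derive; [auto | eqR; ring].
    - replace (s + PI) with (s - PI + 2 * PI) by ring. rewrite Hp. ring. }
  pose proof (constant_of_derive_zero _ c Hd) as E. cbv beta in E.
  rewrite Rplus_0_l, Rminus_0_l in E.
  pose proof (RInt_chasles F 0 (c - PI) (c + PI) HF).
  pose proof (RInt_chasles F 0 (- PI) PI HF). lra.
Qed.

Lemma RInt_fold (F : R -> R) a : (forall t, continuous F t) ->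
  RInt F (- a) a = RInt (fun v => F v + F (- v)) 0 a.
Proof.
  intros HF. assert (HF' : forall t, continuous (fun v => F (- v)) t).
  { intros t. apply (cR_comp F); auto. apply (cR_opp (fun v => v)). cont. }
  rewrite RInt_add_cont by auto.
  pose proof (RInt_reflect F 0 0 a HF) as E. rewrite Rminus_0_l, Rminus_diag in E.
  rewrite (RInt_ext _ (fun v => F (- v))) in E by (intros; now rewrite Rminus_0_l).
  rewrite E, (RInt_chasles F (- a) 0 a) by auto. eqR. ring.
Qed.

Fixpoint dirichlet (N : nat) (v : R) : R :=
  match N with
  | O => 1
  | S k => dirichlet k v + 2 * cos (INR (S k) * v)
  end.

Lemma dirichlet_continuous N v : continuous (dirichlet N) v.
Proof.
  induction N as [|N IH]; [apply continuous_const|].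
  apply (cR_plus (dirichlet N)); auto. cont.
Qed.

Lemma dirichlet_bound N v : Rabs (dirichlet N v) <= 2 * INR N + 1.
Proof.
  induction N as [|N IH].
  - simpl. rewrite Rabs_R1. lra.
  - rewrite S_INR. cbn [dirichlet]. pose proof (COS_bound (INR (S N) * v)).
    apply Rabs_le_between in IH. apply Rabs_le. lra.
Qed.

Lemma dirichlet_even N v : dirichlet N (- v) = dirichlet N v.
Proof.
  induction N as [|N IH]; [reflexivity|]. cbn [dirichlet].
  rewrite IH, Ropp_mult_distr_r_reverse, cos_neg. reflexivity.
Qed.

Lemma dirichlet_periodic N : periodic_2pi (dirichlet N).
Proof.
  intros v. induction N as [|N IH]; [reflexivity|]. cbn [dirichlet]. rewrite IH.
  replace (INR (S N) * (v + 2 * PI)) with (INR (S N) * v + 2 * INR (S N) * PI) by ring.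
  now rewrite cos_period.
Qed.

Lemma dirichlet_closed N v : dirichlet N v * sin (v / 2) = sin ((INR N + / 2) * v).
Proof.
  induction N as [|N IH].
  - simpl. rewrite Rmult_1_l. f_equal. field.
  - cbn [dirichlet]. rewrite Rmult_plus_distr_r, IH, S_INR.
    replace ((INR N + / 2) * v) with ((INR N + 1) * v - v / 2) by field.
    replace ((INR N + 1 + / 2) * v) with ((INR N + 1) * v + v / 2) by field.
    rewrite sin_plus, sin_minus. ring.
Qed.

Lemma RInt_dirichlet N : RInt (dirichlet N) 0 PI = PI.
Proof.
  induction N as [|N IH].
  - rewrite (RInt_ext _ (fun _ => 1)) by reflexivity.
    rewrite RInt_constant. eqR. ring.
  - rewrite (RInt_ext _ (fun v => dirichlet N v + 2 * cos (INR (S N) * v))) by reflexivity.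
    assert (HK : 0 < INR (S N)) by (apply lt_0_INR; lia).
    rewrite RInt_add_cont, IH by (try apply dirichlet_continuous; cont).
    rewrite (RInt_ftc (fun v => 2 / INR (S N) * sin (INR (S N) * v))).
    + replace (sin (INR (S N) * PI)) with 0.
      * rewrite Rmult_0_r, (Rmult_0_r (INR (S N))), sin_0. eqR. ring.
      * symmetry. rewrite INR_IZR_INZ. apply sin_IZR_PI.
    + intros v. apply is_derive_value with (2 / INR (S N) * (INR (S N) * cos (INR (S N) * v))).
      * apply (is_derive_scal (fun v => sin (INR (S N) * v))).
        apply (is_derive_comp sin (fun v => INR (S N) * v)); [apply is_derive_sin|].
        apply is_derive_value with (INR (S N) * 1); [|ring].
        apply (is_derive_scal (fun v => v)), (is_derive_id v).
      * field. lra.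
    + cont.
Qed.

Lemma is_derive_sin_half t : is_derive (fun v => sin (v / 2)) t (/ 2 * cos (t / 2)).
Proof.
  apply (is_derive_comp sin (fun v => v / 2)); [apply is_derive_sin|].
  auto_derive; [auto | eqR; field].
Qed.

Lemma sin_half_lower v : 0 <= v <= PI -> v / 8 <= sin (v / 2).
Proof.
  intros Hv. pose proof PI_RGT_0. destruct (Rle_lt_dec v (2 * (PI / 3))) as [Hle|Hlt].
  - assert (E : sin (0 / 2) - 0 / 8 <= sin (v / 2) - v / 8).
    { apply (nondecreasing_of_derive (fun v => sin (v / 2) - v / 8)
        (fun v => / 2 * cos (v / 2) - / 8)); [lra | |].
      - intros t _. apply (is_derive_minus (fun v => sin (v / 2)) (fun v => v / 8)).
        + apply is_derive_sin_half.
        + auto_derive; [auto | eqR; field].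
      - intros t Ht. assert (cos (PI / 3) <= cos (t / 2)) by (apply cos_decr_1; lra).
        rewrite cos_PI3 in *. lra. }
    replace (0 / 2) with 0 in E by field. rewrite sin_0 in E. lra.
  - assert (Hs : sin (PI / 6) <= sin (v / 2)).
    { apply Rle_trans with (sin (PI / 3)); [|apply sin_incr_1; lra].
      apply sin_incr_1; lra. }
    rewrite sin_PI6 in Hs. pose proof PI_4. lra.
Qed.

(** Near zero the integrand is trivially small, since [w] vanishes to second
    order; away from zero [w / sin (v/2)] has bounded derivative, and one
    integration by parts gains the frequency. Splitting at [1 / (N+1)] avoids the
    removable singularity. *)
Lemma dirichlet_integral_small (w w1 : R -> R) B N : 0 <= B ->
  (forall v, is_derive w v (w1 v)) ->
  (forall v, 0 <= v <= PI -> Rabs (w v) <= B * v * v) ->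
  (forall v, 0 <= v <= PI -> Rabs (w1 v) <= B * v) ->
  Rabs (RInt (fun v => w v * dirichlet N v) 0 PI) <= 1000 * B / (INR N + 1).
Proof.
  intros HB Hd Hw Hw1. pose proof PI_RGT_0. pose proof PI_4. pose proof PI2_1. pose proof (pos_INR N) as HN.
  set (eta := / (INR N + 1)). set (K := INR N + / 2).
  assert (He : 0 < eta <= 1).
  { split; [apply Rinv_0_lt_compat; lra|]. rewrite <- Rinv_1. apply Rinv_le_contravar; lra. }
  assert (HeN : eta * (INR N + 1) = 1) by (unfold eta; field; lra).
  assert (HK : 0 < K) by (unfold K; lra).
  assert (HKe : / K <= 2 * eta).
  { replace (2 * eta) with (/ ((INR N + 1) / 2)) by (unfold eta; field; lra).
    apply Rinv_le_contravar; unfold K; lra. }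
  assert (HK0 : 0 < / K) by now apply Rinv_0_lt_compat.
  pose proof (dirichlet_continuous N) as HDc.
  assert (Hc : forall v, continuous (fun v => w v * dirichlet N v) v) by cont.
  rewrite (RInt_chasles _ 0 eta PI) by auto.
  assert (B1 : Rabs (RInt (fun v => w v * dirichlet N v) 0 eta) <= 2 * B * eta * (eta - 0)).
  { apply RInt_abs_bound; auto; [lra|]. intros v Hv. rewrite Rabs_mult.
    apply Rle_trans with (B * eta * eta * (2 * INR N + 1)).
    - apply Rmult_le_compat; auto using Rabs_pos, dirichlet_bound.
      eapply Rle_trans; [apply Hw; lra|].
      rewrite !Rmult_assoc. apply Rmult_le_compat_l; auto. apply Rmult_le_compat; lra.
    - replace (B * eta * eta * (2 * INR N + 1)) with (B * eta * (2 * (eta * (INR N + 1)) - eta)) by ring.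
      rewrite HeN. assert (0 <= B * eta) by (apply Rmult_le_pos; lra). nra. }
  set (G := fun v => w v / sin (v / 2)).
  set (G1 := fun v => w1 v / sin (v / 2) - w v * (/ 2 * cos (v / 2)) / (sin (v / 2) * sin (v / 2))).
  assert (Hs : forall v, eta <= v <= PI -> 0 < sin (v / 2)).
  { intros v Hv. pose proof (sin_half_lower v ltac:(lra)). lra. }
  assert (Hsi : forall v, eta <= v <= PI -> 0 < / sin (v / 2) <= 8 / v).
  { intros v Hv. split; [apply Rinv_0_lt_compat; auto|].
    replace (8 / v) with (/ (v / 8)) by (field; lra).
    apply Rinv_le_contravar; [lra|]. apply sin_half_lower. lra. }
  assert (HG : forall v, eta <= v <= PI -> Rabs (G v) <= 32 * B).
  { intros v Hv. unfold G, Rdiv. rewrite Rabs_mult, (Rabs_right (/ _)) by (apply Rle_ge, Rlt_le, Hsi; auto).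
    apply Rle_trans with (B * v * v * (8 / v)).
    - apply Rmult_le_compat; auto using Rabs_pos; [apply Rlt_le, Hsi; auto | apply Hw; lra | apply Hsi; auto].
    - replace (B * v * v * (8 / v)) with (8 * B * v) by (field; lra).
      replace (32 * B) with (8 * B * 4) by ring. apply Rmult_le_compat_l; lra. }
  assert (HG1 : forall v, eta <= v <= PI -> Rabs (G1 v) <= 40 * B).
  { intros v Hv. unfold G1. pose proof (Hsi v Hv) as [S1 S2].
    assert (T1 : Rabs (w1 v / sin (v / 2)) <= 8 * B).
    { unfold Rdiv. rewrite Rabs_mult, (Rabs_right (/ _)) by lra.
      replace (8 * B) with (B * v * (8 / v)) by (field; lra).
      apply Rmult_le_compat; auto using Rabs_pos; [lra | apply Hw1; lra]. }
    assert (T2 : Rabs (w v * (/ 2 * cos (v / 2)) / (sin (v / 2) * sin (v / 2))) <= 32 * B).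
    { unfold Rdiv at 1. rewrite Rinv_mult, !Rabs_mult, (Rabs_right (/ sin (v / 2))), (Rabs_right (/ 2)) by lra.
      assert (Hcos : Rabs (cos (v / 2)) <= 1) by apply Rabs_cos_le.
      replace (32 * B) with (B * v * v * (/ 2 * 1) * (8 / v * (8 / v))) by (field; lra).
      pose proof (Rabs_pos (cos (v / 2))).
      apply Rmult_le_compat.
      - apply Rmult_le_pos; [apply Rabs_pos | lra].
      - apply Rmult_le_pos; lra.
      - apply Rmult_le_compat; auto using Rabs_pos; [lra | apply Hw; lra | lra].
      - apply Rmult_le_compat; lra. }
    apply Rabs_le_between in T1, T2. apply Rabs_le. lra. }
  assert (B2 : Rabs (RInt (fun v => w v * dirichlet N v) eta PI + G PI * (cos (K * PI) / K)
    - (RInt (fun v => w v * dirichlet N v) eta eta + G eta * (cos (K * eta) / K)))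
    <= 40 * B * / K * PI - 40 * B * / K * eta).
  { apply (increment_bound
      (fun t => RInt (fun v => w v * dirichlet N v) eta t + G t * (cos (K * t) / K))
      (fun t => 40 * B * / K * t) (fun t => G1 t * (cos (K * t) / K)) (fun _ => 40 * B * / K)); [lra | | |].
    - intros t Ht. pose proof (Hs t Ht) as Hst.
      apply is_derive_value with (w t * dirichlet N t
        + (G1 t * (cos (K * t) / K) + G t * (- sin (K * t)))).
      + apply (is_derive_plus (fun t => RInt (fun v => w v * dirichlet N v) eta t)
          (fun t => G t * (cos (K * t) / K))).
        * now apply (is_derive_RInt_cont (fun v => w v * dirichlet N v)).
        * apply (is_derive_mult G (fun t => cos (K * t) / K)); [ | | intros; apply Rmult_comm].
          -- apply is_derive_value with
               ((w1 t * sin (t / 2) - w t * (/ 2 * cos (t / 2))) / sin (t / 2) ^ 2).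
             ++ apply (is_derive_div w (fun v => sin (v / 2)));
                  [apply Hd | apply is_derive_sin_half | lra].
             ++ unfold G1. field. lra.
          -- auto_derive; [auto | eqR; field; lra].
      + unfold G. fold K. replace (sin (K * t)) with (dirichlet N t * sin (t / 2))
          by apply dirichlet_closed. field. lra.
    - intros t _. apply is_derive_value with (40 * B * / K * 1); [|ring].
      apply (is_derive_scal (fun t => t)), (is_derive_id t).
    - intros t Ht. rewrite Rabs_mult. unfold Rdiv. rewrite Rabs_mult, (Rabs_right (/ K)) by lra.
      assert (Rabs (cos (K * t)) <= 1) by apply Rabs_cos_le.
      pose proof (Rabs_pos (cos (K * t))). pose proof (HG1 t Ht).
      rewrite <- Rmult_assoc. apply Rmult_le_compat_r; [lra|].
      pose proof (Rabs_pos (G1 t)). nra. }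
  rewrite (RInt_point eta (fun v => w v * dirichlet N v)) in B2. unfold zero in B2; simpl in B2.
  assert (B3 : forall v, eta <= v <= PI -> Rabs (G v * (cos (K * v) / K)) <= 32 * B * / K).
  { intros v Hv. rewrite Rabs_mult. unfold Rdiv. rewrite Rabs_mult, (Rabs_right (/ K)) by lra.
    assert (Rabs (cos (K * v)) <= 1) by apply Rabs_cos_le.
    pose proof (Rabs_pos (cos (K * v))). pose proof (HG v Hv). pose proof (Rabs_pos (G v)).
    rewrite <- Rmult_assoc. apply Rmult_le_compat_r; [lra|]. nra. }
  pose proof (B3 PI ltac:(lra)) as B4. pose proof (B3 eta ltac:(lra)) as B5.
  assert (HBK : 0 <= B * / K <= 2 * (B * eta)).
  { split; [apply Rmult_le_pos; lra|]. replace (2 * (B * eta)) with (B * (2 * eta)) by ring.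
    apply Rmult_le_compat_l; lra. }
  assert (HBe : 0 <= B * eta) by (apply Rmult_le_pos; lra).
  assert (B6 : 2 * B * eta * (eta - 0) <= 2 * (B * eta)).
  { replace (2 * B * eta * (eta - 0)) with (2 * (B * eta) * eta) by ring.
    rewrite <- (Rmult_1_r (2 * (B * eta))) at 2. apply Rmult_le_compat_l; lra. }
  assert (B7 : 40 * B * / K * PI - 40 * B * / K * eta <= 160 * (B * / K)).
  { replace (40 * B * / K * PI - 40 * B * / K * eta) with (40 * (B * / K) * (PI - eta)) by ring.
    replace (160 * (B * / K)) with (40 * (B * / K) * 4) by ring. apply Rmult_le_compat_l; lra. }
  replace (1000 * B / (INR N + 1)) with (1000 * (B * eta)) by (unfold eta; field; lra).
  apply Rabs_le_between in B1, B2, B4, B5. apply Rabs_le. lra.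
Qed.

(** Folding by the evenness of the kernel replaces [g (t - v) - g t] by a symmetric second
    difference, which vanishes to second order at [v = 0]. *)
Lemma fourier_inversion (g g1 g2 : R -> R) t : periodic_2pi g ->
  (forall s, is_derive g s (g1 s)) -> (forall s, is_derive g1 s (g2 s)) ->
  (forall s, continuous g2 s) ->
  is_lim_seq (fun N => RInt (fun s => g s * dirichlet N (t - s)) (- PI) PI) (2 * PI * g t).
Proof.
  intros Hp Hg1 Hg2 Hc2. pose proof PI_RGT_0.
  destruct (continuous_bounded g2 (t - PI) (t + PI) Hc2) as [M [HM HMb]].
  set (w := fun v => g (t - v) + g (t + v) - 2 * g t).
  set (w1 := fun v => g1 (t + v) - g1 (t - v)).
  assert (Hwd : forall v, is_derive w v (w1 v)).
  { intros v. apply is_derive_value with (-1 * g1 (t - v) + 1 * g1 (t + v) - 0); [|unfold w1; ring].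
    apply (is_derive_minus (fun v => g (t - v) + g (t + v)) (fun _ => 2 * g t));
      [|apply (is_derive_const (2 * g t))].
    apply (is_derive_plus (fun v => g (t - v)) (fun v => g (t + v))).
    - apply (is_derive_comp g (fun v => t - v)); auto. auto_derive; [auto | eqR; ring].
    - apply (is_derive_comp g (fun v => t + v)); auto. auto_derive; [auto | eqR; ring]. }
  assert (Hw1 : forall v, 0 <= v <= PI -> Rabs (w1 v) <= 2 * M * v).
  { intros v Hv. unfold w1.
    replace (2 * M * v) with (M * Rabs (t + v - (t - v))) by (rewrite Rabs_right; lra).
    apply (lipschitz_bound g1 g2); auto. intros s Hs. apply HMb.
    rewrite Rmin_left, Rmax_right in Hs by lra. lra. }
  assert (Hw : forall v, 0 <= v <= PI -> Rabs (w v) <= 2 * M * v * v).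
  { intros v Hv.
    replace (w v) with (w v - w 0) by (unfold w; rewrite Rminus_0_r, Rplus_0_r; ring).
    replace (2 * M * v * v) with (2 * M * v * Rabs (v - 0)) by (rewrite Rabs_right; lra).
    apply (lipschitz_bound w w1); auto. intros s Hs.
    rewrite Rmin_left, Rmax_right in Hs by lra.
    eapply Rle_trans; [apply Hw1; lra|]. apply Rmult_le_compat_l; lra. }
  assert (Hgc : forall s, continuous g s) by cont.
  assert (E : forall N, RInt (fun s => g s * dirichlet N (t - s)) (- PI) PI
    = RInt (fun v => w v * dirichlet N v) 0 PI + 2 * PI * g t).
  { intros N. pose proof (dirichlet_continuous N) as HDc.
    assert (Hc : forall s, continuous (fun s => g s * dirichlet N (t - s)) s) by cont.
    rewrite <- (RInt_periodic (fun s => g s * dirichlet N (t - s)) t Hc).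
    2: { intros s. rewrite Hp. f_equal.
         rewrite <- (dirichlet_periodic N (t - (s + 2 * PI))). f_equal. ring. }
    replace (t + PI) with (t - - PI) by ring.
    rewrite <- (RInt_reflect (fun s => g s * dirichlet N (t - s)) t (- PI) PI Hc).
    rewrite (RInt_ext _ (fun v => g (t - v) * dirichlet N v)).
    2: { intros v _. f_equal. f_equal. ring. }
    rewrite RInt_fold by cont.
    rewrite (RInt_ext _ (fun v => w v * dirichlet N v + 2 * g t * dirichlet N v)).
    2: { intros v _. rewrite dirichlet_even. unfold w.
         replace (t - - v) with (t + v) by ring. eqR. ring. }
    rewrite RInt_add_cont, RInt_scal_cont, RInt_dirichlet; auto; [eqR; ring | |].
    - intros v. unfold w. cont.
    - cont. }
  apply (is_lim_seq_ext (fun N => RInt (fun v => w v * dirichlet N v) 0 PI + 2 * PI * g t));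
    [intros N; now rewrite E|].
  replace (Finite (2 * PI * g t)) with (Finite (0 + 2 * PI * g t)) by (f_equal; ring).
  apply is_lim_seq_plus'; [|apply is_lim_seq_const].
  apply is_lim_seq_abs_0.
  apply (is_lim_seq_le_le (fun _ => 0) _ (fun N => 1000 * (2 * M) * / INR (S N))).
  - intros N. split; [apply Rabs_pos|].
    rewrite S_INR. apply (dirichlet_integral_small w w1); auto. lra.
  - apply is_lim_seq_const.
  - replace (Finite 0) with (Rbar_mult (1000 * (2 * M)) 0) by (simpl; f_equal; ring).
    apply is_lim_seq_scal_l.
    apply (is_lim_seq_incr_1 (fun n => / INR n)).
    replace (Finite 0) with (Rbar_inv p_infty) by reflexivity.
    apply is_lim_seq_inv; [apply is_lim_seq_INR | discriminate].
Qed.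

(** * Two-sided series *)

Lemma sum_n_nonneg_part (a : Z -> R) n : sum_n (nonneg_part a) n = zsum a 0 (Z.of_nat (S n)).
Proof.
  induction n as [|n IH].
  - rewrite sum_O. unfold nonneg_part. simpl Z.of_nat.
    change 1%Z with (0 + 1)%Z. rewrite zsum_succ, zsum_same by lia. eqR. ring.
  - rewrite sum_Sn, IH. unfold plus; simpl plus. unfold nonneg_part.
    rewrite (Nat2Z.inj_succ (S n)), <- Z.add_1_r, (zsum_succ _ _ (Z.of_nat (S n))) by lia. reflexivity.
Qed.

Lemma sum_n_neg_part (a : Z -> R) n : sum_n (neg_part a) n = zsum a (- Z.of_nat (S n)) 0.
Proof.
  induction n as [|n IH].
  - rewrite sum_O. unfold neg_part. simpl Z.of_nat.
    transitivity (zsum a (-1) (-1 + 1)); [|reflexivity].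
    rewrite zsum_succ, zsum_same by lia. eqR. unfold neg_part. simpl. ring.
  - rewrite sum_Sn, IH. unfold neg_part.
    rewrite (zsum_chasles a (- Z.of_nat (S (S n))) (- Z.of_nat (S n)) 0) by lia.
    replace (- Z.of_nat (S n))%Z with (- Z.of_nat (S (S n)) + 1)%Z at 2 by lia.
    rewrite zsum_succ, zsum_same by lia.
    match goal with |- plus ?u ?v = ?w => change (u + v = w) end. ring.
Qed.

Lemma ex_Zseries_bounded u B : (forall n, 0 <= u n) ->
  (forall a b, (a <= b)%Z -> zsum u a b <= B) -> ex_Zseries u.
Proof.
  intros Hu HB. split.
  - destruct (ex_finite_lim_seq_incr (sum_n (nonneg_part u)) B) as [l Hl].
    + intros n. rewrite sum_Sn. unfold plus; simpl. pose proof (Hu (Z.of_nat (S n))).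
      unfold nonneg_part at 3. lra.
    + intros n. rewrite sum_n_nonneg_part. apply HB. lia.
    + exists l. exact Hl.
  - destruct (ex_finite_lim_seq_incr (sum_n (neg_part u)) B) as [l Hl].
    + intros n. rewrite sum_Sn. unfold plus; simpl. pose proof (Hu (- Z.of_nat (S (S n)))%Z).
      unfold neg_part at 3. lra.
    + intros n. rewrite sum_n_neg_part. apply HB. lia.
    + exists l. exact Hl.
Qed.

Lemma Zseries_limit a : ex_Zseries a ->
  is_lim_seq (fun N => zsum a (- Z.of_nat (S N)) (Z.of_nat (S N))) (Zseries a).
Proof.
  intros [H1 H2]. unfold Zseries.
  apply (is_lim_seq_ext (fun N => sum_n (nonneg_part a) N + sum_n (neg_part a) N)).
  - intros N. rewrite sum_n_nonneg_part, sum_n_neg_part.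
    rewrite (zsum_chasles a (- Z.of_nat (S N)) 0 (Z.of_nat (S N))) by lia. ring.
  - apply is_lim_seq_plus'; [exact (Series_correct _ H1) | exact (Series_correct _ H2)].
Qed.

Lemma ex_Zseries_dominated a u : (forall n, Rabs (a n) <= u n) -> ex_Zseries u -> ex_Zseries a.
Proof.
  intros Hau [H1 H2]. split.
  - apply (ex_series_le (K := R_AbsRing) (V := R_CompleteNormedModule) _ (nonneg_part u)); auto.
    intros n. apply Hau.
  - apply (ex_series_le (K := R_AbsRing) (V := R_CompleteNormedModule) _ (neg_part u)); auto.
    intros n. apply Hau.
Qed.

Lemma is_series_C (a : nat -> C) (l1 l2 : R) :
  is_series (fun n => fst (a n)) l1 -> is_series (fun n => snd (a n)) l2 ->
  is_series (K := R_AbsRing) (V := C_R_NormedModule) a (l1, l2).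
Proof.
  intros H1 H2.
  assert (E : forall n, sum_n (G := C_R_NormedModule) a n
    = (sum_n (fun n => fst (a n)) n, sum_n (fun n => snd (a n)) n)).
  { induction n as [|n IH].
    - rewrite !sum_O. apply surjective_pairing.
    - rewrite !sum_Sn, IH. reflexivity. }
  apply filterlim_locally. intros eps.
  pose proof (proj1 (filterlim_locally _ _) H1 eps) as B1.
  pose proof (proj1 (filterlim_locally _ _) H2 eps) as B2.
  generalize (filter_and _ _ B1 B2). apply filter_imp. intros n [C1 C2].
  rewrite E. split; assumption.
Qed.

(** * The coefficients of [exp (i x h)] *)

Lemma RInt_odd (F : R -> R) a : (forall t, continuous F t) -> (forall t, F (- t) = - F t) ->
  RInt F (- a) a = 0.
Proof.
  intros HF Ho. rewrite RInt_fold by auto. rewrite (RInt_ext _ (fun _ => 0)).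
  - rewrite RInt_constant. eqR. ring.
  - intros t _. rewrite Ho. apply Rplus_opp_r.
Qed.

Lemma RInt_even (F : R -> R) a : (forall t, continuous F t) -> (forall t, F (- t) = F t) ->
  RInt F (- a) a = 2 * RInt F 0 a.
Proof.
  intros HF He. rewrite RInt_fold, <- RInt_scal_cont by auto. apply RInt_ext.
  intros t _. rewrite He. eqR. ring.
Qed.

Lemma coeff_full_period h x y : (forall t, continuous h t) -> (forall t, h (- t) = - h t) ->
  RInt (fun t => cos (x * h t - y * t)) (- PI) PI = 2 * coeff h x y /\
  RInt (fun t => sin (x * h t - y * t)) (- PI) PI = 0.
Proof.
  intros Hc Ho. split.
  - apply (RInt_even (fun t => cos (x * h t - y * t))); [cont|]. intros t. rewrite Ho.
    replace (x * - h t - y * - t) with (- (x * h t - y * t)) by ring. apply cos_neg.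
  - apply RInt_odd; [cont|]. intros t. rewrite Ho.
    replace (x * - h t - y * - t) with (- (x * h t - y * t)) by ring. apply sin_neg.
Qed.

Lemma Cis_mult u v : (Cis u * Cis v)%C = Cis (u + v).
Proof.
  unfold Cis, Cmult; simpl. rewrite cos_plus, sin_plus. f_equal. ring.
Qed.

Lemma is_RInt_Cis (f : R -> R) a b : (forall t, continuous f t) ->
  is_RInt (V := C_R_NormedModule) (fun t => Cis (f t)) a b
    (RInt (fun t => cos (f t)) a b, RInt (fun t => sin (f t)) a b).
Proof.
  intros Hf. apply is_RInt_fct_extend_pair.
  - apply (RInt_correct (V := R_CompleteNormedModule) (fun t => cos (f t))), ex_RInt_cont. cont.
  - apply (RInt_correct (V := R_CompleteNormedModule) (fun t => sin (f t))), ex_RInt_cont. cont.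
Qed.

Lemma fourier_coeff_eq h x n : (forall t, continuous h t) -> (forall t, h (- t) = - h t) ->
  fourier_coeff (fun t => Cis (x * h t)) n = RtoC (coeff h x (IZR n) / PI).
Proof.
  intros Hc Ho. pose proof PI_RGT_0. unfold fourier_coeff.
  destruct (coeff_full_period h x (IZR n) Hc Ho) as [E1 E2].
  rewrite (is_RInt_unique (V := C_R_CompleteNormedModule) _ _ _
    (2 * coeff h x (IZR n), 0)).
  - unfold RtoC, Cmult; simpl. f_equal; field; lra.
  - rewrite <- E1, <- E2.
    apply (is_RInt_ext (V := C_R_NormedModule) (fun t => Cis (x * h t - IZR n * t))).
    + intros t _. now rewrite Cis_mult.
    + apply (is_RInt_Cis (fun t => x * h t - IZR n * t)). cont.
Qed.

Lemma Rabs_div_PI y : Rabs (y / PI) = Rabs y / PI.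
Proof. pose proof PI_RGT_0. rewrite Rabs_div by lra. now rewrite (Rabs_right PI) by lra. Qed.

Lemma coeff_opp h x y : coeff h (- x) (- y) = coeff h x y.
Proof.
  unfold coeff. apply RInt_ext. intros t _.
  replace (- x * h t - - y * t) with (- (x * h t - y * t)) by ring. apply cos_neg.
Qed.

(** Conjugation, which exchanges [(x, n)] and [(-x, -n)], reduces to [x >= 0]. *)
Lemma coefficient_sum_bounded h h1 h2 x : profile h h1 h2 ->
  exists B, forall a b, (a <= b)%Z -> zsum (fun n => Rabs (coeff h x (IZR n))) a b <= B.
Proof.
  intros H.
  assert (Hpos : forall x, 0 <= x ->
    exists B, forall a b, (a <= b)%Z -> zsum (fun n => Rabs (coeff h x (IZR n))) a b <= B).
  { clear x. intros x Hx.
    exists (zsum (fun n => Rabs (coeff h x (IZR n))) (outer_lo h1 x) (outer_hi h1 x)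
      + 2 * ln (1 + x * (h1 PI - h1 0))).
    intros a b Hab.
    pose proof (coefficient_sum_outer h h1 h2 x (Z.min a (outer_lo h1 x)) (Z.max b (outer_hi h1 x))
      H Hx ltac:(lia) ltac:(lia)) as B.
    rewrite (zsum_chasles _ (Z.min a (outer_lo h1 x)) a), (zsum_chasles _ a b) in B by lia.
    assert (P : forall u v, (u <= v)%Z -> 0 <= zsum (fun n => Rabs (coeff h x (IZR n))) u v)
      by (intros; apply zsum_nonneg; auto; intros; apply Rabs_pos).
    pose proof (P (Z.min a (outer_lo h1 x)) a ltac:(lia)).
    pose proof (P b (Z.max b (outer_hi h1 x)) ltac:(lia)). lra. }
  destruct (Rle_lt_dec 0 x) as [Hx|Hx]; auto.
  destruct (Hpos (- x) ltac:(lra)) as [B HB]. exists B. intros a b Hab.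
  rewrite zsum_opp by auto.
  rewrite (zsum_ext _ (fun n => Rabs (coeff h (- x) (IZR n)))).
  - apply HB. lia.
  - lia.
  - intros n _. now rewrite opp_IZR, <- coeff_opp, Ropp_involutive.
Qed.

Lemma coefficient_sum_convergent h h1 h2 x : profile h h1 h2 ->
  ex_Zseries (fun n => Rabs (coeff h x (IZR n)) / PI).
Proof.
  intros H. pose proof PI_RGT_0. destruct (coefficient_sum_bounded h h1 h2 x H) as [B HB].
  apply (ex_Zseries_bounded _ (/ PI * B)).
  - intros n. apply Rmult_le_pos; [apply Rabs_pos | apply Rlt_le, Rinv_0_lt_compat; lra].
  - intros a b Hab.
    rewrite (zsum_ext _ (fun n => / PI * Rabs (coeff h x (IZR n))))
      by (auto; intros; unfold Rdiv; ring).
    rewrite zsum_scal by auto. apply Rmult_le_compat_l; [apply Rlt_le, Rinv_0_lt_compat; lra | auto].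
Qed.

(** Taking [c = 0] and [c = - pi/2] gives the real and imaginary parts of the
    Fourier series of [exp (i x h)]. *)
Lemma coefficient_partial_sum h x c t N : (forall t, continuous h t) ->
  (forall t, h (- t) = - h t) ->
  zsum (fun n => coeff h x (IZR n) / PI * cos (IZR n * t + c)) (- Z.of_nat N) (Z.of_nat N + 1)
  = / (2 * PI) * RInt (fun s => cos (x * h s + c) * dirichlet N (t - s)) (- PI) PI.
Proof.
  intros Hc Ho. pose proof PI_RGT_0.
  assert (E : forall y, coeff h x y / PI * cos (y * t + c)
    = / (2 * PI) * RInt (fun s => cos (x * h s + c + y * (t - s))) (- PI) PI).
  { intros y. destruct (coeff_full_period h x y Hc Ho) as [E1 E2].
    rewrite (RInt_ext _ (fun s => cos (y * t + c) * cos (x * h s - y * s)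
      - sin (y * t + c) * sin (x * h s - y * s))).
    - rewrite RInt_sub_cont, !RInt_scal_cont, E1, E2 by cont. field. lra.
    - intros s _. rewrite <- cos_plus. f_equal. eqR. ring. }
  induction N as [|N IH].
  - simpl Z.of_nat. change (- 0)%Z with 0%Z. rewrite zsum_succ, zsum_same by lia. rewrite E, Rplus_0_l.
    f_equal. apply RInt_ext. intros s _. simpl. rewrite Rmult_0_l, Rplus_0_r. ring.
  - rewrite zsum_succ by lia.
    rewrite (zsum_chasles _ (- Z.of_nat (S N)) (- Z.of_nat N)) by lia.
    replace (Z.of_nat (S N)) with (Z.of_nat N + 1)%Z at 2 by lia. rewrite IH.
    replace (- Z.of_nat N)%Z with (- Z.of_nat (S N) + 1)%Z by lia.
    rewrite zsum_succ, zsum_same, !E by lia.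
    rewrite Rplus_0_l, <- !Rmult_plus_distr_l. f_equal.
    pose proof (dirichlet_continuous N) as HD. pose proof (dirichlet_continuous (S N)) as HD'.
    rewrite <- !RInt_add_cont by cont.
    apply RInt_ext. intros s _. cbn [dirichlet].
    rewrite opp_IZR, <- INR_IZR_INZ.
    replace (x * h s + c + - INR (S N) * (t - s)) with (x * h s + c - INR (S N) * (t - s)) by ring.
    rewrite (cos_plus (x * h s + c)), cos_minus. eqR. ring.
Qed.

Lemma coefficient_series h h1 h2 x c t : profile h h1 h2 -> periodic_2pi h ->
  (forall t, h (- t) = - h t) ->
  ex_Zseries (fun n => coeff h x (IZR n) / PI * cos (IZR n * t + c)) /\
  Zseries (fun n => coeff h x (IZR n) / PI * cos (IZR n * t + c)) = cos (x * h t + c).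
Proof.
  intros H Hp Ho. pose proof PI_RGT_0.
  pose proof (profile_derive _ _ _ H) as Hd. pose proof (profile_derive2 _ _ _ H) as Hd2.
  pose proof (profile_continuous _ _ _ H) as Hc2.
  assert (Hhc : forall s, continuous h s) by cont.
  set (a := fun n => coeff h x (IZR n) / PI * cos (IZR n * t + c)).
  assert (Ha : forall n, Rabs (a n) <= Rabs (coeff h x (IZR n)) / PI).
  { intros n. unfold a. rewrite Rabs_mult, Rabs_div_PI. unfold Rdiv.
    assert (Rabs (cos (IZR n * t + c)) <= 1) by apply Rabs_cos_le.
    assert (0 <= Rabs (coeff h x (IZR n)) * / PI).
    { apply Rmult_le_pos; [apply Rabs_pos | apply Rlt_le, Rinv_0_lt_compat; lra]. }
    rewrite <- (Rmult_1_r (Rabs (coeff h x (IZR n)) * / PI)) at 2. now apply Rmult_le_compat_l. }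
  pose proof (coefficient_sum_convergent h h1 h2 x H) as Hu.
  pose proof (ex_Zseries_dominated a _ Ha Hu) as Hex.
  split; [exact Hex|].
  pose proof (Zseries_limit a Hex) as L.
  assert (L1 : is_lim_seq (fun N => zsum a (- Z.of_nat N) (Z.of_nat N + 1)) (cos (x * h t + c))).
  { replace (Finite (cos (x * h t + c)))
      with (Rbar_mult (/ (2 * PI)) (Finite (2 * PI * cos (x * h t + c)))).
    2: { simpl. f_equal. field. lra. }
    apply (is_lim_seq_ext (fun N => / (2 * PI)
      * RInt (fun s => cos (x * h s + c) * dirichlet N (t - s)) (- PI) PI)).
    { intros N. symmetry. exact (coefficient_partial_sum h x c t N Hhc Ho). }
    apply is_lim_seq_scal_l.
    assert (Hph : forall s, is_derive (fun s => x * h s + c) s (x * h1 s)).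
    { intros s. apply is_derive_value with (x * h1 s + 0); [|ring].
      apply (is_derive_plus (fun s => x * h s) (fun _ => c)); [|apply (is_derive_const c)].
      now apply (is_derive_scal h). }
    apply (fourier_inversion (fun s => cos (x * h s + c))
      (fun s => - (x * h1 s) * sin (x * h s + c))
      (fun s => - (x * h2 s) * sin (x * h s + c)
        + - (x * h1 s) * (x * h1 s * cos (x * h s + c)))).
    - intros s. now rewrite Hp.
    - intros s. apply is_derive_value with (x * h1 s * - sin (x * h s + c)); [|ring].
      apply (is_derive_comp cos (fun s => x * h s + c)); auto. apply is_derive_cos.
    - intros s. apply (is_derive_mult (fun s => - (x * h1 s)) (fun s => sin (x * h s + c)));
        [ | | intros; apply Rmult_comm].
      + apply (is_derive_opp (fun s => x * h1 s)). now apply (is_derive_scal h1).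
      + apply (is_derive_comp sin (fun s => x * h s + c)); auto. apply is_derive_sin.
    - cont. }
  (* the window [-(N+1), N] differs from [-N, N] by one vanishing term *)
  assert (L2 : is_lim_seq (fun N => neg_part a N) 0).
  { apply ex_series_lim_0, Hex. }
  assert (L3 : is_lim_seq (fun N => zsum a (- Z.of_nat (S N)) (Z.of_nat (S N)))
    (0 + cos (x * h t + c))).
  { apply (is_lim_seq_ext (fun N => neg_part a N + zsum a (- Z.of_nat N) (Z.of_nat N + 1))).
    - intros N. rewrite (zsum_chasles a (- Z.of_nat (S N)) (- Z.of_nat N) (Z.of_nat (S N))) by lia.
      replace (Z.of_nat (S N)) with (Z.of_nat N + 1)%Z at 2 by lia. f_equal.
      unfold neg_part. replace (- Z.of_nat N)%Z with (- Z.of_nat (S N) + 1)%Z by lia.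
      rewrite zsum_succ, zsum_same by lia. ring.
    - now apply is_lim_seq_plus'. }
  apply is_lim_seq_unique in L. apply is_lim_seq_unique in L3. rewrite L in L3.
  apply Rbar_finite_eq in L3. lra.
Qed.

Lemma exp_phase_abs_conv h h1 h2 x : profile h h1 h2 -> periodic_2pi h ->
  (forall t, h (- t) = - h t) -> abs_conv_fourier (fun t => Cis (x * h t)).
Proof.
  intros H Hp Ho.
  assert (Hc : forall t, continuous h t).
  { intros t. eapply cR_derive. apply H. }
  split; [|split; [|split]].
  - intros t. now rewrite Hp.
  - eexists. apply (is_RInt_Cis (fun t => x * h t)). cont.
  - apply (ex_Zseries_dominated _ (fun n => Rabs (coeff h x (IZR n)) / PI)).
    + intros n. rewrite fourier_coeff_eq, Cmod_R, Rabs_Rabsolu, Rabs_div_PI by auto. lra.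
    + now apply (coefficient_sum_convergent h h1 h2).
  - intros t.
    destruct (coefficient_series h h1 h2 x 0 t H Hp Ho) as [[X1 X2] X3].
    destruct (coefficient_series h h1 h2 x (- (PI / 2)) t H Hp Ho) as [[Y1 Y2] Y3].
    set (a := fun n => coeff h x (IZR n) / PI * cos (IZR n * t + 0)) in *.
    set (b := fun n => coeff h x (IZR n) / PI * cos (IZR n * t + - (PI / 2))) in *.
    assert (Ef : forall n, (fourier_coeff (fun t => Cis (x * h t)) n * Cis (IZR n * t))%C = (a n, b n)).
    { intros n. rewrite fourier_coeff_eq by auto. unfold a, b. rewrite Rplus_0_r.
      change (IZR n * t + - (PI / 2)) with (IZR n * t - PI / 2). rewrite cos_sub_half_pi.
      unfold RtoC, Cis, Cmult; simpl. f_equal; ring. }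
    exists (Series (nonneg_part a), Series (nonneg_part b)).
    exists (Series (neg_part a), Series (neg_part b)).
    split; [|split].
    + apply is_series_C.
      * apply (is_series_ext (nonneg_part a)); [|now apply Series_correct].
        intros n. unfold nonneg_part. now rewrite Ef.
      * apply (is_series_ext (nonneg_part b)); [|now apply Series_correct].
        intros n. unfold nonneg_part. now rewrite Ef.
    + apply is_series_C.
      * apply (is_series_ext (neg_part a)); [|now apply Series_correct].
        intros n. unfold neg_part. now rewrite Ef.
      * apply (is_series_ext (neg_part b)); [|now apply Series_correct].
        intros n. unfold neg_part. now rewrite Ef.
    + unfold Cplus; simpl. fold (Zseries a) (Zseries b). rewrite X3, Y3, Rplus_0_r.
      change (x * h t + - (PI / 2)) with (x * h t - PI / 2). now rewrite cos_sub_half_pi.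
Qed.

(** * The limit *)

Lemma A_norm_exp_phase h x : (forall t, continuous h t) -> (forall t, h (- t) = - h t) ->
  A_norm (fun t => Cis (x * h t)) = Zseries (fun n => Rabs (coeff h x (IZR n)) / PI).
Proof.
  intros Hc Ho. pose proof PI_RGT_0.
  assert (E : forall n, Cmod (fourier_coeff (fun t => Cis (x * h t)) n) = Rabs (coeff h x (IZR n)) / PI).
  { intros n. rewrite fourier_coeff_eq, Cmod_R by auto.
    apply Rabs_div_PI. }
  unfold A_norm, Zseries. f_equal; apply Series_ext; intros n; apply E.
Qed.

Lemma A_norm_asymptotics h h1 h2 eps : profile h h1 h2 -> (forall t, h (- t) = - h t) ->
  doubling_edge h2 -> doubling_edge (fun t => h2 (PI - t)) -> 0 < eps ->
  for_large (fun x => Rabs (PI * A_norm (fun t => Cis (x * h t))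
    - 2 / PI * sqrt (2 * PI) * sqrt x * RInt (fun t => sqrt (h2 t)) 0 PI) <= eps * sqrt x).
Proof.
  intros H Ho Hl Hr He. pose proof PI_RGT_0.
  apply (for_large_mono _ _ (coefficient_sum_limit h h1 h2 eps H Hl Hr He)).
  intros x Hx B. set (J := 2 / PI * sqrt (2 * PI) * sqrt x * RInt (fun t => sqrt (h2 t)) 0 PI) in *.
  rewrite A_norm_exp_phase; auto.
  2: { intros t. eapply cR_derive. apply H. }
  pose proof (Zseries_limit _ (coefficient_sum_convergent h h1 h2 x H)) as L.
  set (S := Zseries _) in *.
  apply (is_lim_seq_scal_l _ PI) in L.
  assert (L2 : is_lim_seq (fun N => Rabs (PI * zsum (fun n => Rabs (coeff h x (IZR n)) / PI)
    (- Z.of_nat (Datatypes.S N)) (Z.of_nat (Datatypes.S N)) - J)) (Rabs (PI * S - J))).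
  { apply (is_lim_seq_abs _ (Finite (PI * S - J))).
    apply is_lim_seq_minus'; [exact L | apply is_lim_seq_const]. }
  apply (is_lim_seq_le_loc _ (fun _ => eps * sqrt x) _ (Finite (eps * sqrt x))) in L2.
  - exact L2.
  - exists (Z.to_nat (Z.max (- outer_lo h1 x) (outer_hi h1 x))). intros N HN.
    rewrite <- zsum_scal by lia.
    rewrite (zsum_ext _ (fun n => Rabs (coeff h x (IZR n)))).
    + apply B; lia.
    + lia.
    + intros n _. field. lra.
  - apply is_lim_seq_const.
Qed.

Lemma limit_constant : Rpower (2 / PI) (3 / 2) = 2 / PI * sqrt (2 * PI) / PI.
Proof.
  pose proof PI_RGT_0.
  assert (Hp : 0 < 2 / PI) by (apply Rdiv_lt_0_compat; lra).
  replace (3 / 2) with (1 + / 2) by field.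
  rewrite Rpower_plus, Rpower_1, Rpower_sqrt by auto.
  replace (2 / PI) with (2 * PI / (PI * PI)) at 2 by (field; lra).
  rewrite sqrt_div by nra. rewrite sqrt_square by lra. field. lra.
Qed.

Lemma profile_intro h s : C2 h -> periodic_2pi h ->
  (forall t, 0 < t < PI -> Derive_n h 2 t <> 0) -> (forall t, h (- t) = - h t) ->
  0 < s < PI -> 0 < Derive_n h 2 s -> profile h (Derive h) (Derive_n h 2).
Proof.
  intros (Hd & Hd2 & Hc) Hp Hn Ho Hs Hps. pose proof PI_RGT_0.
  assert (Hcont : continuity (Derive_n h 2)).
  { intros t. apply continuity_pt_filterlim, Hc. }
  (* a negative value would force a zero between its argument and [s] *)
  assert (Hnn : forall t, 0 <= t <= PI -> 0 <= Derive_n h 2 t).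
  { intros t Ht. apply Rnot_lt_le. intros Hneg.
    destruct (IVT_gen (Derive_n h 2) t s 0 Hcont) as [r [Hr Er]].
    - rewrite Rmin_left, Rmax_right by lra. lra.
    - apply (Hn r); auto.
      assert (r <> t) by (intros ->; lra).
      revert Hr. unfold Rmin, Rmax. destruct (Rle_dec t s); lra. }
  split; auto.
  - intros t. now apply Derive_correct.
  - intros t. exact (Derive_correct _ _ (Hd2 t)).
  - intros t Ht. specialize (Hnn t ltac:(lra)). specialize (Hn t Ht). lra.
  - pose proof (Ho 0) as E. rewrite Ropp_0 in E. lra.
  - pose proof (Ho PI) as E. pose proof (Hp (- PI)) as E'.
    replace (- PI + 2 * PI) with PI in E' by ring. lra.
Qed.

Theorem theorem2 (h : R -> R)
  (h_C2 : C2 h)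
  (h_periodic : periodic_2pi h)
  (h2_neq0 : forall t : R, 0 < t < PI -> Derive_n h 2 t <> 0)
  (h_odd : forall t : R, h (- t) = - h t)
  (h_doubling : exists (m0 mpi : R -> R) (c K : R),
    0 < c /\ 0 < K /\
    (forall t : R, 0 < t < 4 * c -> 0 < m0 t) /\
    (forall t : R, 0 < t < 4 * c -> 0 < mpi t) /\
    nondecreasing_on m0 0 (4 * c) /\
    nondecreasing_on mpi 0 (4 * c) /\
    (forall t : R, 0 < t < 2 * c ->
       m0 (2 * t) / m0 t <= K /\ mpi (2 * t) / mpi t <= K) /\
    (forall t : R, 0 < t < 4 * c ->
       m0 t <= Derive_n h 2 t <= K * m0 t /\
       mpi t <= Derive_n h 2 (PI - t) <= K * mpi t)) :
  (forall x : R, abs_conv_fourier (fun t : R => Cis (x * h t))) /\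
  is_lim (fun x : R => / sqrt x * A_norm (fun t : R => Cis (x * h t)))
    p_infty
    (Finite (Rpower (2 / PI) (3 / 2) *
             RInt (fun t : R => sqrt (Derive_n h 2 t)) 0 PI)).
Proof.
  pose proof PI_RGT_0 as HPI.
  destruct h_doubling as (m0 & mpi & c & K & Hc & HK & Hm0 & Hmpi & Hi0 & Hipi & Hdb & Hcmp).
  assert (H : profile h (Derive h) (Derive_n h 2)).
  { set (s := Rmin c 1).
    assert (Hs : 0 < s /\ s <= c /\ s <= 1).
    { unfold s. pose proof (Rmin_l c 1). pose proof (Rmin_r c 1).
      repeat split; auto. apply Rmin_glb_lt; lra. }
    pose proof PI2_1.
    apply (profile_intro h s); auto; [lra|].
    pose proof (Hm0 s ltac:(lra)). pose proof (Hcmp s ltac:(lra)). lra. }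
  assert (Hl : doubling_edge (Derive_n h 2)).
  { exists m0, c, K. refine (conj Hc (conj HK (conj Hm0 (conj Hi0 (conj _ _)))));
      intros t Ht; [apply Hdb | apply Hcmp]; exact Ht. }
  assert (Hr : doubling_edge (fun t => Derive_n h 2 (PI - t))).
  { exists mpi, c, K. refine (conj Hc (conj HK (conj Hmpi (conj Hipi (conj _ _)))));
      intros t Ht; [apply Hdb | apply Hcmp]; exact Ht. }
  split.
  - intros x. now apply (exp_phase_abs_conv h (Derive h) (Derive_n h 2)).
  - apply is_lim_spec. intros eps.
    set (e := PI * eps / 2).
    assert (He : 0 < e) by (unfold e; pose proof (cond_pos eps); nra).
    destruct (A_norm_asymptotics h _ _ e H h_odd Hl Hr He) as [X [HX HB]].
    exists X. intros x Hx. specialize (HB x ltac:(lra)).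
    assert (Hsx : 0 < sqrt x) by (apply sqrt_lt_R0; lra).
    rewrite limit_constant.
    set (A := A_norm _) in *. set (I := RInt _ 0 PI) in *.
    apply Rle_lt_trans with (eps / 2); [|pose proof (cond_pos eps); lra].
    apply (Rmult_le_reg_l (PI * sqrt x)); [nra|].
    rewrite <- (Rabs_right (PI * sqrt x)) at 1 by nra. rewrite <- Rabs_mult.
    replace (PI * sqrt x * (/ sqrt x * A - 2 / PI * sqrt (2 * PI) / PI * I))
      with (PI * A - 2 / PI * sqrt (2 * PI) * sqrt x * I) by (field; lra).
    replace (PI * sqrt x * (eps / 2)) with (e * sqrt x) by (unfold e; field).
    exact HB.
Qed.
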